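(* Every bounded domain $R\subset\mathbb{R}^3$ with regular (smooth) boundary admits a complete proper minimal immersion $\psi:\mathbb{D}\to R$ of the open unit disk $\mathbb{D}$.
   Context: An immersion $\psi:\mathbb{D}\to R$ is proper if preimages of compact subsets of $R$ are compact; it is complete if the metric it induces on $\mathbb{D}$ is complete. *)

(* Defs.v *)
From Stdlib Require Import Reals Lra List Sorted.
From Coquelicot Require Import Coquelicot.
Open Scope R_scope.

Definition R2 := (R * R)%type.
Definition R3 := (R * R * R)%type.

Definition c1 (x : R3) : R := fst (fst x).
Definition c2 (x : R3) : R := snd (fst x).
Definition c3 (x : R3) : R := snd x.
Definition mk3 (a b c : R) : R3 := ((a, b), c).

Definition add3 (x y : R3) : R3 := mk3 (c1 x + c1 y) (c2 x + c2 y) (c3 x + c3 y).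
Definition sub3 (x y : R3) : R3 := mk3 (c1 x - c1 y) (c2 x - c2 y) (c3 x - c3 y).
Definition scal3 (a : R) (x : R3) : R3 := mk3 (a * c1 x) (a * c2 x) (a * c3 x).
Definition dot3 (x y : R3) : R := c1 x * c1 y + c2 x * c2 y + c3 x * c3 y.
Definition cross3 (x y : R3) : R3 :=
  mk3 (c2 x * c3 y - c3 x * c2 y) (c3 x * c1 y - c1 x * c3 y) (c1 x * c2 y - c2 x * c1 y).
Definition norm3 (x : R3) : R := sqrt (dot3 x x).
Definition dist3 (x y : R3) : R := norm3 (sub3 x y).
Definition dist2 (p q : R2) : R := sqrt ((fst p - fst q)^2 + (snd p - snd q)^2).

Definition disk (p : R2) : Prop := fst p ^ 2 + snd p ^ 2 < 1.

Definition compact_set {T : UniformSpace} (K : T -> Prop) : Prop :=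
  forall (I : Type) (U : I -> T -> Prop),
    (forall i, open (U i)) -> (forall x, K x -> exists i, U i x) ->
    exists l : list I, forall x, K x -> exists i, In i l /\ U i x.

Definition connected_set {T : UniformSpace} (S : T -> Prop) : Prop :=
  ~ (exists U V : T -> Prop, open U /\ open V /\
       (forall x, S x -> U x \/ V x) /\
       (exists x, S x /\ U x) /\ (exists x, S x /\ V x) /\
       (forall x, S x -> U x -> V x -> False)).

Definition bounded_domain (O : R3 -> Prop) : Prop :=
  (exists x, O x) /\ open O /\ connected_set O /\
  exists M : R, forall x, O x -> norm3 x <= M.

Definition part2 (i : bool) (f : R2 -> R) : R2 -> R :=
  fun p => if i then Derive (fun t => f (t, snd p)) (fst p)
           else Derive (fun t => f (fst p, t)) (snd p).
Definition ex_part2 (i : bool) (f : R2 -> R) (p : R2) : Prop :=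
  if i then ex_derive (fun t => f (t, snd p)) (fst p)
  else ex_derive (fun t => f (fst p, t)) (snd p).
Definition iter_part2 (ds : list bool) (f : R2 -> R) : R2 -> R :=
  fold_right part2 f ds.
Definition Cinf2 (U : R2 -> Prop) (f : R2 -> R) : Prop :=
  forall (ds : list bool) (p : R2), U p ->
    continuous (iter_part2 ds f) p /\ forall i, ex_part2 i (iter_part2 ds f) p.

Inductive dir3 := X1 | X2 | X3.
Definition part3 (i : dir3) (f : R3 -> R) : R3 -> R :=
  fun x => match i with
  | X1 => Derive (fun t => f (mk3 t (c2 x) (c3 x))) (c1 x)
  | X2 => Derive (fun t => f (mk3 (c1 x) t (c3 x))) (c2 x)
  | X3 => Derive (fun t => f (mk3 (c1 x) (c2 x) t)) (c3 x)
  end.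
Definition ex_part3 (i : dir3) (f : R3 -> R) (x : R3) : Prop :=
  match i with
  | X1 => ex_derive (fun t => f (mk3 t (c2 x) (c3 x))) (c1 x)
  | X2 => ex_derive (fun t => f (mk3 (c1 x) t (c3 x))) (c2 x)
  | X3 => ex_derive (fun t => f (mk3 (c1 x) (c2 x) t)) (c3 x)
  end.
Definition iter_part3 (ds : list dir3) (f : R3 -> R) : R3 -> R :=
  fold_right part3 f ds.
Definition Cinf3 (U : R3 -> Prop) (f : R3 -> R) : Prop :=
  forall (ds : list dir3) (x : R3), U x ->
    continuous (iter_part3 ds f) x /\ forall i, ex_part3 i (iter_part3 ds f) x.

Definition ball3 (p : R3) (r : R) (x : R3) : Prop := dist3 x p < r.
Definition boundary_pt (O : R3 -> Prop) (p : R3) : Prop :=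
  ~ O p /\ forall eps, 0 < eps -> exists x, O x /\ dist3 x p < eps.
Definition smooth_boundary (O : R3 -> Prop) : Prop :=
  forall p, boundary_pt O p ->
    exists (r : R) (f : R3 -> R), 0 < r /\ Cinf3 (ball3 p r) f /\
      (forall x, ball3 p r x -> (O x <-> f x < 0)) /\
      (forall x, ball3 p r x -> f x = 0 ->
         part3 X1 f x <> 0 \/ part3 X2 f x <> 0 \/ part3 X3 f x <> 0).

Definition comp1 (psi : R2 -> R3) : R2 -> R := fun p => c1 (psi p).
Definition comp2 (psi : R2 -> R3) : R2 -> R := fun p => c2 (psi p).
Definition comp3 (psi : R2 -> R3) : R2 -> R := fun p => c3 (psi p).

Definition dpsi (ds : list bool) (psi : R2 -> R3) (p : R2) : R3 :=
  mk3 (iter_part2 ds (comp1 psi) p) (iter_part2 ds (comp2 psi) p)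
      (iter_part2 ds (comp3 psi) p).

Definition smooth_on_disk (psi : R2 -> R3) : Prop :=
  Cinf2 disk (comp1 psi) /\ Cinf2 disk (comp2 psi) /\ Cinf2 disk (comp3 psi).

Definition immersion (psi : R2 -> R3) : Prop :=
  smooth_on_disk psi /\
  forall p, disk p -> forall a b : R,
    add3 (scal3 a (dpsi (true :: nil) psi p)) (scal3 b (dpsi (false :: nil) psi p)) = mk3 0 0 0 ->
    a = 0 /\ b = 0.

Definition mean_curvature (psi : R2 -> R3) (p : R2) : R :=
  let Xu := dpsi (true :: nil) psi p in
  let Xv := dpsi (false :: nil) psi p in
  let Xuu := dpsi (true :: true :: nil) psi p in
  let Xuv := dpsi (true :: false :: nil) psi p in
  let Xvv := dpsi (false :: false :: nil) psi p in
  let n := scal3 (/ norm3 (cross3 Xu Xv)) (cross3 Xu Xv) in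
  let E := dot3 Xu Xu in let F := dot3 Xu Xv in let G := dot3 Xv Xv in
  let L := dot3 Xuu n in let M := dot3 Xuv n in let N := dot3 Xvv n in
  (E * N - 2 * F * M + G * L) / (2 * (E * G - F ^ 2)).

Definition minimal_immersion (psi : R2 -> R3) : Prop :=
  immersion psi /\ forall p, disk p -> mean_curvature psi p = 0.

Fixpoint polylen (c : R -> R3) (l : list R) : R :=
  match l with
  | a :: ((b :: _) as l') => dist3 (c a) (c b) + polylen c l'
  | _ => 0
  end.
Definition partition01 (l : list R) : Prop :=
  Sorted Rlt l /\ nth 0 l 1 = 0 /\ last l 0 = 1.
Definition curve_length (c : R -> R3) : Rbar :=
  Lub_Rbar (fun L => exists l, partition01 l /\ L = polylen c l).
Definition disk_path (g : R -> R2) (p q : R2) : Prop :=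
  (forall t, continuous g t) /\ (forall t, 0 <= t <= 1 -> disk (g t)) /\
  g 0 = p /\ g 1 = q.
Definition induced_dist (psi : R2 -> R3) (p q : R2) : Rbar :=
  Glb_Rbar (fun L => exists g, disk_path g p q /\
                       curve_length (fun t => psi (g t)) = Finite L).

Definition complete_immersion (psi : R2 -> R3) : Prop :=
  forall x : nat -> R2, (forall n, disk (x n)) ->
    (forall eps, 0 < eps -> exists N, forall m n, (N <= m)%nat -> (N <= n)%nat ->
        Rbar_lt (induced_dist psi (x m) (x n)) (Finite eps)) ->
    exists y, disk y /\ forall eps, 0 < eps -> exists N, forall n, (N <= n)%nat ->
        Rbar_lt (induced_dist psi (x n) y) (Finite eps).

Definition proper_into (psi : R2 -> R3) (O : R3 -> Prop) : Prop :=
  forall K : R3 -> Prop, (forall x, K x -> O x) -> compact_set K ->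
    compact_set (fun p : R2 => disk p /\ K (psi p)).

(* Main.v *)
From Stdlib Require Import Reals Lra Lia List Sorted Classical ClassicalEpsilon.
From Coquelicot Require Import Coquelicot.
Require Import Defs.
Import ListNotations.

(** Near a point [p] of the boundary at maximal distance from the origin, a defining function [f] of
    the domain increases quadratically along the planes tangent to its level sets. The immersion is
    a limit of maps [Re F], with [F' = q(P, Q)] for polynomial spinors [(P, Q)].

    Replacing [(P, Q)] by [(P, Q) + sqrt(2N+1) z^N eta], where [eta] is a Laurent polynomial, changes
    [F] into [F + z^(2N+1) q(eta) + O(N^(-1/2))]: for large [N] each boundary point is replaced by a
    point of a circle of prescribed centre, radius and plane, and almost nothing changes on smaller
    discs. Used with the planes tangent to the level sets of [f] and squared radii proportional to
    [|f|], this drives the boundary into the boundary of the domain, with geometrically decaying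
    displacements. Used [m] times with radius [r] of order [1/m] and the planes orthogonal to the
    accumulated displacement, it moves the surface by [sqrt(m r^2)] only, while every step increases
    the intrinsic distance to the boundary by a fixed multiple of [r]. Alternating both and passing
    to the limit yields a proper and complete surface. *)

(** * Polynomials as coefficient lists *)

(** At a point farthest from the origin the domain lies inside a sphere touching it there, so the
    boundary bends at least as much as that sphere; the surface never leaves a small ball around
    this point. Perturbing the spinor instead of [F'] keeps the null condition for free. The
    amplitude [sqrt(2N+1)] is the one for which the quadratic term [(2N+1) z^(2N) q(eta)] integrates
    to size one, while the cross term, of order [sqrt N], loses a factor [N] on integration. The
    obstacle is to find [eta] continuously along the circle when only the planes are prescribed. The
    stereographic spinor of the normal direction is continuous off one half-axis, so the normal
    field has to avoid it: for the cap a choice of sign of the gradient suffices, for the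
    accumulated displacement a tiny generic translation. Every gain must survive infinitely many
    later steps, so it is stored with slack: [tol] and [sd] say how much may still be spoiled.
    Lengths are not computed as integrals: a function that changes no faster than the surface
    distance bounds from below the length of every continuous path. *)

Fixpoint peval (p : list C) (z : C) : C :=
  match p with nil => RtoC 0 | a :: p' => (a + z * peval p' z)%C end.
(** The coefficient norm dominates the supremum on the disc of radius [r], is submultiplicative, and
    controls derivatives on smaller discs. It stands in for uniform convergence and Cauchy estimates
    throughout. *)
Fixpoint pnorm (r : R) (p : list C) : R :=
  match p with nil => 0 | a :: p' => Cmod a + r * pnorm r p' end.
Fixpoint padd (p q : list C) : list C :=
  match p, q with
  | nil, _ => q
  | _, nil => p
  | a :: p', b :: q' => (a + b)%C :: padd p' q'
  end.
Fixpoint pscale (c : C) (p : list C) : list C :=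
  match p with nil => nil | a :: p' => (c * a)%C :: pscale c p' end.
Fixpoint pmul (p q : list C) : list C :=
  match p with nil => nil | a :: p' => padd (pscale a q) (RtoC 0 :: pmul p' q) end.
Fixpoint pshift (n : nat) (p : list C) : list C :=
  match n with O => p | S n' => RtoC 0 :: pshift n' p end.
(** [z^(n+1) * primn n p] is the primitive of [z^n * p] vanishing at 0. The offset lets a high power
    be factored out of a primitive, which makes the gain [1/n] visible. *)
Fixpoint primn (n : nat) (p : list C) : list C :=
  match p with nil => nil | a :: p' => (a / RtoC (INR (S n)))%C :: primn (S n) p' end.
Definition prim (p : list C) : list C := RtoC 0 :: primn 0 p.
Fixpoint pder (p : list C) : list C :=
  match p with nil => nil | _ :: p' => padd p' (RtoC 0 :: pder p') end.

Lemma peval_padd p q z : peval (padd p q) z = (peval p z + peval q z)%C.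
Proof.
  revert q; induction p as [|a p IH]; intros [|b q]; simpl; try ring.
  rewrite IH; ring.
Qed.

Lemma peval_pscale c p z : peval (pscale c p) z = (c * peval p z)%C.
Proof. induction p as [|a p IH]; simpl; [ring|]. rewrite IH; ring. Qed.

Lemma peval_pmul p q z : peval (pmul p q) z = (peval p z * peval q z)%C.
Proof.
  induction p as [|a p IH]; simpl; [ring|].
  rewrite peval_padd, peval_pscale; simpl; rewrite IH; ring.
Qed.

Lemma peval_pshift n p z : peval (pshift n p) z = (z ^ n * peval p z)%C.
Proof. induction n as [|n IH]; simpl; [ring|]. rewrite IH; ring. Qed.

Lemma pnorm_ge0 r p : 0 <= r -> 0 <= pnorm r p.
Proof.
  intros Hr; induction p as [|a p IH]; simpl; [lra|].
  pose proof (Cmod_ge_0 a); nra.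
Qed.

Lemma pnorm_padd r p q : 0 <= r -> pnorm r (padd p q) <= pnorm r p + pnorm r q.
Proof.
  intros Hr; revert q; induction p as [|a p IH]; intros [|b q]; simpl; try lra.
  specialize (IH q). pose proof (Cmod_triangle a b). nra.
Qed.

Lemma pnorm_pscale r c p : pnorm r (pscale c p) = Cmod c * pnorm r p.
Proof.
  induction p as [|a p IH]; simpl; [ring|].
  rewrite IH, Cmod_mult; ring.
Qed.

Lemma pnorm_pmul r p q : 0 <= r -> pnorm r (pmul p q) <= pnorm r p * pnorm r q.
Proof.
  intros Hr; induction p as [|a p IH]; simpl; [lra|].
  eapply Rle_trans; [apply pnorm_padd; lra|]. rewrite pnorm_pscale; simpl.
  rewrite Cmod_0. nra.
Qed.

Lemma pnorm_pshift r n p : pnorm r (pshift n p) = r ^ n * pnorm r p.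
Proof. induction n as [|n IH]; simpl; [ring|]. rewrite IH, Cmod_0; ring. Qed.

Lemma pnorm_mono r r' p : 0 <= r <= r' -> pnorm r p <= pnorm r' p.
Proof.
  intros Hr; induction p as [|a p IH]; simpl; [lra|].
  pose proof (pnorm_ge0 r p ltac:(lra)). nra.
Qed.

Lemma Cmod_peval_le r p z : Cmod z <= r -> Cmod (peval p z) <= pnorm r p.
Proof.
  intros Hz; pose proof (Cmod_ge_0 z).
  induction p as [|a p IH]; simpl; [rewrite Cmod_0; lra|].
  eapply Rle_trans; [apply Cmod_triangle|]. rewrite Cmod_mult.
  pose proof (pnorm_ge0 r p ltac:(lra)). pose proof (Cmod_ge_0 (peval p z)). nra.
Qed.

(** A Cauchy estimate without integrals: the loss [1/(r' - r)] reproduces itself in the Horner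
    recursion, since [r/(r' - r) + 1 = r'/(r' - r)]. The quadratic remainder and the norm of the
    derivative are bounded below by the same mechanism. *)
Lemma peval_lipschitz r r' p z h : 0 <= r < r' -> Cmod z <= r -> Cmod (z + h) <= r ->
  Cmod (peval p (z + h) - peval p z) <= Cmod h * pnorm r' p / (r' - r).
Proof.
  intros Hr Hz Hzh. pose proof (Cmod_ge_0 h) as Hh.
  induction p as [|a p IH]; simpl.
  - unfold Cminus; rewrite Cplus_opp_r, Cmod_0. unfold Rdiv; lra.
  - replace (a + (z + h) * peval p (z + h) - (a + z * peval p z))%C
      with (z * (peval p (z + h) - peval p z) + h * peval p (z + h))%C by ring.
    eapply Rle_trans; [apply Cmod_triangle|]. rewrite !Cmod_mult.
    pose proof (Cmod_peval_le r p _ Hzh) as H1.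
    pose proof (pnorm_mono r r' p ltac:(lra)) as H2.
    pose proof (pnorm_ge0 r' p ltac:(lra)) as H3.
    pose proof (Cmod_ge_0 a) as Ha.
    apply Rle_trans with (r * (Cmod h * pnorm r' p / (r' - r)) + Cmod h * pnorm r' p).
    + apply Rplus_le_compat.
      * apply Rmult_le_compat; try apply Cmod_ge_0; auto.
      * apply Rmult_le_compat_l; lra.
    + replace (r * (Cmod h * pnorm r' p / (r' - r)) + Cmod h * pnorm r' p)
        with (Cmod h * (r' * pnorm r' p) / (r' - r)) by (field; lra).
      unfold Rdiv. apply Rmult_le_compat_r.
      * left; apply Rinv_0_lt_compat; lra.
      * apply Rmult_le_compat_l; lra.
Qed.

Lemma peval_quadratic_remainder r r' p z h : 0 <= r < r' -> Cmod z <= r -> Cmod (z + h) <= r ->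
  Cmod (peval p (z + h) - peval p z - h * peval (pder p) z) <= (Cmod h)^2 * pnorm r' p / (r' - r)^2.
Proof.
  intros Hr Hz Hzh. pose proof (Cmod_ge_0 h) as Hh.
  assert (Hpos : 0 < (r' - r)^2) by (apply pow_lt; lra).
  induction p as [|a p IH].
  - simpl peval; simpl pnorm.
    replace (0 - 0 - h * 0)%C with (RtoC 0) by ring. rewrite Cmod_0.
    unfold Rdiv; lra.
  - simpl pder. rewrite peval_padd. simpl peval; simpl pnorm.
    replace (a + (z + h) * peval p (z + h) - (a + z * peval p z)
             - h * (peval p z + (0 + z * peval (pder p) z)))%C
      with (z * (peval p (z + h) - peval p z - h * peval (pder p) z) + h * (peval p (z + h) - peval p z))%C
      by ring.
    eapply Rle_trans; [apply Cmod_triangle|]. rewrite !Cmod_mult.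
    pose proof (peval_lipschitz r r' p z h Hr Hz Hzh) as H1.
    pose proof (pnorm_ge0 r' p ltac:(lra)) as H3.
    pose proof (Cmod_ge_0 a) as Ha.
    apply Rle_trans with (r * ((Cmod h)^2 * pnorm r' p / (r' - r)^2)
                          + Cmod h * (Cmod h * pnorm r' p / (r' - r))).
    + apply Rplus_le_compat.
      * apply Rmult_le_compat; try apply Cmod_ge_0; auto.
      * apply Rmult_le_compat_l; lra.
    + replace (r * ((Cmod h)^2 * pnorm r' p / (r' - r)^2)
                          + Cmod h * (Cmod h * pnorm r' p / (r' - r)))
        with ((Cmod h)^2 * (r' * pnorm r' p) / (r' - r)^2) by (field; lra).
      unfold Rdiv. apply Rmult_le_compat_r.
      * left; apply Rinv_0_lt_compat; lra.
      * apply Rmult_le_compat_l; [apply pow2_ge_0|lra].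
Qed.

Lemma pnorm_pder r r' p : 0 <= r < r' -> pnorm r (pder p) <= pnorm r' p / (r' - r).
Proof.
  intros Hr; induction p as [|a p IH]; simpl.
  - unfold Rdiv; lra.
  - eapply Rle_trans; [apply pnorm_padd; lra|]. simpl. rewrite Cmod_0.
    pose proof (pnorm_mono r r' p ltac:(lra)) as H2.
    pose proof (Cmod_ge_0 a) as Ha.
    apply Rle_trans with (pnorm r' p + r * (pnorm r' p / (r' - r))); [nra|].
    replace (pnorm r' p + r * (pnorm r' p / (r' - r))) with ((r' * pnorm r' p) / (r' - r))
      by (field; lra).
    unfold Rdiv. apply Rmult_le_compat_r; [left; apply Rinv_0_lt_compat; lra|lra].
Qed.

Lemma padd_assoc p q s : padd p (padd q s) = padd (padd p q) s.
Proof.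
  revert q s; induction p as [|a p IH]; intros [|b q] [|c s]; simpl; auto.
  rewrite IH; f_equal; ring.
Qed.

Lemma padd_nil_r p : padd p nil = p.
Proof. destruct p; reflexivity. Qed.

Lemma RtoC_S_neq n : RtoC (INR (S n)) <> RtoC 0.
Proof. intros H; apply RtoC_inj in H; revert H; apply not_0_INR; lia. Qed.

(** This is [(z^(n+1) u)' = z^n p] for [u = primn n p], divided by [z^n]. The trailing zero comes
    from [pder], which keeps the length of a list. *)
Lemma padd_primn_pder n p :
  padd (pscale (RtoC (INR (S n))) (primn n p)) (RtoC 0 :: pder (primn n p)) = p ++ [RtoC 0].
Proof.
  revert n; induction p as [|a p IH]; intros n; [reflexivity|].
  cbn [primn pder pscale padd app]. f_equal.
  - field. apply RtoC_S_neq.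
  - rewrite <- (IH (S n)). rewrite padd_assoc. f_equal.
    generalize (primn (S n) p) as q; intro q. rewrite (S_INR (S n)), RtoC_plus.
    induction q as [|b q IHq]; [reflexivity|]. cbn [pscale padd]. f_equal; [ring|].
    exact IHq.
Qed.

Lemma pder_prim p : pder (prim p) = p ++ [RtoC 0].
Proof.
  rewrite <- (padd_primn_pder 0 p). unfold prim; simpl pder at 1. f_equal.
  change (INR 1) with 1. induction (primn 0 p) as [|b q IHq]; [reflexivity|].
  cbn [pscale]. f_equal; [ring|exact IHq].
Qed.

Lemma peval_app_zero p z : peval (p ++ [RtoC 0]) z = peval p z.
Proof. induction p as [|a p IH]; simpl; [ring|rewrite IH; reflexivity]. Qed.

Lemma pnorm_app_zero r p : pnorm r (p ++ [RtoC 0]) = pnorm r p.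
Proof. induction p as [|a p IH]; simpl; [rewrite Cmod_0; ring|rewrite IH; reflexivity]. Qed.

Lemma pnorm_primn r n p : 0 <= r -> pnorm r (primn n p) <= pnorm r p / INR (S n).
Proof.
  intros Hr. cut (forall k, (n <= k)%nat -> pnorm r (primn k p) <= pnorm r p / INR (S n)); [auto|].
  assert (Hn : 0 < INR (S n)) by (apply lt_0_INR; lia).
  induction p as [|a p IH]; intros k Hk; cbn [primn pnorm].
  - unfold Rdiv; lra.
  - rewrite Cmod_div by apply RtoC_S_neq.
    assert (Hkn : INR (S n) <= INR (S k)) by (apply le_INR; lia).
    rewrite Cmod_R, Rabs_pos_eq by lra.
    specialize (IH (S k) ltac:(lia)).
    unfold Rdiv in *. rewrite Rmult_plus_distr_r. apply Rplus_le_compat.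
    + apply Rmult_le_compat_l; [apply Cmod_ge_0|]. apply Rinv_le_contravar; lra.
    + rewrite Rmult_assoc. apply Rmult_le_compat_l; lra.
Qed.

Lemma prim_pshift n p : prim (pshift n p) = pshift (S n) (primn n p).
Proof.
  unfold prim; simpl. f_equal.
  cut (forall k, primn k (pshift n p) = pshift n (primn (k + n) p)).
  { intros H; apply (H 0%nat). }
  induction n as [|n IH]; intros k; simpl.
  - rewrite Nat.add_0_r; reflexivity.
  - f_equal; [unfold Cdiv; ring|]. rewrite IH. do 2 f_equal. lia.
Qed.

(** The [j]-th coefficient is multiplied by [c/(m+1+j)], which differs from 1 by at most
    [(|c - (m+1)| + j)/(m+1)]; the length of [p] stays fixed while [m] grows. *)
Lemma primn_approx m c p z : Cmod z <= 1 ->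
  Cmod (RtoC c * peval (primn m p) z - peval p z)
    <= (Rabs (c - INR (S m)) + INR (length p)) * pnorm 1 p / INR (S m).
Proof.
  intros Hz.
  (* The induction moves the starting index [k] but has to keep the denominator [INR (S m)], hence
     the extra term [INR k - INR m]. *)
  cut (forall k, (m <= k)%nat -> Cmod (RtoC c * peval (primn k p) z - peval p z)
    <= (Rabs (c - INR (S m)) + (INR k - INR m) + INR (length p)) * pnorm 1 p / INR (S m)).
  { intros H; specialize (H m (Nat.le_refl m)). eapply Rle_trans; [exact H|].
    apply Req_le; f_equal. f_equal. ring. }
  assert (Hm : 0 < INR (S m)) by (apply lt_0_INR; lia).
  induction p as [|a p IH]; intros k Hk.
  - simpl peval; simpl pnorm. replace (RtoC c * 0 - 0)%C with (RtoC 0) by ring.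
    rewrite Cmod_0. unfold Rdiv; lra.
  - specialize (IH (S k) ltac:(lia)). cbn [primn peval pnorm].
    replace (RtoC c * (a / RtoC (INR (S k)) + z * peval (primn (S k) p) z) - (a + z * peval p z))%C
      with (a * RtoC ((c - INR (S k)) / INR (S k)) + z * (RtoC c * peval (primn (S k) p) z - peval p z))%C.
    2:{ rewrite RtoC_div, RtoC_minus by (apply not_0_INR; lia). field. apply RtoC_S_neq. }
    eapply Rle_trans; [apply Cmod_triangle|]. rewrite !Cmod_mult.
    remember (Rabs (c - INR (S m))) as B eqn:HBeq.
    assert (Hkm : INR m <= INR k) by (apply le_INR; lia).
    cbn [length] in *. rewrite !S_INR in *.
    pose proof (pos_INR (length p)) as HL. pose proof (pnorm_ge0 1 p ltac:(lra)) as HN.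
    pose proof (Cmod_ge_0 a) as Ha.
    assert (HB : 0 <= B) by (rewrite HBeq; apply Rabs_pos).
    assert (H1 : Cmod (RtoC ((c - (INR k + 1)) / (INR k + 1))) <= (B + (INR k - INR m)) / (INR m + 1)).
    { rewrite Cmod_R. unfold Rdiv. rewrite Rabs_mult, (Rabs_pos_eq (/ (INR k + 1))).
      2:{ left; apply Rinv_0_lt_compat; lra. }
      apply Rmult_le_compat.
      - apply Rabs_pos.
      - left; apply Rinv_0_lt_compat; lra.
      - rewrite HBeq. replace (c - (INR k + 1)) with ((c - (INR m + 1)) + (INR m - INR k)) by ring.
        eapply Rle_trans; [apply Rabs_triang|]. rewrite (Rabs_left1 (INR m - INR k)) by lra. lra.
      - apply Rinv_le_contravar; lra. }
    pose proof (Cmod_ge_0 (RtoC c * peval (primn (S k) p) z - peval p z)) as Hr.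
    apply Rle_trans with (Cmod a * ((B + (INR k - INR m)) / (INR m + 1))
      + (B + (INR k + 1 - INR m) + INR (length p)) * pnorm 1 p / (INR m + 1)).
    + apply Rplus_le_compat; [apply Rmult_le_compat_l; lra|]. nra.
    + unfold Rdiv. rewrite <- Rmult_assoc, <- Rmult_plus_distr_r.
      apply Rmult_le_compat_r; [left; apply Rinv_0_lt_compat; lra|]. nra.
Qed.

(** * Division by a linear factor and finiteness of roots *)

Fixpoint pquo (r : C) (p : list C) : list C :=
  match p with nil => nil | _ :: p' => padd p' (pscale r (pquo r p')) end.

Lemma pquo_spec r p z : peval p z = ((z - r) * peval (pquo r p) z + peval p r)%C.
Proof.
  induction p as [|a p IH]; simpl; [ring|].
  rewrite peval_padd, peval_pscale. 
  transitivity ((z - r) * peval p z + r * ((z - r) * peval (pquo r p) z + peval p r) + a)%C;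
    [rewrite <- IH; ring|ring].
Qed.

Lemma length_pscale c p : length (pscale c p) = length p.
Proof. induction p; simpl; auto. Qed.

Lemma length_padd p q : (length (padd p q) <= Nat.max (length p) (length q))%nat.
Proof.
  revert q; induction p as [|a p IH]; intros [|b q]; simpl; try lia.
  specialize (IH q); lia.
Qed.

Lemma length_spinor_quaduo r p : (length (pquo r p) <= pred (length p))%nat.
Proof.
  induction p as [|a p IH]; simpl; [lia|].
  eapply Nat.le_trans; [apply length_padd|]. rewrite length_pscale. lia.
Qed.

(** Nonvanishing at one point replaces a nonzero leading coefficient, which lists with trailing
    zeros do not provide. Dividing by [z - r] at a root [r] shortens the list, and the quotient is
    still nonzero at that point. *)
Lemma polynomial_finite_roots p : (exists z, peval p z <> RtoC 0) ->
  exists l : list C, forall z, peval p z = RtoC 0 -> In z l.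
Proof.
  remember (length p) as n eqn:Hn. assert (Hle : (length p <= n)%nat) by lia. clear Hn.
  revert p Hle; induction n as [|n IH]; intros p Hle [w Hw].
  - destruct p; [|simpl in Hle; lia]. elim Hw; reflexivity.
  - destruct (classic (exists r, peval p r = RtoC 0)) as [[r Hr]|Hno].
    + destruct (IH (pquo r p)) as [l Hl].
      * pose proof (length_spinor_quaduo r p); lia.
      * exists w. intros Hq. apply Hw. rewrite (pquo_spec r p w), Hr, Hq. ring.
      * exists (r :: l). intros z Hz. rewrite (pquo_spec r p z), Hr in Hz.
        destruct (Ceq_dec z r) as [->|Hzr]; [left; auto|right].
        apply Hl. destruct (Ceq_dec (peval (pquo r p) z) 0) as [E|E]; [exact E|].
        exfalso. apply (Cmult_neq_0 (z - r) (peval (pquo r p) z)); auto.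
        -- intros E2. apply Hzr. replace z with (z - r + r)%C by ring. rewrite E2; ring.
        -- rewrite <- Hz; ring.
    + exists nil. intros z Hz. apply Hno; exists z; exact Hz.
Qed.

Lemma exists_real_avoiding (l : list R) e : 0 < e -> exists t, 0 < t < e /\ ~ In t l.
Proof.
  revert e; induction l as [|a l IH]; intros e He.
  - exists (e / 2); split; [lra|auto].
  - destruct (Rle_or_lt a 0) as [Ha|Ha].
    + destruct (IH e He) as [t [Ht Hn]]. exists t; split; [lra|].
      intros [->|H]; [lra|auto].
    + destruct (IH (Rmin a e)) as [t [Ht Hn]]; [apply Rmin_glb_lt; lra|].
      exists t. pose proof (Rmin_l a e); pose proof (Rmin_r a e). split; [lra|].
      intros [->|H']; [lra|auto].
Qed.

(** * Vectors, null vectors and planar compactness *)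

Definition vec (v : dir3 -> R) : R3 := mk3 (v X1) (v X2) (v X3).
Definition coord (i : dir3) (x : R3) : R :=
  match i with X1 => c1 x | X2 => c2 x | X3 => c3 x end.

Ltac r3 := unfold dist3, sub3, add3, scal3, vec, coord, dot3, mk3, c1, c2, c3 in *; simpl fst in *; simpl snd in *.

Lemma dot3_ge0 x : 0 <= dot3 x x.
Proof. unfold dot3; nra. Qed.

Lemma norm3_ge0 x : 0 <= norm3 x.
Proof. apply sqrt_pos. Qed.

Lemma norm3_sq x : norm3 x * norm3 x = dot3 x x.
Proof. apply sqrt_sqrt, dot3_ge0. Qed.

Lemma norm3_le x e : 0 <= e -> dot3 x x <= e * e -> norm3 x <= e.
Proof.
  intros He H. unfold norm3. rewrite <- (sqrt_square e He). now apply sqrt_le_1_alt.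
Qed.

Lemma norm3_ge x e : 0 <= e -> e * e <= dot3 x x -> e <= norm3 x.
Proof.
  intros He H. unfold norm3. rewrite <- (sqrt_square e He). now apply sqrt_le_1_alt.
Qed.

Lemma cauchy_schwarz3 x y : dot3 x y <= norm3 x * norm3 y.
Proof.
  apply Rsqr_incr_0_var; [|apply Rmult_le_pos; apply norm3_ge0].
  unfold Rsqr. replace (norm3 x * norm3 y * (norm3 x * norm3 y))
    with ((norm3 x * norm3 x) * (norm3 y * norm3 y)) by ring.
  rewrite !norm3_sq. destruct x as [[a b] c], y as [[a' b'] c']. r3.
  pose proof (pow2_ge_0 (a * b' - b * a')); pose proof (pow2_ge_0 (a * c' - c * a')).
  pose proof (pow2_ge_0 (b * c' - c * b')). nra.
Qed.

Lemma cauchy_schwarz3_abs x y : Rabs (dot3 x y) <= norm3 x * norm3 y.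
Proof.
  apply Rabs_le; split; [|apply cauchy_schwarz3].
  pose proof (cauchy_schwarz3 (scal3 (-1) x) y) as H.
  assert (E : norm3 (scal3 (-1) x) = norm3 x).
  { unfold norm3. f_equal. r3. ring. }
  rewrite E in H. replace (dot3 (scal3 (-1) x) y) with (- dot3 x y) in H by (r3; ring). lra.
Qed.

Lemma norm3_triangle x y : norm3 (add3 x y) <= norm3 x + norm3 y.
Proof.
  apply norm3_le.
  - pose proof (norm3_ge0 x); pose proof (norm3_ge0 y); lra.
  - replace (dot3 (add3 x y) (add3 x y)) with (dot3 x x + 2 * dot3 x y + dot3 y y) by (r3; ring).
    rewrite <- !norm3_sq. pose proof (cauchy_schwarz3 x y). nra.
Qed.

Lemma norm3_scal a x : norm3 (scal3 a x) = Rabs a * norm3 x.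
Proof.
  unfold norm3. replace (dot3 (scal3 a x) (scal3 a x)) with (a * a * dot3 x x) by (r3; ring).
  rewrite sqrt_mult by (try apply dot3_ge0; nra). f_equal.
  rewrite <- sqrt_Rsqr_abs. reflexivity.
Qed.

Lemma coord_le_norm3 i x : Rabs (coord i x) <= norm3 x.
Proof.
  apply norm3_ge; [apply Rabs_pos|]. rewrite <- Rabs_mult.
  destruct i; rewrite Rabs_pos_eq; r3; nra.
Qed.

Lemma norm3_le_coords x e : (forall i, Rabs (coord i x) <= e) -> norm3 x <= 2 * e.
Proof.
  intros H. pose proof (H X1) as H1; pose proof (H X2) as H2; pose proof (H X3) as H3.
  assert (He : 0 <= e) by (pose proof (Rabs_pos (coord X1 x)); lra).
  assert (S : forall a, Rabs a <= e -> a * a <= e * e).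
  { intros a Ha. pose proof (Rabs_pos a). rewrite <- (Rabs_pos_eq (a * a)) by nra.
    rewrite Rabs_mult. nra. }
  apply S in H1. apply S in H2. apply S in H3.
  apply norm3_le; [lra|]. r3. nra.
Qed.

Lemma dist3_sym x y : dist3 x y = dist3 y x.
Proof. unfold dist3, norm3; f_equal; r3; ring. Qed.

Lemma R3_ext x y : (forall i, coord i x = coord i y) -> x = y.
Proof.
  intros H. pose proof (H X1); pose proof (H X2); pose proof (H X3).
  destruct x as [[a b] c], y as [[a' b'] c']; r3; congruence.
Qed.

Lemma dist3_triangle x y z : dist3 x z <= dist3 x y + dist3 y z.
Proof.
  unfold dist3. replace (sub3 x z) with (add3 (sub3 x y) (sub3 y z)).
  - apply norm3_triangle.
  - apply R3_ext; intros []; r3; ring.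
Qed.

Lemma dist3_ge0 x y : 0 <= dist3 x y.
Proof. apply norm3_ge0. Qed.

Lemma dist3_refl x : dist3 x x = 0.
Proof.
  unfold dist3, norm3. replace (dot3 (sub3 x x) (sub3 x x)) with 0 by (r3; ring). apply sqrt_0.
Qed.

Lemma dist3_add x v : dist3 (add3 x v) x = norm3 v.
Proof. unfold dist3; f_equal. apply R3_ext; intros []; r3; ring. Qed.

Lemma norm3_dist_le x y : norm3 x <= norm3 y + dist3 x y.
Proof.
  unfold dist3. replace x with (add3 y (sub3 x y)) at 1 by (apply R3_ext; intros []; r3; ring).
  apply norm3_triangle.
Qed.

(* Weierstrass representation: the null vectors of [C^3] as quadratic forms in a spinor [(p, s)]. *)
Definition qv (i : dir3) (p s : C) : C :=
  match i with
  | X1 => (p * p - s * s)%C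
  | X2 => (Ci * (p * p + s * s))%C
  | X3 => (2 * (p * s))%C
  end.
Definition null (w : dir3 -> C) : Prop :=
  (w X1 * w X1 + w X2 * w X2 + w X3 * w X3)%C = RtoC 0.
Definition revec (w : dir3 -> C) : R3 := vec (fun i => Re (w i)).
(** When [w = F'(z)] is null, both partial derivatives of [Re F] have this length and are
    orthogonal: [lam] is the conformal factor of the surface. *)
Definition lam (w : dir3 -> C) : R := norm3 (revec w).

Lemma Ci_sq : (Ci * Ci)%C = (- RtoC 1)%C.
Proof. unfold Ci, Cmult, Copp, RtoC; simpl; f_equal; ring. Qed.

Lemma null_qv p s : null (fun i => qv i p s).
Proof.
  unfold null, qv. transitivity ((p * p - s * s) * (p * p - s * s)
    + (Ci * Ci) * ((p * p + s * s) * (p * p + s * s)) + 2 * (p * s) * (2 * (p * s)))%C; [ring|].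
  rewrite Ci_sq. ring.
Qed.

Lemma revec_add w w' : revec (fun i => (w i + w' i)%C) = add3 (revec w) (revec w').
Proof. reflexivity. Qed.

Lemma revec_sub w w' : revec (fun i => (w i - w' i)%C) = sub3 (revec w) (revec w').
Proof. reflexivity. Qed.

Lemma revec_le w e : (forall i, Cmod (w i) <= e) -> norm3 (revec w) <= 2 * e.
Proof.
  intros H. apply norm3_le_coords. intros i. eapply Rle_trans; [|apply (H i)].
  eapply Rle_trans; [|apply re_le_Cmod]. destruct i; apply Rle_refl.
Qed.

Lemma Cmod_sqr (z : C) : Cmod z * Cmod z = fst z * fst z + snd z * snd z.
Proof. unfold Cmod. rewrite sqrt_sqrt; [ring|]. nra. Qed.

Lemma null_parts w : null w ->
  let a i := fst (w i) in let b i := snd (w i) in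
  a X1 * a X1 + a X2 * a X2 + a X3 * a X3 = b X1 * b X1 + b X2 * b X2 + b X3 * b X3 /\
  a X1 * b X1 + a X2 * b X2 + a X3 * b X3 = 0.
Proof.
  intros H a b. unfold null in H. apply (f_equal fst) in H as H1. apply (f_equal snd) in H as H2.
  subst a b; unfold Cmult, Cplus, RtoC in *; simpl in *. split; lra.
Qed.

(** Real and imaginary parts of a null vector are orthogonal of equal length, so the map sending [h]
    to [Re (h w)] is a similarity. Unimodular [h] therefore trace a round circle. *)
Lemma norm3_revec_scal w h : null w ->
  norm3 (revec (fun i => (h * w i)%C)) = Cmod h * lam w.
Proof.
  intros H. destruct (null_parts w H) as [H1 H2].
  apply Rsqr_inj.
  - apply norm3_ge0.
  - apply Rmult_le_pos; [apply Cmod_ge_0|apply norm3_ge0].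
  - unfold Rsqr. rewrite norm3_sq.
    replace (Cmod h * lam w * (Cmod h * lam w)) with ((Cmod h * Cmod h) * (lam w * lam w)) by ring.
    unfold lam; rewrite norm3_sq, Cmod_sqr. unfold revec; r3. unfold Re, Cmult; simpl.
    set (a1 := fst (w X1)) in *; set (a2 := fst (w X2)) in *; set (a3 := fst (w X3)) in *.
    set (b1 := snd (w X1)) in *; set (b2 := snd (w X2)) in *; set (b3 := snd (w X3)) in *.
    transitivity (fst h * fst h * (a1 * a1 + a2 * a2 + a3 * a3)
      - 2 * fst h * snd h * (a1 * b1 + a2 * b2 + a3 * b3)
      + snd h * snd h * (b1 * b1 + b2 * b2 + b3 * b3)); [ring|].
    rewrite H2, <- H1. ring.
Qed.

(** For a null vector [|Re w|^2 = |w|^2 / 2], and the spinor form satisfies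
    [|q|^2 = 2 (|p|^2 + |s|^2)^2]. Hence the immersion degenerates exactly at common zeros of the
    spinor. *)
Lemma lam_qv p s : lam (fun i => qv i p s) = Cmod p * Cmod p + Cmod s * Cmod s.
Proof.
  apply Rsqr_inj; [apply norm3_ge0|pose proof (Cmod_ge_0 p); pose proof (Cmod_ge_0 s); nra|].
  destruct (null_parts _ (null_qv p s)) as [H _].
  unfold Rsqr; unfold lam; rewrite norm3_sq, !Cmod_sqr.
  destruct p as [a b], s as [c d]. unfold revec; r3; unfold qv, Ci, Re, Cmult, Cminus, Copp, Cplus, RtoC in *;
  simpl in *. ring_simplify in H. ring_simplify. nra.
Qed.

Lemma lam_close w w' e : (forall i, Cmod (w i - w' i) <= e) -> Rabs (lam w - lam w') <= 2 * e.
Proof.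
  intros H. unfold lam.
  assert (H1 : dist3 (revec w) (revec w') <= 2 * e).
  { unfold dist3. rewrite <- revec_sub. now apply revec_le. }
  pose proof (norm3_dist_le (revec w) (revec w')).
  pose proof (norm3_dist_le (revec w') (revec w)) as H2. rewrite dist3_sym in H2.
  apply Rabs_le; split; lra.
Qed.

(** * Continuous functions on closed and bounded sets of the plane *)

Definition cont_on (S : C -> Prop) (g : C -> R) : Prop :=
  forall z, S z -> forall e, 0 < e -> exists d, 0 < d /\
    forall w, S w -> Cmod (w - z) < d -> Rabs (g w - g z) < e.

Definition compact2 (S : C -> Prop) : Prop :=
  (forall z, ~ S z -> exists e, 0 < e /\ forall w, Cmod (w - z) < e -> ~ S w) /\
  exists M, forall z, S z -> Cmod z <= M.

(** The gauge is extended to a bounding square by giving each point outside [S] a radius that keeps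
    clear of [S], so that every cell meeting [S] is centred in [S]. The halved radii absorb the
    passage from the sup norm to [Cmod], a factor below 2. *)
Lemma compact2_cover S (d : C -> R) : compact2 S -> (forall z, S z -> 0 < d z) ->
  exists l : list C, (forall z, In z l -> S z) /\
    forall z, S z -> exists c, In c l /\ Cmod (z - c) < d c.
Proof.
  intros [Hcl [M HM]] Hd.
  assert (Hex : forall t : R * (R * unit), exists r : posreal,
     (S (fst t, fst (snd t)) -> r <= d (fst t, fst (snd t)) / 2) /\
     (~ S (fst t, fst (snd t)) -> forall w, Cmod (w - (fst t, fst (snd t))) < 2 * r -> ~ S w)).
  { intros t. set (z := (fst t, fst (snd t))). destruct (classic (S z)) as [Hz|Hz].
    - assert (Hp : 0 < d z / 2) by (specialize (Hd z Hz); lra).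
      exists (mkposreal _ Hp); simpl; split; [lra|tauto].
    - destruct (Hcl z Hz) as [e [He Hw]]. assert (Hp : 0 < e / 2) by lra.
      exists (mkposreal _ Hp); simpl; split; [tauto|]. intros _ w Hwz; apply Hw; lra. }
  set (dl := fun t => proj1_sig (constructive_indefinite_description _ (Hex t))).
  assert (Hdl : forall t, (S (fst t, fst (snd t)) -> dl t <= d (fst t, fst (snd t)) / 2) /\
     (~ S (fst t, fst (snd t)) -> forall w, Cmod (w - (fst t, fst (snd t))) < 2 * dl t -> ~ S w)).
  { intros t. exact (proj2_sig (constructive_indefinite_description _ (Hex t))). }
  destruct (NNPP _ (compactness_list 2 (-M, (-M, tt)) (M, (M, tt)) dl)) as [l Hl].
  assert (Hsel : exists l' : list C, (forall z, In z l' -> S z) /\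
     forall t, In t l -> S (fst t, fst (snd t)) -> In (fst t, fst (snd t)) l').
  { clear Hl. induction l as [|t l [l' [H1 H2]]].
    - exists nil; split; [intros z []|intros t []].
    - destruct (classic (S (fst t, fst (snd t)))) as [Ht|Ht].
      + exists ((fst t, fst (snd t)) :: l'). split.
        * intros z [<-|Hz]; auto.
        * intros u [<-|Hu] Hs; [left; auto|right; auto].
      + exists l'. split; auto. intros u [<-|Hu] Hs; [tauto|auto]. }
  destruct Hsel as [l' [H1 H2]]. exists l'; split; [exact H1|].
  intros z Hz. destruct (Hl (fst z, (snd z, tt))) as [t [Ht [_ Hclose]]].
  { specialize (HM z Hz). pose proof (Rmax_Cmod z) as Hmx.
    pose proof (Rmax_l (Rabs (fst z)) (Rabs (snd z))). pose proof (Rmax_r (Rabs (fst z)) (Rabs (snd z))).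
    assert (Ha : Rabs (fst z) <= M) by lra. assert (Hb : Rabs (snd z) <= M) by lra.
    apply Rabs_le_between in Ha. apply Rabs_le_between in Hb. simpl; repeat split; lra. }
  destruct t as [x [y []]]. simpl in Hclose. destruct Hclose as [Hx [Hy _]].
  assert (Hdist : Cmod (z - (x, y)) < 2 * dl (x, (y, tt))).
  { eapply Rle_lt_trans; [apply Cmod_2Rmax|]. simpl.
    assert (Hs : sqrt 2 < 2).
    { rewrite <- (sqrt_square 2) at 2 by lra. apply sqrt_lt_1; lra. }
    pose proof (cond_pos (dl (x, (y, tt)))).
    assert (Rmax (Rabs (fst z - x)) (Rabs (snd z - y)) < dl (x, (y, tt))) by (apply Rmax_lub_lt; auto).
    pose proof (Rmax_l (Rabs (fst z + - x)) (Rabs (snd z + - y))).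
    pose proof (Rabs_pos (fst z + - x)). pose proof (sqrt_pos 2).
    unfold Rminus in *. nra. }
  destruct (Hdl (x, (y, tt))) as [Hd1 Hd2]; simpl in Hd1, Hd2.
  destruct (classic (S (x, y))) as [Hs|Hs].
  - exists (x, y); split; [apply (H2 _ Ht Hs)|]. specialize (Hd1 Hs). lra.
  - exfalso. apply (Hd2 Hs z Hdist Hz).
Qed.

Lemma list_min (l : list C) (g : C -> R) : (forall z, In z l -> 0 < g z) ->
  exists m, 0 < m /\ forall z, In z l -> m <= g z.
Proof.
  induction l as [|a l IH]; intros H.
  - exists 1; split; [lra|intros z []].
  - destruct IH as [m [Hm Hl]]; [intros; apply H; right; auto|].
    exists (Rmin m (g a)). split; [apply Rmin_glb_lt; auto; apply H; left; auto|].
    intros z [<-|Hz]; [apply Rmin_r|]. eapply Rle_trans; [apply Rmin_l|auto].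
Qed.

Lemma cont_on_min S g : compact2 S -> cont_on S g -> (forall z, S z -> 0 < g z) ->
  exists m, 0 < m /\ forall z, S z -> m <= g z.
Proof.
  intros HS Hc Hp.
  assert (Hex : forall z, exists d, 0 < d /\
     (S z -> forall w, S w -> Cmod (w - z) < d -> g z / 2 < g w)).
  { intros z. destruct (classic (S z)) as [Hz|Hz].
    - destruct (Hc z Hz (g z / 2)) as [d [Hd H]]; [specialize (Hp z Hz); lra|].
      exists d; split; auto. intros _ w Hw Hwz. specialize (H w Hw Hwz).
      apply Rabs_def2 in H. lra.
    - exists 1; split; [lra|tauto]. }
  apply choice in Hex. destruct Hex as [d Hd].
  destruct (compact2_cover S d HS) as [l [Hl1 Hl2]]; [intros; apply Hd|].
  destruct (list_min l (fun z => g z / 2)) as [m [Hm Hml]].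
  { intros z Hz. specialize (Hp z (Hl1 z Hz)). lra. }
  exists m; split; auto. intros z Hz. destruct (Hl2 z Hz) as [c [Hc1 Hc2]].
  left. eapply Rle_lt_trans; [apply (Hml c Hc1)|]. apply (proj2 (Hd c)); auto.
Qed.

Lemma cont_on_uniform S g : compact2 S -> cont_on S g ->
  forall e, 0 < e -> exists d, 0 < d /\
    forall z w, S z -> S w -> Cmod (w - z) < d -> Rabs (g w - g z) < e.
Proof.
  intros HS Hc e He.
  assert (Hex : forall z, exists d, 0 < d /\
     (S z -> forall w, S w -> Cmod (w - z) < 2 * d -> Rabs (g w - g z) < e / 2)).
  { intros z. destruct (classic (S z)) as [Hz|Hz].
    - destruct (Hc z Hz (e / 2)) as [d [Hd H]]; [lra|].
      exists (d / 2); split; [lra|]. intros _ w Hw Hwz. apply H; auto; lra.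
    - exists 1; split; [lra|tauto]. }
  apply choice in Hex. destruct Hex as [d Hd].
  destruct (compact2_cover S d HS) as [l [Hl1 Hl2]]; [intros; apply Hd|].
  destruct (list_min l d) as [m [Hm Hml]]; [intros; apply Hd|].
  exists m; split; auto. intros z w Hz Hw Hzw. destruct (Hl2 z Hz) as [c [Hc1 Hc2]].
  specialize (Hml c Hc1). destruct (Hd c) as [Hdc Hgc]. specialize (Hgc (Hl1 c Hc1)).
  assert (H1 := Hgc z Hz ltac:(lra)).
  assert (H2 : Rabs (g w - g c) < e / 2).
  { apply Hgc; auto. replace (w - c)%C with ((w - z) + (z - c))%C by ring.
    eapply Rle_lt_trans; [apply Cmod_triangle|]. lra. }
  replace (g w - g z) with ((g w - g c) - (g z - g c)) by ring.
  unfold Rminus at 1. eapply Rle_lt_trans; [apply Rabs_triang|]. rewrite Rabs_Ropp. lra.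
Qed.

(** Boundedness of [g] is a positive lower bound for [1/(1 + |g|)]. *)
Lemma cont_on_bounded S g : compact2 S -> cont_on S g ->
  exists M, 0 < M /\ forall z, S z -> Rabs (g z) <= M.
Proof.
  intros HS Hc.
  destruct (cont_on_min S (fun z => / (1 + Rabs (g z))) HS) as [m [Hm H]].
  - intros z Hz e He. pose proof (Rabs_pos (g z)) as Hpz.
    destruct (Hc z Hz e He) as [d [Hd Hw]]. exists d; split; auto.
    intros w Sw Hwz. specialize (Hw w Sw Hwz). pose proof (Rabs_pos (g w)) as Hpw.
    replace (/ (1 + Rabs (g w)) - / (1 + Rabs (g z)))
      with ((Rabs (g z) - Rabs (g w)) * / ((1 + Rabs (g w)) * (1 + Rabs (g z)))) by (field; lra).
    rewrite Rabs_mult. apply Rle_lt_trans with (Rabs (g w - g z) * 1); [|lra].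
    apply Rmult_le_compat; try apply Rabs_pos.
    + rewrite (Rabs_minus_sym (g w)). apply Rabs_triang_inv2.
    + rewrite Rabs_pos_eq; [|left; apply Rinv_0_lt_compat; nra].
      rewrite <- Rinv_1. apply Rinv_le_contravar; nra.
  - intros z Hz. apply Rinv_0_lt_compat. pose proof (Rabs_pos (g z)); lra.
  - exists (/ m); split; [now apply Rinv_0_lt_compat|]. intros z Hz. specialize (H z Hz).
    pose proof (Rabs_pos (g z)).
    apply Rinv_le_contravar in H; auto. rewrite Rinv_inv in H. lra.
Qed.

Lemma Cmod_sub_ge (z w : C) : Cmod z - Cmod w <= Cmod (z - w).
Proof.
  pose proof (Cmod_triangle (z - w) w). replace (z - w + w)%C with z in H by ring. lra.
Qed.

Lemma Cmod_sub_sym (z w : C) : Cmod (z - w) = Cmod (w - z).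
Proof. replace (z - w)%C with (- (w - z))%C by ring. apply Cmod_opp. Qed.

Lemma compact2_annulus a b : compact2 (fun z => a <= Cmod z <= b).
Proof.
  split; [|exists b; intros z [_ H]; exact H].
  intros z Hz. destruct (Rlt_or_le (Cmod z) a) as [H|H].
  - exists (a - Cmod z); split; [lra|]. intros w Hw [H1 H2].
    pose proof (Cmod_sub_ge w z). lra.
  - exists (Cmod z - b). assert (b < Cmod z).
    { destruct (Rle_or_lt (Cmod z) b); [elim Hz; split; auto|auto]. }
    split; [lra|]. intros w Hw [H1 H2]. pose proof (Cmod_sub_ge z w).
    rewrite Cmod_sub_sym in H3. lra.
Qed.

(** * Laurent approximation on the circle *)

Fixpoint csum (f : nat -> C) (n : nat) : C :=
  match n with O => RtoC 0 | S n' => (csum f n' + f n')%C end.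
Fixpoint rsum (f : nat -> R) (n : nat) : R :=
  match n with O => 0 | S n' => rsum f n' + f n' end.

Lemma csum_ext f g n : (forall k, (k < n)%nat -> f k = g k) -> csum f n = csum g n.
Proof. induction n as [|n IH]; intros H; simpl; auto. rewrite IH, H; auto. Qed.

Lemma csum_scal c f n : csum (fun k => (c * f k)%C) n = (c * csum f n)%C.
Proof. induction n as [|n IH]; simpl; [ring|rewrite IH; ring]. Qed.

Lemma csum_plus f g n : csum (fun k => (f k + g k)%C) n = (csum f n + csum g n)%C.
Proof. induction n as [|n IH]; simpl; [ring|rewrite IH; ring]. Qed.

Lemma csum_const c n : csum (fun _ => c) n = (RtoC (INR n) * c)%C.
Proof. induction n as [|n IH]; [simpl; ring|]. rewrite S_INR, RtoC_plus. simpl csum. rewrite IH; ring. Qed.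

Lemma csum_zero n : csum (fun _ => RtoC 0) n = RtoC 0.
Proof. rewrite csum_const; ring. Qed.

Lemma csum_swap f n m :
  csum (fun a => csum (fun b => f a b) m) n = csum (fun b => csum (fun a => f a b) n) m.
Proof.
  induction n as [|n IH]; simpl; [rewrite csum_zero; auto|].
  rewrite IH, csum_plus; reflexivity.
Qed.

Lemma csum_conj f n : Cconj (csum f n) = csum (fun k => Cconj (f k)) n.
Proof.
  induction n as [|n IH]; simpl; [unfold Cconj, RtoC; simpl; f_equal; ring|].
  rewrite Cplus_conj, IH; reflexivity.
Qed.

Lemma csum_single f n a : (a < n)%nat -> (forall k, (k < n)%nat -> k <> a -> f k = RtoC 0) ->
  csum f n = f a.
Proof.
  induction n as [|n IH]; intros Ha H; [lia|]. simpl.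
  destruct (Nat.eq_dec a n) as [->|Hn].
  - rewrite (csum_ext f (fun _ => RtoC 0)), csum_zero; [ring|].
    intros; apply H; lia.
  - rewrite IH, (H n); [ring|lia|lia|lia|intros; apply H; lia].
Qed.

Lemma Cmod_csum f n : Cmod (csum f n) <= rsum (fun k => Cmod (f k)) n.
Proof.
  induction n as [|n IH]; simpl; [rewrite Cmod_0; lra|].
  eapply Rle_trans; [apply Cmod_triangle|lra].
Qed.

Lemma rsum_le f g n : (forall k, (k < n)%nat -> f k <= g k) -> rsum f n <= rsum g n.
Proof.
  induction n as [|n IH]; intros H; simpl; [lra|].
  pose proof (H n ltac:(lia)). assert (rsum f n <= rsum g n) by (apply IH; auto). lra.
Qed.

Lemma rsum_lin a b f g n :
  rsum (fun k => a * f k + b * g k) n = a * rsum f n + b * rsum g n.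
Proof. induction n as [|n IH]; simpl; [ring|rewrite IH; ring]. Qed.

Lemma rsum_const c n : rsum (fun _ => c) n = INR n * c.
Proof. induction n as [|n IH]; [simpl; ring|]. rewrite S_INR; simpl rsum; rewrite IH; ring. Qed.

Lemma RtoC_rsum f n : RtoC (rsum f n) = csum (fun k => RtoC (f k)) n.
Proof. induction n as [|n IH]; simpl; [auto|rewrite RtoC_plus, IH; auto]. Qed.

(** * Roots of unity and the discrete Fejer kernel *)

Definition cis (t : R) : C := (cos t, sin t).

Lemma cis_pow t n : (cis t ^ n)%C = cis (INR n * t).
Proof.
  induction n as [|n IH].
  - simpl. unfold cis. rewrite Rmult_0_l, cos_0, sin_0. reflexivity.
  - rewrite Cpow_S, IH, S_INR. unfold cis, Cmult; simpl.
    replace ((INR n + 1) * t) with (t + INR n * t) by ring.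
    rewrite cos_plus, sin_plus. f_equal; ring.
Qed.

Lemma Cmod_cis t : Cmod (cis t) = 1.
Proof.
  unfold Cmod, cis; simpl. transitivity (sqrt 1); [f_equal|apply sqrt_1].
  pose proof (sin2_cos2 t) as H; unfold Rsqr in H. nra.
Qed.

Lemma cis_neq_1 t : 0 < t < 2 * PI -> cis t <> RtoC 1.
Proof.
  intros Ht H. apply (f_equal fst) in H; unfold cis in H; simpl in H.
  pose proof (cos_2a_sin (t / 2)) as E. replace (2 * (t / 2)) with t in E by field.
  pose proof (sin_gt_0 (t / 2) ltac:(lra) ltac:(lra)). nra.
Qed.

Lemma conj_unit z : Cmod z = 1 -> (z * Cconj z)%C = RtoC 1.
Proof. intros H. rewrite <- Cmod2_conj, H. f_equal; ring. Qed.

Lemma csum_geom u n : ((u - 1) * csum (fun j => u ^ j) n)%C = (u ^ n - 1)%C.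
Proof. induction n as [|n IH]; simpl; [ring|]. rewrite Cmult_plus_distr_l, IH. simpl; ring. Qed.

Lemma csum_root_of_unity v n : v <> RtoC 1 -> (v ^ n)%C = RtoC 1 -> csum (fun j => v ^ j)%C n = RtoC 0.
Proof.
  intros H1 H2. pose proof (csum_geom v n) as H. rewrite H2 in H.
  destruct (Ceq_dec (csum (fun j => v ^ j)%C n) 0) as [E|E]; [exact E|exfalso].
  apply (Cmult_neq_0 (v - 1) (csum (fun j => v ^ j)%C n)); auto.
  - intros E2. apply H1. replace v with (v - 1 + 1)%C by ring. rewrite E2; ring.
  - rewrite H; ring.
Qed.

Definition zeta (n : nat) : C := cis (2 * PI / INR n).

Lemma zeta_pow_neq n k : (0 < k < n)%nat -> (zeta n ^ k)%C <> RtoC 1.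
Proof.
  intros Hk. unfold zeta. rewrite cis_pow. apply cis_neq_1.
  assert (0 < INR k) by (apply lt_0_INR; lia). assert (INR k < INR n) by (apply lt_INR; lia).
  pose proof PI_RGT_0 as HP. split.
  - apply Rmult_lt_0_compat; auto. apply Rdiv_lt_0_compat; lra.
  - replace (INR k * (2 * PI / INR n)) with (2 * PI * (INR k / INR n)) by (field; lra).
    rewrite <- (Rmult_1_r (2 * PI)) at 2. apply Rmult_lt_compat_l; [lra|].
    apply Rlt_div_l; lra.
Qed.

Lemma zeta_pow_n n : (0 < n)%nat -> (zeta n ^ n)%C = RtoC 1.
Proof.
  intros Hn. unfold zeta. rewrite cis_pow.
  replace (INR n * (2 * PI / INR n)) with (2 * PI) by (field; apply not_0_INR; lia).
  unfold cis. rewrite cos_2PI, sin_2PI. reflexivity.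
Qed.

(** Orthogonality of the characters of the cyclic group of order [n]: the terms are the powers of
    [zeta^(b-a)], a nontrivial root of unity unless [a = b]. *)
Lemma fejer_pair_sum n a b : (a < n)%nat -> (b < n)%nat ->
  csum (fun j => (Cconj (zeta n ^ j) ^ a * (zeta n ^ j) ^ b)%C) n
  = if Nat.eq_dec a b then RtoC (INR n) else RtoC 0.
Proof.
  intros Ha Hb. pose proof (conj_unit (zeta n) (Cmod_cis _)) as Hu.
  set (z := zeta n) in *.
  assert (Hab : forall m, (Cconj z ^ m * z ^ m)%C = RtoC 1).
  { intros m. rewrite <- Cpow_mult_l, Cmult_comm, Hu, Cpow_1_l. reflexivity. }
  rewrite (csum_ext _ (fun j => (Cconj z ^ a * z ^ b) ^ j)%C).
  2:{ intros j _. rewrite Cpow_conj, Cpow_mult_l, <- !Cpow_mult_r.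
      rewrite (Nat.mul_comm j a), (Nat.mul_comm j b). reflexivity. }
  destruct (Nat.eq_dec a b) as [->|Hne].
  - rewrite Hab. rewrite (csum_ext _ (fun _ => RtoC 1)), csum_const; [ring|].
    intros; apply Cpow_1_l.
  - apply csum_root_of_unity.
    + intros E. destruct (Nat.lt_trichotomy a b) as [H|[H|H]]; [|lia|].
      * apply (zeta_pow_neq n (b - a)); [lia|]. fold z.
        replace b with (a + (b - a))%nat in E by lia. rewrite Cpow_add_r in E.
        rewrite <- E. rewrite Cmult_assoc, Hab. ring.
      * apply (zeta_pow_neq n (a - b)); [lia|]. fold z.
        replace a with (b + (a - b))%nat in E by lia. rewrite Cpow_add_r in E.
        assert (E' : (Cconj z ^ (a - b))%C = RtoC 1).
        { transitivity (Cconj z ^ (a - b) * (Cconj z ^ b * z ^ b))%C; [rewrite Hab; ring|].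
          rewrite <- E. ring. }
        transitivity (1 * z ^ (a - b))%C; [ring|]. rewrite <- E' at 1. apply Hab.
    + rewrite Cpow_mult_l, <- !Cpow_mult_r, (Nat.mul_comm a), (Nat.mul_comm b), !Cpow_mult_r.
      assert (E : (z ^ n)%C = RtoC 1) by (apply zeta_pow_n; lia).
      rewrite <- Cpow_conj, E, !Cpow_1_l.
      replace (Cconj (RtoC 1)) with (RtoC 1) by (unfold Cconj, RtoC; simpl; f_equal; ring).
      rewrite Cpow_1_l; ring.
Qed.

Definition geo (u : C) (n : nat) : C := csum (fun a => (u ^ a)%C) n.

(** Parseval on the [n]-th roots of unity: after expanding the squares only the [n] diagonal pairs
    survive, each summing to [n]. The total weight thus does not depend on [x]. *)
Lemma fejer_mean n x : Cmod x = 1 ->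
  rsum (fun j => Cmod (geo (x * Cconj (zeta n ^ j)) n) ^ 2) n = INR n * INR n.
Proof.
  intros Hx. apply RtoC_inj. rewrite RtoC_rsum.
  rewrite (csum_ext _ (fun j => csum (fun a => csum (fun b =>
    ((x ^ a * Cconj x ^ b) * (Cconj (zeta n ^ j) ^ a * (zeta n ^ j) ^ b))%C) n) n)).
  2:{ intros j _. rewrite Cmod2_conj. unfold geo. rewrite csum_conj, Cmult_comm, <- csum_scal.
      apply csum_ext; intros a _. rewrite Cmult_comm, <- csum_scal. apply csum_ext; intros b _.
      rewrite !Cpow_conj, !Cmult_conj, !Cpow_conj, !Cconj_conj, !Cpow_mult_l. ring. }
  rewrite csum_swap, (csum_ext _ (fun _ => RtoC (INR n))).
  { rewrite csum_const, <- RtoC_mult. reflexivity. }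
  intros a Ha. rewrite csum_swap.
  rewrite (csum_single _ n a Ha).
  - rewrite csum_scal, fejer_pair_sum by auto. destruct (Nat.eq_dec a a); [|lia].
    rewrite <- Cpow_mult_l, conj_unit, Cpow_1_l by auto. ring.
  - intros b Hb Hne. rewrite csum_scal, fejer_pair_sum by auto. destruct (Nat.eq_dec a b); [lia|ring].
Qed.

Lemma geo_S u m : geo u (S m) = (1 + u * geo u m)%C.
Proof.
  induction m as [|m IH]; unfold geo in *; [simpl; ring|].
  change (csum (fun a => u ^ a)%C (S (S m))) with (csum (fun a => u ^ a)%C (S m) + u ^ S m)%C.
  rewrite IH at 1. simpl; ring.
Qed.

(** A geometric sum is palindromic on the circle. It follows that
    [u^n |geo u (n+1)|^2 = geo u (n+1)^2], which turns the kernel, written with conjugates, into a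
    polynomial. *)
Lemma geo_reflect u n : Cmod u = 1 -> (u ^ n * Cconj (geo u (S n)))%C = geo u (S n).
Proof.
  intros Hu. pose proof (conj_unit u Hu) as E.
  induction n as [|n IH].
  - unfold geo; simpl. rewrite Cplus_conj.
    unfold Cconj, RtoC, Cmult, Cplus; simpl; f_equal; ring.
  - rewrite (geo_S u (S n)) at 2. rewrite <- IH. unfold geo at 1.
    change (csum (fun a => u ^ a)%C (S (S n))) with (geo u (S n) + u ^ S n)%C.
    rewrite Cplus_conj, Cmult_plus_distr_l.
    replace (u ^ S n * Cconj (u ^ S n))%C with (RtoC 1).
    2:{ rewrite Cpow_conj, <- Cpow_mult_l, E, Cpow_1_l; reflexivity. }
    simpl; ring.
Qed.

(** [(u - 1) geo u n = u^n - 1] has modulus at most 2. Summed over the [n] nodes the second moment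
    is at most [4 n], against a total weight [n^2]: the kernel concentrates at rate [1/n]. *)
Lemma fejer_moment u n : Cmod u = 1 -> Cmod (geo u n) ^ 2 * Cmod (u - 1) ^ 2 <= 4.
Proof.
  intros Hu. rewrite <- Rpow_mult_distr, <- Cmod_mult, Cmult_comm.
  unfold geo; rewrite csum_geom.
  assert (H : Cmod (u ^ n - 1) <= 2).
  { unfold Cminus. eapply Rle_trans; [apply Cmod_triangle|].
    rewrite Cmod_opp, Cmod_1, Cmod_pow, Hu, pow1. lra. }
  pose proof (Cmod_ge_0 (u ^ n - 1)). nra.
Qed.

Definition circle (z : C) : Prop := Cmod z = 1.
Definition cont_circle (h : C -> C) : Prop :=
  cont_on circle (fun z => Re (h z)) /\ cont_on circle (fun z => Im (h z)).

Lemma compact2_circle : compact2 circle.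
Proof.
  destruct (compact2_annulus 1 1) as [H1 H2]. unfold circle. split.
  - intros z Hz. destruct (H1 z) as [e [He H]]; [intros [? ?]; apply Hz; lra|].
    exists e; split; auto. intros w Hw E; apply (H w Hw); lra.
  - exists 1; intros; lra.
Qed.

Lemma Cmod_le_parts z : Cmod z <= Rabs (Re z) + Rabs (Im z).
Proof.
  pose proof (Rabs_pos (Re z)); pose proof (Rabs_pos (Im z)).
  unfold Cmod. rewrite <- (sqrt_square (Rabs (Re z) + Rabs (Im z))) by lra.
  apply sqrt_le_1_alt. unfold Re, Im in *.
  rewrite <- (pow2_abs (fst z)), <- (pow2_abs (snd z)).
  assert (0 <= Rabs (fst z) * Rabs (snd z)) by (apply Rmult_le_pos; auto). lra.
Qed.

(** The shape [e + B |x - y|^2] fits the second moment of the kernel. Uniform continuity handles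
    close points, and for [|x - y| >= d] the bound of [h] is absorbed by [B = 2 (M1 + M2) / d^2]. *)
Lemma cont_circle_modulus h : cont_circle h -> forall e, 0 < e -> exists B, 0 <= B /\
  forall x y, circle x -> circle y -> Cmod (h x - h y) <= e + B * Cmod (x - y) ^ 2.
Proof.
  intros [Hr Hi] e He.
  destruct (cont_on_uniform _ _ compact2_circle Hr (e / 2)) as [d1 [Hd1 H1]]; [lra|].
  destruct (cont_on_uniform _ _ compact2_circle Hi (e / 2)) as [d2 [Hd2 H2]]; [lra|].
  destruct (cont_on_bounded _ _ compact2_circle Hr) as [M1 [HM1 B1]].
  destruct (cont_on_bounded _ _ compact2_circle Hi) as [M2 [HM2 B2]].
  set (d := Rmin d1 d2). assert (Hd : 0 < d) by (apply Rmin_glb_lt; auto).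
  assert (Hi2 : 0 < / d ^ 2) by (apply Rinv_0_lt_compat, pow_lt; auto).
  exists (2 * (M1 + M2) * / d ^ 2). split; [apply Rmult_le_pos; lra|].
  intros x y Hx Hy. eapply Rle_trans; [apply Cmod_le_parts|].
  unfold Re, Im in *; change (fst (h x - h y)%C) with (fst (h x) + - fst (h y)).
  change (snd (h x - h y)%C) with (snd (h x) + - snd (h y)).
  destruct (Rlt_or_le (Cmod (x - y)) d) as [Hlt|Hge].
  - pose proof (Rmin_l d1 d2); pose proof (Rmin_r d1 d2).
    assert (L1 := H1 y x Hy Hx ltac:(unfold d in *; lra)).
    assert (L2 := H2 y x Hy Hx ltac:(unfold d in *; lra)).
    assert (0 <= 2 * (M1 + M2) * / d ^ 2 * Cmod (x - y) ^ 2).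
    { apply Rmult_le_pos; [apply Rmult_le_pos; lra|apply pow2_ge_0]. }
    unfold Rminus in *. lra.
  - specialize (B1 x Hx) as B1x; specialize (B1 y Hy) as B1y.
    specialize (B2 x Hx) as B2x; specialize (B2 y Hy) as B2y.
    assert (T : forall a b, Rabs (a + - b) <= Rabs a + Rabs b).
    { intros; eapply Rle_trans; [apply Rabs_triang|rewrite Rabs_Ropp; lra]. }
    pose proof (T (fst (h x)) (fst (h y))); pose proof (T (snd (h x)) (snd (h y))).
    assert (1 <= / d ^ 2 * Cmod (x - y) ^ 2).
    { rewrite <- (Rinv_l (d ^ 2)) by (apply pow_nonzero; lra).
      apply Rmult_le_compat_l; [lra|]. apply pow_incr; lra. }
    rewrite (Rmult_assoc (2 * (M1 + M2))).
    assert (2 * (M1 + M2) * 1 <= 2 * (M1 + M2) * (/ d ^ 2 * Cmod (x - y) ^ 2)).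
    { apply Rmult_le_compat_l; lra. }
    unfold Rminus in *. lra.
Qed.

Fixpoint pgeo (c : C) (n : nat) : list C :=
  match n with O => nil | S n' => RtoC 1 :: pscale c (pgeo c n') end.

Lemma peval_pgeo c n x : peval (pgeo c n) x = geo (x * c) n.
Proof.
  induction n as [|n IH]; [reflexivity|].
  simpl pgeo; cbn [peval]. rewrite peval_pscale, IH.
  rewrite geo_S. ring.
Qed.

Fixpoint psum (f : nat -> list C) (n : nat) : list C :=
  match n with O => nil | S n' => padd (psum f n') (f n') end.

Lemma peval_psum f n x : peval (psum f n) x = csum (fun k => peval (f k) x) n.
Proof. induction n as [|n IH]; simpl; [auto|rewrite peval_padd, IH; auto]. Qed.

(* The Fejer kernel [|geo u n|^2 / n], sampled at the [n]-th roots of unity,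
   is a partition of unity; multiplied by [x^(n-1)] it is a polynomial in [x]. *)
Lemma laurent_approximation h e : cont_circle h -> 0 < e ->
  exists M0, forall M, (M0 <= M)%nat ->
  exists A, forall x, circle x -> Cmod (peval A x - x ^ M * h x) <= e.
Proof.
  intros Hh He. destruct (cont_circle_modulus h Hh (e / 2)) as [B [HB Hmod]]; [lra|].
  (* With more than [8B/e] nodes the moment term [4B/n] is below [e/2]. *)
  destruct (nfloor_ex (8 * B / e)) as [N HN].
  { apply Rdiv_le_0_compat; lra. }
  exists N. intros M HM. set (n := S M). set (z := fun j => (zeta n ^ j)%C).
  assert (Hz : forall j, Cmod (z j) = 1).
  { intros j; unfold z; rewrite Cmod_pow. unfold zeta. rewrite Cmod_cis, pow1; auto. }
  assert (Hn : 0 < INR n) by (apply lt_0_INR; unfold n; lia).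
  assert (HnC : RtoC (INR n) <> RtoC 0) by (apply RtoC_S_neq).
  (* With [n = M + 1] and [u = x / z_j], the polynomial [geo(u)^2] equals [u^M |geo(u)|^2]; the
     factor [z_j^M] turns [u^M] into [x^M], common to all nodes. *)
  exists (psum (fun j => pscale (h (z j) * z j ^ M / (RtoC (INR n) * RtoC (INR n)))
     (pmul (pgeo (Cconj (z j)) n) (pgeo (Cconj (z j)) n))) n).
  intros x Hx. rewrite peval_psum.
  set (g := fun j => Cmod (geo (x * Cconj (z j)) n) ^ 2).
  assert (Hux : forall j, Cmod (x * Cconj (z j)) = 1).
  { intros j. rewrite Cmod_mult, Cmod_conj, Hz, Hx; ring. }
  rewrite (csum_ext _ (fun j => (x ^ M / (RtoC (INR n) * RtoC (INR n))) * (h (z j) * RtoC (g j)))%C).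
  2:{ intros j _. rewrite peval_pscale, peval_pmul, peval_pgeo.
      unfold g. rewrite Cmod2_conj.
      pose proof (geo_reflect (x * Cconj (z j)) M (Hux j)) as HR. fold n in HR.
      rewrite <- HR at 1. clear HR.
      rewrite Cpow_mult_l.
      transitivity ((z j ^ M * Cconj (z j) ^ M) * ((x ^ M / (RtoC (INR n) * RtoC (INR n))) *
        (h (z j) * (geo (x * Cconj (z j)) n * Cconj (geo (x * Cconj (z j)) n)))))%C.
      { field. auto. }
      rewrite <- Cpow_mult_l, conj_unit, Cpow_1_l by auto. ring. }
  rewrite csum_scal.
  assert (Hmean : rsum g n = INR n * INR n) by (apply fejer_mean; exact Hx).
  assert (Hmc : csum (fun j => RtoC (g j)) n = (RtoC (INR n) * RtoC (INR n))%C).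
  { rewrite <- RtoC_rsum, Hmean, RtoC_mult; reflexivity. }
  replace (x ^ M / (RtoC (INR n) * RtoC (INR n)) * csum (fun j => h (z j) * RtoC (g j)) n - x ^ M * h x)%C
    with (x ^ M / (RtoC (INR n) * RtoC (INR n)) * csum (fun j => (h (z j) - h x) * RtoC (g j)) n)%C.
  2:{ rewrite (csum_ext (fun j => (h (z j) - h x) * RtoC (g j))%C
        (fun j => h (z j) * RtoC (g j) + (- h x) * RtoC (g j))%C) by (intros; ring).
      rewrite csum_plus, csum_scal, Hmc. field; auto. }
  rewrite Cmod_mult, Cmod_div by (apply Cmult_neq_0; auto).
  rewrite Cmod_pow, Hx, pow1, Cmod_mult, Cmod_R, Rabs_pos_eq by lra.
  assert (Hs : Cmod (csum (fun j => (h (z j) - h x) * RtoC (g j))%C n)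
     <= e / 2 * (INR n * INR n) + B * (4 * INR n)).
  { eapply Rle_trans; [apply Cmod_csum|].
    apply Rle_trans with (rsum (fun j => e / 2 * g j + B * 4) n).
    - apply rsum_le; intros j _. rewrite Cmod_mult, Cmod_R.
      assert (Hg : 0 <= g j) by apply pow2_ge_0. rewrite (Rabs_pos_eq _ Hg).
      specialize (Hmod (z j) x (Hz j) Hx).
      assert (Hf := fejer_moment (x * Cconj (z j)) n (Hux j)). fold (g j) in Hf.
      replace (Cmod (x * Cconj (z j) - 1)) with (Cmod (z j - x)) in Hf.
      2:{ replace (x * Cconj (z j) - 1)%C with ((x - z j) * Cconj (z j))%C.
          - rewrite Cmod_mult, Cmod_conj, Hz, Cmod_sub_sym; ring.
          - rewrite <- (conj_unit (z j) (Hz j)). ring. }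
      apply Rle_trans with ((e / 2 + B * Cmod (z j - x) ^ 2) * g j); [apply Rmult_le_compat_r; lra|nra].
    - apply Req_le. transitivity (e / 2 * rsum g n + B * rsum (fun _ => 4) n).
      + apply (rsum_lin (e / 2) B g (fun _ => 4) n).
      + rewrite Hmean, rsum_const. ring. }
  apply Rle_trans with (1 / (INR n * INR n) * (e / 2 * (INR n * INR n) + B * (4 * INR n))).
  { apply Rmult_le_compat_l; [|exact Hs]. apply Rdiv_le_0_compat; nra. }
  replace (1 / (INR n * INR n) * (e / 2 * (INR n * INR n) + B * (4 * INR n)))
    with (e / 2 + 4 * B / INR n) by (field; lra).
  assert (4 * B / INR n <= e / 2); [|lra].
  apply Rle_div_l; [lra|].
  assert (8 * B / e < INR n).
  { destruct HN as [_ HN]. eapply Rlt_le_trans; [exact HN|]. unfold n. rewrite S_INR.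
    apply Rplus_le_compat_r, le_INR; auto. }
  apply Rlt_div_l in H; lra.
Qed.

(** * Perturbing spinors *)

Lemma eventually_and P Q : eventually P -> eventually Q -> eventually (fun n => P n /\ Q n).
Proof.
  intros [a Ha] [b Hb]. exists (Nat.max a b). intros n Hn; split; [apply Ha|apply Hb]; lia.
Qed.

Lemma eventually_INR_ge B : eventually (fun n => B <= INR n).
Proof.
  destruct (Rle_or_lt B 0) as [H|H].
  - exists 0%nat. intros n _. pose proof (pos_INR n); lra.
  - destruct (nfloor_ex B) as [N HN]; [lra|]. exists (S N). intros n Hn.
    apply le_INR in Hn. rewrite S_INR in Hn. lra.
Qed.

Lemma eventually_pow_le r e : 0 <= r < 1 -> 0 < e -> eventually (fun n => r ^ n <= e).
Proof.
  intros Hr He. destruct (pow_lt_1_zero r) with (y := e) as [N HN]; auto.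
  { rewrite Rabs_pos_eq; lra. }
  exists N. intros n Hn. specialize (HN n ltac:(lia)). apply Rabs_def2 in HN; lra.
Qed.

(** Writing [r = s^2], one factor [s^n] absorbs the linear term: Bernoulli applied to [1/s = 1 + d]
    gives [n s^n <= 1/d]. *)
Lemma eventually_linear_pow_le r a b e : 0 < r < 1 -> 0 <= a -> 0 <= b -> 0 < e ->
  eventually (fun n => (a * INR n + b) * r ^ n <= e).
Proof.
  intros Hr Ha Hb He. set (s := sqrt r).
  assert (Hs : 0 < s < 1).
  { unfold s; split; [apply sqrt_lt_R0; lra|]. rewrite <- sqrt_1. apply sqrt_lt_1; lra. }
  assert (Hss : s * s = r) by (apply sqrt_sqrt; lra).
  set (d := / s - 1).
  assert (Hd : 0 < d).
  { unfold d. assert (1 < / s) by (rewrite <- Rinv_1; apply Rinv_lt_contravar; lra). lra. }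
  assert (Hn : forall n, INR n * s ^ n <= / d).
  { intros n. pose proof (poly n d Hd) as Hb'. replace (1 + d) with (/ s) in Hb' by (unfold d; ring).
    rewrite pow_inv in Hb'. assert (0 < s ^ n) by (apply pow_lt; lra).
    apply Rmult_le_compat_r with (r := s ^ n) in Hb'; [|lra].
    rewrite Rinv_l in Hb' by lra.
    apply Rmult_le_reg_l with d; auto. rewrite Rinv_r by lra. nra. }
  assert (Hq : 0 < a * / d + b + 1).
  { assert (0 < / d) by now apply Rinv_0_lt_compat. nra. }
  destruct (eventually_pow_le s (e / (a * / d + b + 1))) as [N HN]; [lra|apply Rdiv_lt_0_compat; auto|].
  exists N. intros n HnN. specialize (HN n HnN). specialize (Hn n).
  assert (Hsn : 0 < s ^ n <= 1).
  { split; [apply pow_lt; lra|]. rewrite <- (pow1 n). apply pow_incr; lra. }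
  rewrite <- Hss, Rpow_mult_distr.
  apply Rle_trans with ((a * / d + b + 1) * s ^ n).
  - assert (a * (INR n * s ^ n) <= a * / d) by (apply Rmult_le_compat_l; lra).
    assert (b * s ^ n <= b * 1) by (apply Rmult_le_compat_l; lra).
    rewrite <- Rmult_assoc. apply Rmult_le_compat_r; lra.
  - apply Rmult_le_compat_l with (r := a * / d + b + 1) in HN; [|lra].
    revert HN Hq. generalize (a * / d + b + 1); intros q HN Hq.
    replace (q * (e / q)) with e in HN by (field; lra). exact HN.
Qed.

Lemma length_pmul p q : (length (pmul p q) <= length p + length q)%nat.
Proof.
  induction p as [|a p IH]; simpl; [lia|].
  eapply Nat.le_trans; [apply length_padd|]. rewrite length_pscale; simpl. lia.
Qed.

Definition spinor_quad (i : dir3) (P Q : list C) : list C :=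
  match i with
  | X1 => padd (pmul P P) (pscale (- RtoC 1)%C (pmul Q Q))
  | X2 => pscale Ci (padd (pmul P P) (pmul Q Q))
  | X3 => pscale (RtoC 2) (pmul P Q)
  end.
(** Twice the polarisation of the quadratic form [q], so that [q((P,Q) + k (A,B)) = q(P,Q) + k polar
    + k^2 q(A,B)]. *)
Definition spinor_polar (i : dir3) (P Q A B : list C) : list C :=
  match i with
  | X1 => pscale (RtoC 2) (padd (pmul P A) (pscale (- RtoC 1)%C (pmul Q B)))
  | X2 => pscale (RtoC 2 * Ci)%C (padd (pmul P A) (pmul Q B))
  | X3 => pscale (RtoC 2) (padd (pmul P B) (pmul Q A))
  end.

Lemma peval_spinor_quad i P Q z : peval (spinor_quad i P Q) z = qv i (peval P z) (peval Q z).
Proof.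
  destruct i; unfold spinor_quad, qv; rewrite ?peval_padd, ?peval_pscale, ?peval_padd, ?peval_pmul; ring.
Qed.

Lemma peval_spinor_polar i P Q A B k z :
  (qv i (peval P z) (peval Q z) + k * peval (spinor_polar i P Q A B) z + k * k * peval (spinor_quad i A B) z)%C
  = qv i (peval P z + k * peval A z) (peval Q z + k * peval B z).
Proof.
  destruct i; unfold spinor_polar, spinor_quad, qv; rewrite ?peval_pscale, ?peval_padd, ?peval_pscale, ?peval_pmul; ring.
Qed.

Lemma Cmod_2 : Cmod (RtoC 2) = 2.
Proof. rewrite Cmod_R; apply Rabs_pos_eq; lra. Qed.

Lemma pnorm_spinor_quad i P Q a : pnorm 1 P <= a -> pnorm 1 Q <= a -> pnorm 1 (spinor_quad i P Q) <= 2 * a * a.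
Proof.
  intros HP HQ. pose proof (pnorm_ge0 1 P ltac:(lra)) as P0. pose proof (pnorm_ge0 1 Q ltac:(lra)) as Q0.
  pose proof (pnorm_pmul 1 P P ltac:(lra)). pose proof (pnorm_pmul 1 Q Q ltac:(lra)).
  pose proof (pnorm_pmul 1 P Q ltac:(lra)).
  destruct i; unfold spinor_quad; rewrite ?pnorm_pscale, ?Cmod_Ci, ?Cmod_2.
  - eapply Rle_trans; [apply pnorm_padd; lra|]. rewrite pnorm_pscale, Cmod_opp, Cmod_1. nra.
  - pose proof (pnorm_padd 1 (pmul P P) (pmul Q Q) ltac:(lra)). nra.
  - nra.
Qed.

Lemma pnorm_spinor_polar i P Q A B s a : pnorm 1 P <= s -> pnorm 1 Q <= s -> pnorm 1 A <= a -> pnorm 1 B <= a ->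
  pnorm 1 (spinor_polar i P Q A B) <= 4 * s * a.
Proof.
  intros HP HQ HA HB. pose proof (pnorm_ge0 1 P ltac:(lra)) as P0. pose proof (pnorm_ge0 1 Q ltac:(lra)) as Q0.
  pose proof (pnorm_ge0 1 A ltac:(lra)) as A0. pose proof (pnorm_ge0 1 B ltac:(lra)) as B0.
  assert (M : forall U V, pnorm 1 U <= s -> pnorm 1 V <= a -> pnorm 1 (pmul U V) <= s * a).
  { intros U V HU HV. eapply Rle_trans; [apply pnorm_pmul; lra|].
    pose proof (pnorm_ge0 1 U ltac:(lra)); pose proof (pnorm_ge0 1 V ltac:(lra)). nra. }
  destruct i; unfold spinor_polar; rewrite ?pnorm_pscale, ?Cmod_mult, ?Cmod_Ci, ?Cmod_2.
  - pose proof (pnorm_padd 1 (pmul P A) (pscale (- RtoC 1) (pmul Q B)) ltac:(lra)) as H.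
    rewrite pnorm_pscale, Cmod_opp, Cmod_1 in H.
    pose proof (M P A HP HA); pose proof (M Q B HQ HB). lra.
  - pose proof (pnorm_padd 1 (pmul P A) (pmul Q B) ltac:(lra)) as H.
    pose proof (M P A HP HA); pose proof (M Q B HQ HB). lra.
  - pose proof (pnorm_padd 1 (pmul P B) (pmul Q A) ltac:(lra)) as H.
    pose proof (M P B HP HB); pose proof (M Q A HQ HA). lra.
Qed.

Lemma length_spinor_quad i P Q : (length (spinor_quad i P Q) <= 2 * (length P + length Q))%nat.
Proof.
  pose proof (length_pmul P P); pose proof (length_pmul Q Q); pose proof (length_pmul P Q).
  destruct i; unfold spinor_quad; rewrite ?length_pscale; try lia;
  (eapply Nat.le_trans; [apply length_padd|]; rewrite ?length_pscale; lia).
Qed.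

Lemma primn_padd n p q : primn n (padd p q) = padd (primn n p) (primn n q).
Proof.
  revert n q; induction p as [|a p IH]; intros n [|b q]; simpl; auto.
  rewrite IH; f_equal. unfold Cdiv; ring.
Qed.

Lemma primn_pscale n c p : primn n (pscale c p) = pscale c (primn n p).
Proof.
  revert n; induction p as [|a p IH]; intros n; simpl; auto.
  rewrite IH; f_equal. unfold Cdiv; ring.
Qed.

Lemma peval_prim_padd p q z : peval (prim (padd p q)) z = (peval (prim p) z + peval (prim q) z)%C.
Proof. unfold prim; simpl. rewrite primn_padd, peval_padd; ring. Qed.

Lemma peval_prim_pscale c p z : peval (prim (pscale c p)) z = (c * peval (prim p) z)%C.
Proof. unfold prim; simpl. rewrite primn_pscale, peval_pscale; ring. Qed.

Lemma pnorm_prim r p : 0 <= r <= 1 -> pnorm r (prim p) <= pnorm r p.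
Proof.
  intros Hr. unfold prim; simpl. rewrite Cmod_0.
  pose proof (pnorm_primn r 0 p ltac:(lra)) as H. simpl in H. rewrite Rdiv_1_r in H.
  pose proof (pnorm_ge0 r (primn 0 p) ltac:(lra)). nra.
Qed.

Lemma peval_pder_padd p q z : peval (pder (padd p q)) z = (peval (pder p) z + peval (pder q) z)%C.
Proof.
  revert q; induction p as [|a p IH]; intros [|b q]; cbn [padd pder peval]; try ring.
  rewrite !peval_padd. cbn [peval]. rewrite IH. ring.
Qed.

Lemma qv_close i p s p' s' B d : Cmod p <= B -> Cmod s <= B -> Cmod p' <= B -> Cmod s' <= B ->
  Cmod (p - p') <= d -> Cmod (s - s') <= d -> Cmod (qv i p s - qv i p' s') <= 4 * B * d.
Proof.
  intros Hp Hs Hp' Hs' Hd1 Hd2.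
  pose proof (Cmod_ge_0 p); pose proof (Cmod_ge_0 s); pose proof (Cmod_ge_0 p'); pose proof (Cmod_ge_0 s').
  pose proof (Cmod_ge_0 (p - p')); pose proof (Cmod_ge_0 (s - s')).
  assert (E1 : Cmod ((p - p') * (p + p')) <= d * (2 * B)).
  { rewrite Cmod_mult. pose proof (Cmod_triangle p p'). apply Rmult_le_compat; try apply Cmod_ge_0; lra. }
  assert (E2 : Cmod ((s - s') * (s + s')) <= d * (2 * B)).
  { rewrite Cmod_mult. pose proof (Cmod_triangle s s'). apply Rmult_le_compat; try apply Cmod_ge_0; lra. }
  destruct i; unfold qv.
  - replace (p * p - s * s - (p' * p' - s' * s'))%C
      with ((p - p') * (p + p') + - ((s - s') * (s + s')))%C by ring.
    eapply Rle_trans; [apply Cmod_triangle|]. rewrite Cmod_opp. lra.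
  - replace (Ci * (p * p + s * s) - Ci * (p' * p' + s' * s'))%C
      with (Ci * ((p - p') * (p + p') + ((s - s') * (s + s'))))%C by ring.
    rewrite Cmod_mult, Cmod_Ci. pose proof (Cmod_triangle ((p - p') * (p + p')) ((s - s') * (s + s'))). lra.
  - replace (2 * (p * s) - 2 * (p' * s'))%C with (2 * ((p - p') * s + p' * (s - s')))%C by ring.
    rewrite Cmod_mult, Cmod_2.
    pose proof (Cmod_triangle ((p - p') * s) (p' * (s - s'))). rewrite !Cmod_mult in H5. nra.
Qed.

(** The phase [x^M] left over by the Laurent approximation becomes [x^(2M)] on the null vector,
    which merely rotates its circle. *)
Lemma qv_scal i c p s : qv i (c * p) (c * s) = (c * c * qv i p s)%C.
Proof. destruct i; unfold qv; ring. Qed.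

(* [Re F] is a conformal minimal immersion with spinor [(P, Q)]. The condition at [0] keeps [P]
   nonzero when the spinor is perturbed by multiples of [z^n]. *)
Definition stage (P Q : list C) (F : dir3 -> list C) : Prop :=
  (forall i z, peval (pder (F i)) z = qv i (peval P z) (peval Q z)) /\
  (forall z, peval P z <> RtoC 0 \/ peval Q z <> RtoC 0) /\ peval P 0 <> RtoC 0.

Definition speed (F : dir3 -> list C) (z : C) : R := lam (fun i => peval (pder (F i)) z).

Lemma speed_stage P Q F z : stage P Q F -> speed F z = Cmod (peval P z) ^ 2 + Cmod (peval Q z) ^ 2.
Proof.
  intros [H _]. unfold speed, lam, revec, vec. rewrite !H.
  change (lam (fun i => qv i (peval P z) (peval Q z)) = Cmod (peval P z) ^ 2 + Cmod (peval Q z) ^ 2).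
  rewrite lam_qv. ring.
Qed.

Definition spinor_pert (k : R) (n : nat) (P A : list C) : list C :=
  padd P (pscale (RtoC k) (pshift n A)).
(** The increment of [F'] when [k z^n (A, B)] is added to the spinor; its primitive is the
    displacement of the map. *)
Definition deriv_pert (k : R) (n : nat) (P Q A B : list C) (i : dir3) : list C :=
  padd (pscale (RtoC k) (pshift n (spinor_polar i P Q A B)))
       (pscale (RtoC (k * k)) (pshift (2 * n) (spinor_quad i A B))).

Lemma peval_spinor_pert k n P A z : peval (spinor_pert k n P A) z = (peval P z + (RtoC k * z ^ n) * peval A z)%C.
Proof. unfold spinor_pert. rewrite peval_padd, peval_pscale, peval_pshift. ring. Qed.

Lemma peval_deriv_pert k n P Q A B i z :
  (qv i (peval P z) (peval Q z) + peval (deriv_pert k n P Q A B i) z)%C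
  = qv i (peval (spinor_pert k n P A) z) (peval (spinor_pert k n Q B) z).
Proof.
  rewrite !peval_spinor_pert, <- peval_spinor_polar. unfold deriv_pert.
  rewrite peval_padd, !peval_pscale, !peval_pshift, RtoC_mult.
  replace (z ^ (2 * n))%C with (z ^ n * z ^ n)%C; [ring|].
  rewrite <- Cpow_add_r. f_equal; lia.
Qed.

(* A generic small constant [t] removes the common zeros of the perturbed spinor. *)
Lemma stage_pert P Q F A B k n e : stage P Q F -> 0 < k -> (0 < n)%nat -> 0 < e ->
  exists t, 0 < t < e /\
    stage (spinor_pert k n P A) (spinor_pert k n Q (padd B [RtoC t]))
      (fun i => padd (F i) (prim (deriv_pert k n P Q A (padd B [RtoC t]) i))).
Proof.
  intros [HF [HPQ HP0]] Hk Hn He.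
  set (P' := spinor_pert k n P A).
  assert (HP0' : peval P' 0 = peval P 0).
  { unfold P'. rewrite peval_spinor_pert. destruct n; [lia|]. simpl; ring. }
  destruct (polynomial_finite_roots P') as [l Hl].
  { exists (RtoC 0). rewrite HP0'; exact HP0. }
  (* At a common zero [z] of the perturbed spinor, [t] would equal [- Q(z)/(k z^n) - B(z)], and [z]
     ranges over the finite zero set of the first entry. *)
  destruct (exists_real_avoiding
    (map (fun z => fst (- (peval Q z / (RtoC k * z ^ n)) - peval B z)%C) l) e He) as [t [Ht Hav]].
  exists t; split; [exact Ht|]. split; [|split].
  - intros i z. rewrite peval_pder_padd, HF, pder_prim, peval_app_zero. apply peval_deriv_pert.
  - intros z. destruct (Ceq_dec (peval P' z) 0) as [Hz|Hz]; [right|left; exact Hz].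
    rewrite peval_spinor_pert. intros E. apply Hav. apply in_map_iff. exists z; split; [|apply Hl; exact Hz].
    assert (Hz0 : z <> RtoC 0).
    { intros ->. rewrite HP0' in Hz. contradiction. }
    assert (Hkz : (RtoC k * z ^ n)%C <> RtoC 0).
    { apply Cmult_neq_0; [|apply Cpow_nz; auto]. intros E'; apply RtoC_inj in E'; lra. }
    rewrite peval_padd in E. cbn [peval] in E.
    replace (- (peval Q z / (RtoC k * z ^ n)) - peval B z)%C with (RtoC t); [reflexivity|].
    replace (peval Q z) with (- (RtoC k * z ^ n) * (peval B z + (RtoC t + z * 0)))%C.
    + field. split; [apply Cpow_nz; auto|intros E'; apply RtoC_inj in E'; lra].
    + transitivity (peval Q z - (peval Q z + RtoC k * z ^ n * (peval B z + (RtoC t + z * 0))))%C; [ring|].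
      rewrite E; ring.
  - rewrite HP0'; exact HP0.
Qed.

Lemma pnorm_deriv_pert P Q A B i k n r s a : 0 <= r <= 1 -> 0 <= k -> 0 <= s ->
  pnorm 1 P <= s -> pnorm 1 Q <= s -> pnorm 1 A <= a -> pnorm 1 B <= a ->
  pnorm r (deriv_pert k n P Q A B i) <= k * r ^ n * (4 * s * a) + k * k * r ^ (2 * n) * (2 * a * a).
Proof.
  intros Hr Hk Hs HP HQ HA HB. unfold deriv_pert.
  eapply Rle_trans; [apply pnorm_padd; lra|].
  rewrite !pnorm_pscale, !pnorm_pshift, !Cmod_R, !Rabs_pos_eq by nra.
  pose proof (pnorm_spinor_polar i P Q A B s a HP HQ HA HB). pose proof (pnorm_spinor_quad i A B a HA HB).
  pose proof (pnorm_mono r 1 (spinor_polar i P Q A B) ltac:(lra)). pose proof (pnorm_mono r 1 (spinor_quad i A B) ltac:(lra)).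
  pose proof (pow_le r n ltac:(lra)). pose proof (pow_le r (2 * n) ltac:(lra)).
  rewrite !Rmult_assoc. apply Rplus_le_compat.
  - apply Rmult_le_compat_l; [lra|]. apply Rmult_le_compat_l; lra.
  - do 2 (apply Rmult_le_compat_l; [lra|]). apply Rmult_le_compat_l; lra.
Qed.

(* Since [k^2] is close to [2n], integrating [k^2 z^(2n) q(A, B)] gives [z^(2n+1) q(A, B)] up to
   [O(1/n)], while the cross term contributes [O(k/n)]. *)
Lemma prim_deriv_pert_approx P Q A B i k n s a z M : Cmod z <= 1 -> 0 <= k -> 0 <= s ->
  pnorm 1 P <= s -> pnorm 1 Q <= s -> pnorm 1 A <= a -> pnorm 1 B <= a ->
  k * k = 2 * INR (n + M) + 1 ->
  Cmod (peval (prim (deriv_pert k n P Q A B i)) z - z ^ (S (2 * n)) * qv i (peval A z) (peval B z))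
   <= k * (4 * s * a) / INR (S n)
    + (2 * INR M + 2 * INR (length A + length B)) * (2 * a * a) / INR (S (2 * n)).
Proof.
  intros Hz Hk Hs HP HQ HA HB Hkk. unfold deriv_pert.
  rewrite peval_prim_padd, !peval_prim_pscale, !prim_pshift, !peval_pshift, <- peval_spinor_quad.
  replace (RtoC k * (z ^ S n * peval (primn n (spinor_polar i P Q A B)) z) +
     RtoC (k * k) * (z ^ S (2 * n) * peval (primn (2 * n) (spinor_quad i A B)) z) -
     z ^ S (2 * n) * peval (spinor_quad i A B) z)%C
  with (RtoC k * z ^ S n * peval (primn n (spinor_polar i P Q A B)) z +
     z ^ S (2 * n) * (RtoC (k * k) * peval (primn (2 * n) (spinor_quad i A B)) z - peval (spinor_quad i A B) z))%C by ring.
  eapply Rle_trans; [apply Cmod_triangle|].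
  assert (Hzp : forall m, 0 <= Cmod (z ^ m) <= 1).
  { intros m. split; [apply Cmod_ge_0|]. rewrite Cmod_pow, <- (pow1 m).
    apply pow_incr; split; [apply Cmod_ge_0|auto]. }
  rewrite !Cmod_mult, Cmod_R, Rabs_pos_eq by lra.
  pose proof (pos_INR M) as HM. pose proof (pos_INR (length A + length B)) as HL.
  assert (Hn1 : 0 < / INR (S n)) by (apply Rinv_0_lt_compat, lt_0_INR; lia).
  assert (Hn2 : 0 < / INR (S (2 * n))) by (apply Rinv_0_lt_compat, lt_0_INR; lia).
  apply Rplus_le_compat.
  - pose proof (Cmod_peval_le 1 (primn n (spinor_polar i P Q A B)) z Hz) as H1.
    pose proof (pnorm_primn 1 n (spinor_polar i P Q A B) ltac:(lra)) as H2.
    pose proof (pnorm_spinor_polar i P Q A B s a HP HQ HA HB) as H3.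
    apply Rle_trans with (k * 1 * (4 * s * a / INR (S n))); [|unfold Rdiv; lra].
    apply Rmult_le_compat; try apply Cmod_ge_0.
    + apply Rmult_le_pos; [lra|apply Hzp].
    + apply Rmult_le_compat_l; [lra|apply Hzp].
    + eapply Rle_trans; [exact H1|]. eapply Rle_trans; [exact H2|].
      unfold Rdiv. apply Rmult_le_compat_r; lra.
  - pose proof (primn_approx (2 * n) (k * k) (spinor_quad i A B) z Hz) as H1.
    pose proof (pnorm_spinor_quad i A B a HA HB) as H3. pose proof (pnorm_ge0 1 (spinor_quad i A B) ltac:(lra)) as H4.
    assert (H5 : INR (length (spinor_quad i A B)) <= 2 * INR (length A + length B)).
    { change 2 with (INR 2). rewrite <- mult_INR. apply le_INR, length_spinor_quad. }
    assert (H6 : Rabs (k * k - INR (S (2 * n))) = 2 * INR M).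
    { rewrite Hkk, S_INR, mult_INR, plus_INR. change (INR 2) with 2. rewrite Rabs_pos_eq; lra. }
    rewrite H6 in H1. rewrite <- (Rmult_1_l (_ / _)).
    apply Rmult_le_compat; try apply Cmod_ge_0; [apply Hzp|].
    eapply Rle_trans; [exact H1|]. unfold Rdiv. apply Rmult_le_compat_r; [lra|].
    apply Rmult_le_compat; try lra. pose proof (pos_INR (length (spinor_quad i A B))); lra.
Qed.

Definition unitize (z : C) : C := (z / RtoC (Cmod z))%C.

Lemma Cmod_unitize z : z <> RtoC 0 -> Cmod (unitize z) = 1.
Proof.
  intros Hz. unfold unitize. apply Cmod_gt_0 in Hz.
  rewrite Cmod_div by (intros E; apply RtoC_inj in E; lra).
  rewrite Cmod_R, Rabs_pos_eq by lra. field; lra.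
Qed.

Lemma unitize_eq z : z <> RtoC 0 -> z = (RtoC (Cmod z) * unitize z)%C.
Proof.
  intros Hz. unfold unitize. field. intros E; apply RtoC_inj in E.
  apply Cmod_gt_0 in Hz; lra.
Qed.

Lemma unitize_dist z : z <> RtoC 0 -> Cmod z <= 1 -> Cmod (unitize z - z) = 1 - Cmod z.
Proof.
  intros Hz H1. pose proof (unitize_eq z Hz) as E. pose proof (Cmod_unitize z Hz) as U.
  replace (unitize z - z)%C with (RtoC (1 - Cmod z) * unitize z)%C.
  - rewrite Cmod_mult, U, Cmod_R, Rabs_pos_eq; lra.
  - transitivity (unitize z - RtoC (Cmod z) * unitize z)%C; [rewrite RtoC_minus; ring|].
    rewrite <- E. reflexivity.
Qed.

Lemma bernoulli_le x n : 0 <= x <= 1 -> 1 - INR n * x <= (1 - x) ^ n.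
Proof.
  intros Hx. induction n as [|n IH]; [simpl; lra|].
  rewrite S_INR. simpl. assert (0 <= (1 - x) ^ n) by (apply pow_le; lra).
  pose proof (pos_INR n). assert (0 <= INR n * x * x) by (apply Rmult_le_pos; [nra|lra]).
  apply Rle_trans with ((1 - x) * (1 - INR n * x)); [nra|].
  apply Rmult_le_compat_l; lra.
Qed.

Lemma Cmod_sq_add_ge u v : Cmod v ^ 2 / 2 - Cmod u ^ 2 <= Cmod (u + v) ^ 2.
Proof.
  pose proof (Cmod_triangle (u + v) (- u)) as H. replace (u + v + - u)%C with v in H by ring.
  rewrite Cmod_opp in H. pose proof (Cmod_ge_0 u); pose proof (Cmod_ge_0 v); pose proof (Cmod_ge_0 (u + v)).
  assert (Cmod v ^ 2 <= (Cmod (u + v) + Cmod u) ^ 2) by (apply pow_incr; lra).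
  pose proof (pow2_ge_0 (Cmod (u + v) - Cmod u)). lra.
Qed.

(** All demands on the exponent at once. Here [n + M] is the [N] of the overview, and [M] clears the
    poles of the Laurent spinor. As [k] is of order [sqrt n], the first two errors are [O(n^(-1/2))]
    and [O(1/n)]; the others decay geometrically or only ask for large [N]. *)
Lemma spinor_step_parameter s a len M r0 rho rho1 e :
  0 <= s -> 0 <= a -> 0 < r0 -> 0 < rho < 1 -> 0 <= rho1 < 1 -> 0 < e ->
  exists n, (0 < n)%nat /\
    let k := sqrt (2 * INR (n + M) + 1) in
    k * (4 * s * a) / INR (S n) <= e / 8 /\
    (2 * INR M + 2 * INR len) * (2 * a * a) / INR (S (2 * n)) <= e / 8 /\
    rho1 ^ n * (2 * a * a) <= e / 4 /\
    k * rho ^ n * (4 * s * a) + k * k * rho ^ (2 * n) * (2 * a * a) <= e /\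
    / (4 * INR (n + M)) < 1 - rho /\ / (4 * INR (n + M)) <= 1 - rho1 /\
    2 * s ^ 2 <= INR (n + M) * r0 / 64.
Proof.
  intros Hs Ha Hr0 Hrho Hrho1 He.
  pose proof (pos_INR M) as HM. pose proof (pos_INR len) as Hl.
  set (b := 4 * s * a). set (c := 2 * a * a).
  assert (Hb : 0 <= b) by (unfold b; apply Rmult_le_pos; lra).
  assert (Hc : 0 <= c) by (unfold c; apply Rmult_le_pos; lra).
  destruct (eventually_and _ _ (eventually_INR_ge ((2 * INR M + 3) * (8 * b / e) ^ 2))
    (eventually_and _ _ (eventually_INR_ge ((2 * INR M + 2 * INR len) * c * 8 / e))
    (eventually_and _ _ (eventually_pow_le rho1 (e / 4 / (c + 1)) Hrho1 ltac:(apply Rdiv_lt_0_compat; lra))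
    (eventually_and _ _ (eventually_linear_pow_le rho (2 * (b + c)) ((2 * INR M + 1) * (b + c)) e Hrho
        ltac:(lra) ltac:(apply Rmult_le_pos; lra) He)
    (eventually_and _ _ (eventually_INR_ge (/ (1 - rho)))
    (eventually_and _ _ (eventually_INR_ge (/ (1 - rho1))) (eventually_INR_ge (2 * s ^ 2 * 64 / r0)))))))) as [n0 H].
  exists (S n0). split; [lia|]. specialize (H (S n0) ltac:(lia)).
  set (n := S n0) in *. destruct H as [H1 [H2 [H3 [H4 [H5 [H6 H7]]]]]].
  assert (Hn : 1 <= INR n) by (change 1 with (INR 1); apply le_INR; unfold n; lia).
  intro k. assert (Hkk : k * k = 2 * INR (n + M) + 1).
  { apply sqrt_sqrt. pose proof (pos_INR (n + M)); lra. }
  rewrite plus_INR in *. assert (Hk : 1 <= k).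
  { unfold k. rewrite <- sqrt_1 at 1. apply sqrt_le_1_alt. rewrite plus_INR; lra. }
  assert (Hpn : 0 < rho ^ n) by (apply pow_lt; lra).
  repeat split.
  - rewrite S_INR. apply Rle_div_l; [lra|]. apply Rsqr_incr_0_var; [|apply Rmult_le_pos; lra].
    unfold Rsqr. replace (k * (b) * (k * b)) with ((k * k) * (b * b)) by ring. rewrite Hkk.
    apply Rle_trans with ((2 * INR M + 3) * (INR n + 1) * (b * b)).
    + apply Rmult_le_compat_r; nra.
    + replace ((2 * INR M + 3) * (8 * b / e) ^ 2) with ((2 * INR M + 3) * (b * b) * (64 / (e * e))) in H1
        by (field; lra).
      assert (He2 : 0 < e * e) by nra.
      assert ((2 * INR M + 3) * (b * b) <= INR n * (e * e / 64)).
      { apply Rmult_le_compat_r with (r := e * e / 64) in H1; [|lra].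
        replace ((2 * INR M + 3) * (b * b) * (64 / (e * e)) * (e * e / 64))
          with ((2 * INR M + 3) * (b * b)) in H1 by (field; lra). exact H1. }
      replace ((2 * INR M + 3) * (INR n + 1) * (b * b)) with ((INR n + 1) * ((2 * INR M + 3) * (b * b))) by ring.
      apply Rle_trans with ((INR n + 1) * (INR n * (e * e / 64))).
      * apply Rmult_le_compat_l; lra.
      * replace (e / 8 * (INR n + 1) * (e / 8 * (INR n + 1)))
          with ((INR n + 1) * ((INR n + 1) * (e * e / 64))) by field.
        apply Rmult_le_compat_l; [lra|]. apply Rmult_le_compat_r; lra.
  - rewrite S_INR, mult_INR. change (INR 2) with 2. apply Rle_div_l; [lra|].
    apply Rle_div_l in H2; [|lra]. fold c. nra.
  - apply Rle_trans with (e / 4 / (c + 1) * c).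
    + apply Rmult_le_compat_r; auto.
    + replace (e / 4 / (c + 1) * c) with (e / 4 * (c / (c + 1))) by (field; lra).
      rewrite <- (Rmult_1_r (e / 4)) at 2. apply Rmult_le_compat_l; [lra|].
      apply Rle_div_l; lra.
  - eapply Rle_trans; [|exact H4].
    assert (Hp2 : rho ^ (2 * n) <= rho ^ n).
    { replace (2 * n)%nat with (n + n)%nat by lia. rewrite pow_add.
      rewrite <- (Rmult_1_r (rho ^ n)) at 3. apply Rmult_le_compat_l; [lra|].
      rewrite <- (pow1 n). apply pow_incr; lra. }
    assert (0 <= rho ^ (2 * n)) by (apply pow_le; lra).
    apply Rle_trans with (k * k * rho ^ n * b + k * k * rho ^ n * c).
    + apply Rplus_le_compat.
      * apply Rmult_le_compat_r; auto. apply Rmult_le_compat_r; [lra|nra].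
      * apply Rmult_le_compat_r; auto. apply Rmult_le_compat_l; [nra|auto].
    + rewrite Hkk. apply Req_le; ring.
  - apply Rle_lt_trans with (/ (4 * / (1 - rho))).
    + apply Rinv_le_contravar; [|lra]. assert (0 < / (1 - rho)) by (apply Rinv_0_lt_compat; lra). lra.
    + rewrite Rinv_mult, Rinv_inv. lra.
  - apply Rle_trans with (/ (4 * / (1 - rho1))).
    + apply Rinv_le_contravar; [|lra]. assert (0 < / (1 - rho1)) by (apply Rinv_0_lt_compat; lra). lra.
    + rewrite Rinv_mult, Rinv_inv. lra.
  - apply Rle_div_l in H7; [|lra]. assert (0 <= INR M * r0) by nra. lra.
Qed.

(** Near the circle the displacement is about [z^(2n+1) x^(2M) q(h1, h2)], taken at the radial
    projection [x] of [z]; boundary points land on the full circle and interior points in its disc.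
    The speed is at least of order [N r0] on an annulus of width of order [1/N], so the intrinsic
    gain is a fixed multiple of [r0] whatever the precision [e]. *)
Lemma spinor_step P Q F h1 h2 r0 rho e :
  stage P Q F -> cont_circle h1 -> cont_circle h2 -> 0 < r0 ->
  (forall x, circle x -> r0 <= Cmod (h1 x) ^ 2 + Cmod (h2 x) ^ 2) ->
  0 < rho < 1 -> 0 < e ->
  exists P' Q' D, stage P' Q' (fun i => padd (F i) (D i)) /\
    (forall i, pnorm rho (D i) <= e /\ pnorm rho (pder (D i)) <= e) /\
    (forall z, Cmod z <= 1 -> (forall i, Cmod (peval (D i) z) <= e) \/
       exists x w, circle x /\ Cmod (x - z) <= e /\ Cmod w <= 1 /\
         forall i, Cmod (peval (D i) z - w * qv i (h1 x) (h2 x)) <= e) /\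
    (forall x, circle x -> exists w, Cmod w = 1 /\
         forall i, Cmod (peval (D i) x - w * qv i (h1 x) (h2 x)) <= e) /\
    exists a b c, rho < a < b /\ b < 1 /\ 0 < c /\ r0 / 100 <= c * (b - a) /\
      forall z, a <= Cmod z <= b -> c <= speed (fun i => padd (F i) (D i)) z.
Proof.
  intros HS Hh1 Hh2 Hr0 Hr Hrho He.
  assert (HB : exists B, 1 <= B /\ forall x, circle x -> Cmod (h1 x) + 1 <= B /\ Cmod (h2 x) + 1 <= B).
  { destruct Hh1 as [R1 I1]. destruct Hh2 as [R2' I2].
    destruct (cont_on_bounded _ _ compact2_circle R1) as [a1 [A1p H1]].
    destruct (cont_on_bounded _ _ compact2_circle I1) as [a2 [A2p H2]].
    destruct (cont_on_bounded _ _ compact2_circle R2') as [a3 [A3p H3]].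
    destruct (cont_on_bounded _ _ compact2_circle I2) as [a4 [A4p H4]].
    exists (a1 + a2 + a3 + a4 + 1). split; [lra|]. intros x Hx.
    pose proof (Cmod_le_parts (h1 x)); pose proof (Cmod_le_parts (h2 x)).
    specialize (H1 x Hx); specialize (H2 x Hx); specialize (H3 x Hx); specialize (H4 x Hx). lra. }
  destruct HB as [B [HB1 HB]].
  (* Chosen for [3 e2 <= 1], [18 e2^2 <= r0/4] and [12 B e2 <= e/4]: the approximating spinors stay
     below [B], their squared norm stays above [r0/4], and the quadratic form is off by at most
     [e/4]. *)
  set (e2 := Rmin (Rmin (1 / 3) (r0 / 72)) (e / (48 * B))).
  assert (He2 : 0 < e2).
  { unfold e2; repeat apply Rmin_glb_lt; try lra. apply Rdiv_lt_0_compat; lra. }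
  assert (He2a : e2 <= 1 / 3) by (unfold e2; eapply Rle_trans; [apply Rmin_l|apply Rmin_l]).
  assert (He2b : e2 <= r0 / 72) by (unfold e2; eapply Rle_trans; [apply Rmin_l|apply Rmin_r]).
  assert (He2c : 12 * B * e2 <= e / 4).
  { assert (e2 <= e / (48 * B)) by (unfold e2; apply Rmin_r).
    apply Rle_div_r in H; lra. }
  destruct (laurent_approximation h1 e2 Hh1 He2) as [M1 HM1].
  destruct (laurent_approximation h2 e2 Hh2 He2) as [M2 HM2].
  set (M := Nat.max M1 M2).
  destruct (HM1 M ltac:(unfold M; lia)) as [A1 HA1]. destruct (HM2 M ltac:(unfold M; lia)) as [A2 HA2].
  clear HM1 HM2.
  set (LA := pnorm 2 A1 + pnorm 2 A2 + 1).
  pose proof (pnorm_ge0 2 A1 ltac:(lra)) as PA1. pose proof (pnorm_ge0 2 A2 ltac:(lra)) as PA2.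
  (* Width of the collar [1 - g <= |z| <= 1], on which [A1] and [A2] differ from their values at the
     projection by at most [e2], [LA] being a Lipschitz constant on the unit disc. Further inside,
     the factor [z^(2n+1)] makes the quadratic term small. *)
  set (g := Rmin (1 / 2) (Rmin e (e2 / LA))).
  assert (Hg : 0 < g).
  { unfold g; repeat apply Rmin_glb_lt; try lra. apply Rdiv_lt_0_compat; unfold LA; lra. }
  assert (Hga : g <= 1 / 2) by (unfold g; apply Rmin_l).
  assert (Hgb : g <= e) by (unfold g; eapply Rle_trans; [apply Rmin_r|apply Rmin_l]).
  assert (Hgc : g * LA <= e2).
  { assert (g <= e2 / LA) by (unfold g; eapply Rle_trans; [apply Rmin_r|apply Rmin_r]).
    apply Rle_div_r in H; [lra|unfold LA; lra]. }
  set (s := pnorm 1 P + pnorm 1 Q). set (a := pnorm 1 A1 + pnorm 1 A2 + 1).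
  pose proof (pnorm_ge0 1 P ltac:(lra)) as P0. pose proof (pnorm_ge0 1 Q ltac:(lra)) as Q0.
  pose proof (pnorm_ge0 1 A1 ltac:(lra)) as A10. pose proof (pnorm_ge0 1 A2 ltac:(lra)) as A20.
  destruct (spinor_step_parameter s a (length A1 + length A2 + 1) M r0 rho (1 - g) e)
    as [n [Hn [N1 [N2 [N3 [N4 [N5 [N6 N7]]]]]]]]; try (unfold s, a; lra).
  set (k := sqrt (2 * INR (n + M) + 1)) in *.
  assert (HnM : 1 <= INR (n + M)) by (change 1 with (INR 1); apply le_INR; lia).
  assert (Hkk : k * k = 2 * INR (n + M) + 1) by (apply sqrt_sqrt; lra).
  assert (Hk : 0 < k) by (apply sqrt_lt_R0; lra).
  destruct (stage_pert P Q F A1 A2 k n e2 HS Hk Hn He2) as [t [Ht Hst]].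
  set (B' := padd A2 [RtoC t]) in *.
  assert (HB'n : pnorm 1 B' <= a).
  { unfold B'. eapply Rle_trans; [apply pnorm_padd; lra|]. simpl. rewrite Cmod_R, Rabs_pos_eq by lra.
    unfold a; lra. }
  assert (HA1n : pnorm 1 A1 <= a) by (unfold a; lra).
  set (D := fun i => prim (deriv_pert k n P Q A1 B' i)).
  assert (Happ : forall z, 1 - g <= Cmod z <= 1 -> z <> RtoC 0 ->
     let x := unitize z in circle x /\ Cmod (x - z) <= e /\
       Cmod (peval A1 z - x ^ M * h1 x) <= 3 * e2 /\ Cmod (peval B' z - x ^ M * h2 x) <= 3 * e2).
  { intros z Hz Hz0 x. assert (Hx : circle x) by (apply Cmod_unitize; auto).
    assert (Hxz : Cmod (x - z) = 1 - Cmod z) by (apply unitize_dist; [auto|lra]).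
    assert (HL : forall A0, pnorm 2 A0 <= LA -> Cmod (peval A0 z - peval A0 x) <= e2).
    { intros A0 HA0. pose proof (peval_lipschitz 1 2 A0 x (z - x)) as HL.
      replace (x + (z - x))%C with z in HL by ring.
      eapply Rle_trans; [apply HL|]; [lra|unfold circle in Hx; lra|lra|].
      rewrite Cmod_sub_sym, Hxz. replace (2 - 1) with 1 by ring. rewrite Rdiv_1_r.
      pose proof (pnorm_ge0 2 A0 ltac:(lra)).
      apply Rle_trans with (g * LA); [|lra]. apply Rmult_le_compat; lra. }
    split; [exact Hx|]. split; [lra|]. split.
    - replace (peval A1 z - x ^ M * h1 x)%C with ((peval A1 z - peval A1 x) + (peval A1 x - x ^ M * h1 x))%C by ring.
      eapply Rle_trans; [apply Cmod_triangle|].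
      pose proof (HL A1 ltac:(unfold LA; lra)). pose proof (HA1 x Hx). lra.
    - unfold B'. rewrite peval_padd; cbn [peval].
      replace (peval A2 z + (RtoC t + z * 0) - x ^ M * h2 x)%C
        with ((peval A2 z - peval A2 x) + (peval A2 x - x ^ M * h2 x) + RtoC t)%C by ring.
      eapply Rle_trans; [apply Cmod_triangle|]. rewrite Cmod_R, Rabs_pos_eq by lra.
      pose proof (Cmod_triangle (peval A2 z - peval A2 x) (peval A2 x - x ^ M * h2 x)).
      pose proof (HL A2 ltac:(unfold LA; lra)). pose proof (HA2 x Hx). lra. }
  assert (Hprim : forall i z, Cmod z <= 1 ->
     Cmod (peval (D i) z - z ^ S (2 * n) * qv i (peval A1 z) (peval B' z)) <= e / 4).
  { intros i z Hz. eapply Rle_trans.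
    - apply (prim_deriv_pert_approx P Q A1 B' i k n s a z M Hz); unfold s; lra.
    - assert (Hlen : INR (length A1 + length B') <= INR (length A1 + length A2 + 1)).
      { apply le_INR. unfold B'. pose proof (length_padd A2 [RtoC t]). simpl in *; lia. }
      assert ((2 * INR M + 2 * INR (length A1 + length B')) * (2 * a * a) / INR (S (2 * n))
        <= (2 * INR M + 2 * INR (length A1 + length A2 + 1)) * (2 * a * a) / INR (S (2 * n))).
      { unfold Rdiv. apply Rmult_le_compat_r.
        - left; apply Rinv_0_lt_compat, lt_0_INR; lia.
        - apply Rmult_le_compat_r; [unfold a; nra|lra]. }
      lra. }
  assert (Hmain : forall z, 1 - g <= Cmod z <= 1 -> z <> RtoC 0 ->
     forall i, Cmod (peval (D i) z - (z ^ S (2 * n) * (unitize z ^ M * unitize z ^ M))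
        * qv i (h1 (unitize z)) (h2 (unitize z))) <= e).
  { intros z Hz Hz0 i. destruct (Happ z Hz Hz0) as [Hx [_ [Q1 Q2]]]. set (x := unitize z) in *.
    replace (peval (D i) z - z ^ S (2 * n) * (x ^ M * x ^ M) * qv i (h1 x) (h2 x))%C
      with ((peval (D i) z - z ^ S (2 * n) * qv i (peval A1 z) (peval B' z))
        + z ^ S (2 * n) * (qv i (peval A1 z) (peval B' z) - qv i (x ^ M * h1 x) (x ^ M * h2 x)))%C
      by (rewrite qv_scal; ring).
    eapply Rle_trans; [apply Cmod_triangle|].
    pose proof (Hprim i z ltac:(lra)) as H1.
    destruct (HB x Hx) as [HBx1 HBx2].
    assert (Hxm : forall u, Cmod (x ^ M * u) = Cmod u).
    { intros u. rewrite Cmod_mult, Cmod_pow, Hx, pow1; ring. }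
    assert (Hclose : forall u v, Cmod (u - v) <= 3 * e2 -> Cmod v + 1 <= B -> Cmod u <= B).
    { intros u v Huv Hv. pose proof (Cmod_sub_ge u v). lra. }
    assert (H2 : Cmod (qv i (peval A1 z) (peval B' z) - qv i (x ^ M * h1 x) (x ^ M * h2 x)) <= 4 * B * (3 * e2)).
    { apply qv_close; auto; try (rewrite Hxm; lra).
      - apply (Hclose _ _ Q1). rewrite Hxm; lra.
      - apply (Hclose _ _ Q2). rewrite Hxm; lra. }
    assert (H3 : 0 <= Cmod (z ^ S (2 * n)) <= 1).
    { split; [apply Cmod_ge_0|]. rewrite Cmod_pow, <- (pow1 (S (2 * n))).
      apply pow_incr; split; [apply Cmod_ge_0|lra]. }
    rewrite Cmod_mult. pose proof (Cmod_ge_0 (qv i (peval A1 z) (peval B' z) - qv i (x ^ M * h1 x) (x ^ M * h2 x))).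
    assert (Cmod (z ^ S (2 * n)) * Cmod (qv i (peval A1 z) (peval B' z) - qv i (x ^ M * h1 x) (x ^ M * h2 x))
      <= 1 * (4 * B * (3 * e2))) by (apply Rmult_le_compat; lra).
    lra. }
  assert (Hw : forall z, z <> RtoC 0 -> Cmod (z ^ S (2 * n) * (unitize z ^ M * unitize z ^ M)) = Cmod z ^ S (2 * n)).
  { intros z Hz. rewrite !Cmod_mult, !Cmod_pow, (Cmod_unitize z Hz), pow1; ring. }
  assert (Hn0 : forall z, 1 - g <= Cmod z -> z <> RtoC 0).
  { intros z Hz ->. rewrite Cmod_0 in Hz; lra. }
  exists (spinor_pert k n P A1), (spinor_pert k n Q B'), D.
  split; [exact Hst|]. split; [|split; [|split]].
  - intros i. unfold D.
    assert (Hd : pnorm rho (deriv_pert k n P Q A1 B' i) <= e).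
    { eapply Rle_trans; [apply (pnorm_deriv_pert P Q A1 B' i k n rho s a); unfold s; lra|exact N4]. }
    split; [eapply Rle_trans; [apply pnorm_prim; lra|exact Hd]|].
    rewrite pder_prim, pnorm_app_zero; exact Hd.
  - intros z Hz. destruct (Rle_or_lt (1 - g) (Cmod z)) as [Hge|Hlt].
    + right. assert (Hz0 := Hn0 z Hge). destruct (Happ z ltac:(lra) Hz0) as [Hx [Hxz _]].
      exists (unitize z), (z ^ S (2 * n) * (unitize z ^ M * unitize z ^ M))%C.
      split; [exact Hx|]. split; [exact Hxz|]. split; [|apply Hmain; [lra|auto]].
      rewrite Hw by auto. rewrite <- (pow1 (S (2 * n))). apply pow_incr; lra.
    + left. intros i. pose proof (Hprim i z Hz) as H1.
      assert (H2 : Cmod (z ^ S (2 * n) * qv i (peval A1 z) (peval B' z)) <= e / 4).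
      { rewrite <- peval_spinor_quad, Cmod_mult, Cmod_pow.
        pose proof (Cmod_peval_le 1 (spinor_quad i A1 B') z Hz) as H2. pose proof (pnorm_spinor_quad i A1 B' a HA1n HB'n) as H3.
        pose proof (Cmod_ge_0 z) as Hz0.
        apply Rle_trans with ((1 - g) ^ n * (2 * a * a)); [|exact N3].
        apply Rmult_le_compat; [apply pow_le; auto|apply Cmod_ge_0| |lra].
        replace (S (2 * n))%nat with (n + S n)%nat by lia. rewrite pow_add.
        rewrite <- (Rmult_1_r ((1 - g) ^ n)). apply Rmult_le_compat; try (apply pow_le; auto).
        - apply pow_incr; lra.
        - rewrite <- (pow1 (S n)). apply pow_incr; lra. }
      pose proof (Cmod_sub_ge (peval (D i) z) (z ^ S (2 * n) * qv i (peval A1 z) (peval B' z))). lra.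
  - intros x Hx. unfold circle in Hx. assert (Hx0 := Hn0 x ltac:(lra)).
    exists (x ^ S (2 * n) * (x ^ M * x ^ M))%C.
    assert (Hux : unitize x = x).
    { unfold unitize. rewrite Hx. field. }
    pose proof (Hmain x ltac:(lra) Hx0) as HM. pose proof (Hw x Hx0) as HW.
    rewrite Hux in HM, HW. split; [rewrite HW, Hx, pow1; auto|exact HM].
  - assert (HN4 : 0 < / (4 * INR (n + M)) <= 1 / 4).
    { split; [apply Rinv_0_lt_compat; lra|]. replace (1 / 4) with (/ 4) by field.
      apply Rinv_le_contravar; lra. }
    set (N := INR (n + M)) in *.
    (* On this annulus Bernoulli gives [|z|^n >= 3/4]. The perturbation contributes at least
       [(1/2)(2N)(9/16)(r0/4) = 9 N r0/64] to the speed, and subtracting [2 s^2 <= N r0/64] leaves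
       [N r0/8]. Times the width [1/(8N)] this is [r0/64]. *)
    exists (1 - / (4 * N)), (1 - / (4 * N) / 2), (N * r0 / 8).
    split; [lra|]. split; [lra|]. split; [apply Rdiv_lt_0_compat; [apply Rmult_lt_0_compat|]; lra|]. split.
    + replace (N * r0 / 8 * (1 - / (4 * N) / 2 - (1 - / (4 * N)))) with (r0 / 64) by (field; lra). lra.
    + intros z Hz. unfold D; rewrite (speed_stage _ _ _ z Hst), !peval_spinor_pert.
      assert (Hz1 : 1 - g <= Cmod z <= 1) by lra. assert (Hz0 := Hn0 z (proj1 Hz1)).
      destruct (Happ z Hz1 Hz0) as [Hx [_ [Q1 Q2]]]. set (x := unitize z) in *.
      assert (Hxm : forall u, Cmod (x ^ M * u) = Cmod u).
      { intros u. rewrite Cmod_mult, Cmod_pow, Hx, pow1; ring. }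
      assert (Hlow : forall u v, Cmod (u - x ^ M * v) <= 3 * e2 -> Cmod v ^ 2 / 2 - 9 * e2 * e2 <= Cmod u ^ 2).
      { intros u v Huv. pose proof (Cmod_sq_add_ge (- (x ^ M * v - u)) (x ^ M * v)) as H.
        replace (- (x ^ M * v - u) + x ^ M * v)%C with u in H by ring.
        rewrite Cmod_opp, (Cmod_sub_sym (x ^ M * v)), Hxm in H.
        assert (Cmod (u - x ^ M * v) ^ 2 <= (3 * e2) ^ 2) by (apply pow_incr; split; [apply Cmod_ge_0|auto]).
        lra. }
      assert (HA : r0 / 4 <= Cmod (peval A1 z) ^ 2 + Cmod (peval B' z) ^ 2).
      { pose proof (Hlow _ _ Q1). pose proof (Hlow _ _ Q2). specialize (Hr x Hx).
        assert (18 * e2 * e2 <= r0 / 4) by nra. lra. }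
      assert (Hzn : 3 / 4 <= Cmod z ^ n).
      { apply Rle_trans with ((1 - / (4 * N)) ^ n); [|apply pow_incr; lra].
        eapply Rle_trans; [|apply bernoulli_le; lra].
        assert (INR n * / (4 * N) <= 1 / 4); [|lra].
        apply Rle_trans with (N * / (4 * N)).
        - apply Rmult_le_compat_r; [lra|]. unfold N. apply le_INR; lia.
        - apply Req_le; field; lra. }
      assert (Hsm : forall p, pnorm 1 p <= s -> Cmod (peval p z) ^ 2 <= s ^ 2).
      { intros p Hp. apply pow_incr. split; [apply Cmod_ge_0|].
        eapply Rle_trans; [apply (Cmod_peval_le 1); lra|auto]. }
      pose proof (Hsm P ltac:(unfold s; lra)) as HsP. pose proof (Hsm Q ltac:(unfold s; lra)) as HsQ.
      pose proof (Cmod_sq_add_ge (peval P z) (RtoC k * z ^ n * peval A1 z)) as G1.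
      pose proof (Cmod_sq_add_ge (peval Q z) (RtoC k * z ^ n * peval B' z)) as G2.
      rewrite !Cmod_mult, Cmod_R, (Rabs_pos_eq k), Cmod_pow in G1, G2 by lra.
      rewrite !Rpow_mult_distr in G1, G2.
      replace (k ^ 2) with (2 * N + 1) in G1, G2 by (rewrite <- Hkk; ring).
      assert (Hz2 : 9 / 16 <= (Cmod z ^ n) ^ 2).
      { replace (9 / 16) with ((3 / 4) ^ 2) by field. apply pow_incr; lra. }
      set (zz := (Cmod z ^ n) ^ 2) in *. set (u1 := Cmod (peval A1 z) ^ 2) in *. set (u2 := Cmod (peval B' z) ^ 2) in *.
      assert (Hprod : (2 * N) * (9 / 16) * (r0 / 4) <= (2 * N + 1) * zz * (u1 + u2)).
      { apply Rmult_le_compat; [nra|lra| |lra]. apply Rmult_le_compat; lra. }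
      lra.
Qed.

(** * Pushing the boundary along circles *)

Definition Xmap (F : dir3 -> list C) (z : C) : R3 := revec (fun i => peval (F i) z).

Lemma dist3_add_l x y z : dist3 (add3 x y) (add3 x z) = dist3 y z.
Proof. unfold dist3; f_equal. apply R3_ext; intros []; r3; ring. Qed.

Lemma dist3_add_r x y z : dist3 (add3 x z) (add3 y z) = dist3 x y.
Proof. unfold dist3; f_equal. apply R3_ext; intros []; r3; ring. Qed.

Lemma Xmap_lipschitz F : exists L, 0 < L /\ forall z w, Cmod z <= 1 -> Cmod w <= 1 ->
  dist3 (Xmap F z) (Xmap F w) <= L * Cmod (z - w).
Proof.
  pose proof (pnorm_ge0 2 (F X1) ltac:(lra)); pose proof (pnorm_ge0 2 (F X2) ltac:(lra)).
  pose proof (pnorm_ge0 2 (F X3) ltac:(lra)).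
  exists (2 * (pnorm 2 (F X1) + pnorm 2 (F X2) + pnorm 2 (F X3) + 1)). split; [lra|].
  intros z w Hz Hw. unfold dist3, Xmap. rewrite <- revec_sub, Rmult_assoc.
  apply revec_le. intros i. pose proof (peval_lipschitz 1 2 (F i) w (z - w)) as HL.
  replace (w + (z - w))%C with z in HL by ring.
  eapply Rle_trans; [apply HL; lra|]. replace (2 - 1) with 1 by ring. rewrite Rdiv_1_r, Rmult_comm.
  apply Rmult_le_compat_r; [apply Cmod_ge_0|]. destruct i; lra.
Qed.

Lemma Xmap_padd F D z : Xmap (fun i => padd (F i) (D i)) z
  = add3 (Xmap F z) (revec (fun i => peval (D i) z)).
Proof. unfold Xmap. rewrite <- revec_add. unfold revec, vec. rewrite !peval_padd. reflexivity. Qed.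

Lemma cont_on_comp S g f : cont_on S g -> (forall z, S z -> continuity_pt f (g z)) ->
  cont_on S (fun z => f (g z)).
Proof.
  intros Hg Hf z Hz e He.
  destruct (proj1 (continuity_pt_locally f (g z)) (Hf z Hz) (mkposreal e He)) as [d Hd].
  destruct (Hg z Hz d (cond_pos d)) as [d' [Hd' H]].
  exists d'; split; auto. intros w Sw Hw. apply (Hd (g w)). apply H; auto.
Qed.

Lemma cont_on_comp2 S g h f : cont_on S g -> cont_on S h ->
  (forall z, S z -> continuity_2d_pt f (g z) (h z)) -> cont_on S (fun z => f (g z) (h z)).
Proof.
  intros Hg Hh Hf z Hz e He.
  destruct (Hf z Hz (mkposreal e He)) as [d Hd].
  destruct (Hg z Hz d (cond_pos d)) as [d1 [Hd1 H1]].
  destruct (Hh z Hz d (cond_pos d)) as [d2 [Hd2 H2]].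
  exists (Rmin d1 d2); split; [apply Rmin_glb_lt; auto|]. intros w Sw Hw.
  pose proof (Rmin_l d1 d2); pose proof (Rmin_r d1 d2).
  apply (Hd (g w) (h w)); [apply H1|apply H2]; auto; lra.
Qed.

Lemma cont_on_plus S g h : cont_on S g -> cont_on S h -> cont_on S (fun z => g z + h z).
Proof.
  intros Hg Hh. apply (cont_on_comp2 S g h Rplus Hg Hh). intros z _.
  apply (continuity_2d_pt_plus (fun u v => u) (fun u v => v));
    [apply continuity_2d_pt_id1|apply continuity_2d_pt_id2].
Qed.

Lemma cont_on_mult S g h : cont_on S g -> cont_on S h -> cont_on S (fun z => g z * h z).
Proof.
  intros Hg Hh. apply (cont_on_comp2 S g h Rmult Hg Hh). intros z _.
  apply (continuity_2d_pt_mult (fun u v => u) (fun u v => v));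
    [apply continuity_2d_pt_id1|apply continuity_2d_pt_id2].
Qed.

Lemma cont_on_const S c : cont_on S (fun _ => c).
Proof.
  intros z _ e He. exists 1; split; [lra|]. intros w _ _.
  rewrite Rminus_diag, Rabs_R0; exact He.
Qed.

Lemma cont_on_ext S g h : (forall z, S z -> g z = h z) -> cont_on S g -> cont_on S h.
Proof.
  intros E Hg z Hz e He. destruct (Hg z Hz e He) as [d [Hd H]]. exists d; split; auto.
  intros w Sw Hw. rewrite <- !E by auto. auto.
Qed.

Lemma cont_on_sqrt S g : cont_on S g -> (forall z, S z -> 0 <= g z) -> cont_on S (fun z => sqrt (g z)).
Proof. intros Hg Hp. apply cont_on_comp; auto. intros z Hz. apply continuity_pt_sqrt; auto. Qed.

Lemma cont_on_inv S g : cont_on S g -> (forall z, S z -> g z <> 0) -> cont_on S (fun z => / g z).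
Proof.
  intros Hg Hp. apply cont_on_comp; auto. intros z Hz.
  apply continuity_pt_inv; [apply continuity_pt_id|auto].
Qed.

Definition cont3_on (S : C -> Prop) (m : C -> R3) : Prop :=
  forall i, cont_on S (fun z => coord i (m z)).

Lemma cont_on_norm3 S m : cont3_on S m -> cont_on S (fun z => norm3 (m z)).
Proof.
  intros H. unfold norm3. apply cont_on_sqrt; [|intros; apply dot3_ge0].
  unfold dot3. repeat apply cont_on_plus; apply cont_on_mult; first [apply (H X1)|apply (H X2)|apply (H X3)].
Qed.

Lemma cont_on_of_lipschitz S g L : 0 < L ->
  (forall z w, S z -> S w -> Rabs (g w - g z) <= L * Cmod (w - z)) -> cont_on S g.
Proof.
  intros HL H z Hz e He. exists (e / L). split; [apply Rdiv_lt_0_compat; auto|].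
  intros w Hw Hd. specialize (H z w Hz Hw). apply Rlt_div_r in Hd; [lra|auto].
Qed.

Lemma Xmap_cont3 F S : (forall z, S z -> Cmod z <= 1) -> cont3_on S (Xmap F).
Proof.
  intros HS i. destruct (Xmap_lipschitz F) as [L [HL H]].
  apply (cont_on_of_lipschitz S _ L HL). intros z w Hz Hw.
  eapply Rle_trans; [|apply (H w z); auto].
  eapply Rle_trans; [|apply (coord_le_norm3 i)]. destruct i; r3; lra.
Qed.

(* The stereographic spinor of the direction [m]: continuous away from the negative third axis. *)
Definition spin_scale (m : R3) (r : R) : R := sqrt (r / (2 * norm3 m * (norm3 m + c3 m))).
Definition spin1 (m : R3) (r : R) : C := RtoC (spin_scale m r * (norm3 m + c3 m)).
Definition spin2 (m : R3) (r : R) : C := (- (spin_scale m r * c1 m), - (spin_scale m r * c2 m)).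

Lemma norm3_pos_of m : 0 < norm3 m + c3 m -> 0 < norm3 m.
Proof.
  intros H. pose proof (coord_le_norm3 X3 m) as H1. simpl in H1.
  pose proof (Rle_abs (c3 m)). lra.
Qed.

(** The scale comes from [(l + c3)^2 + c1^2 + c2^2 = 2 l (l + c3)] with [l = |m|]; it degenerates
    only on the excluded half-axis. *)
Lemma spin_norm m r : 0 < norm3 m + c3 m -> 0 <= r ->
  Cmod (spin1 m r) ^ 2 + Cmod (spin2 m r) ^ 2 = r.
Proof.
  intros Hm Hr. pose proof (norm3_pos_of m Hm) as Hl. pose proof (norm3_sq m) as Hsq.
  unfold spin1, spin2. rewrite !Cmod2_alt. simpl Re; simpl Im.
  set (k := spin_scale m r).
  assert (Hk : k * k = r / (2 * norm3 m * (norm3 m + c3 m))).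
  { apply sqrt_sqrt. apply Rdiv_le_0_compat; auto. apply Rmult_lt_0_compat; lra. }
  unfold dot3 in Hsq.
  replace ((k * (norm3 m + c3 m)) ^ 2 + 0 ^ 2 + ((- (k * c1 m)) ^ 2 + (- (k * c2 m)) ^ 2))
    with (k * k * ((norm3 m + c3 m) * (norm3 m + c3 m) + c1 m * c1 m + c2 m * c2 m)) by ring.
  rewrite Hk.
  replace ((norm3 m + c3 m) * (norm3 m + c3 m) + c1 m * c1 m + c2 m * c2 m)
    with (2 * norm3 m * (norm3 m + c3 m)) by lra.
  field. split; lra.
Qed.

(** The complex vector [q(spin1, spin2)] is itself orthogonal to [m], its pairing with [m] being a
    multiple of [|m|^2 - (c1^2 + c2^2 + c3^2)]. Hence the circle traced by unimodular [w] lies in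
    the plane orthogonal to [m]. *)
Lemma spin_orthogonal m r w :
  dot3 (revec (fun i => (w * qv i (spin1 m r) (spin2 m r))%C)) m = 0.
Proof.
  pose proof (norm3_sq m) as Hsq. unfold spin1, spin2. set (k := spin_scale m r).
  clearbody k. revert Hsq. generalize (norm3 m) as l. intros l Hsq.
  destruct w as [a b], m as [[x y] t]. unfold revec, vec, dot3, mk3, c1, c2, c3 in *.
  unfold qv, Re, Ci, Cmult, Cminus, Copp, Cplus, RtoC; cbn [fst snd] in *.
  transitivity (k * k * (a * x - b * y) * (l * l - (x * x + y * y + t * t))); [ring|].
  rewrite Hsq; ring.
Qed.

Lemma cont_spin m r : cont3_on circle m -> cont_on circle r ->
  (forall x, circle x -> 0 < norm3 (m x) + c3 (m x)) -> (forall x, circle x -> 0 <= r x) ->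
  cont_circle (fun x => spin1 (m x) (r x)) /\ cont_circle (fun x => spin2 (m x) (r x)).
Proof.
  intros Hm Hr Hp Hr0.
  assert (Hn := cont_on_norm3 _ _ Hm).
  assert (H1 := Hm X1); assert (H2 := Hm X2); assert (H3 := Hm X3); simpl in H1, H2, H3.
  assert (Hk : cont_on circle (fun x => spin_scale (m x) (r x))).
  { unfold spin_scale. apply cont_on_sqrt.
    - unfold Rdiv. apply cont_on_mult; auto. apply cont_on_inv.
      + apply cont_on_mult; [apply cont_on_mult; [apply cont_on_const|auto]|apply cont_on_plus; auto].
      + intros x Hx. specialize (Hp x Hx). pose proof (norm3_pos_of _ Hp). nra.
    - intros x Hx. specialize (Hp x Hx). pose proof (norm3_pos_of _ Hp).
      apply Rdiv_le_0_compat; auto. apply Rmult_lt_0_compat; lra. }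
  split; split; unfold spin1, spin2; simpl.
  - apply cont_on_mult; auto. apply cont_on_plus; auto.
  - apply cont_on_const.
  - apply (cont_on_ext _ (fun x => (-1) * (spin_scale (m x) (r x) * c1 (m x)))); [intros; ring|].
    apply cont_on_mult; [apply cont_on_const|apply cont_on_mult; auto].
  - apply (cont_on_ext _ (fun x => (-1) * (spin_scale (m x) (r x) * c2 (m x)))); [intros; ring|].
    apply cont_on_mult; [apply cont_on_const|apply cont_on_mult; auto].
Qed.

(** [spinor_step] read geometrically, with spinors replaced by planes orthogonal to [m] and radii
    [r]. For interior points the base point is moved to [x] on the circle, because [m] and [r] are
    controlled only there. *)
Lemma push P Q F m r r0 rho e : stage P Q F -> cont3_on circle m -> cont_on circle r ->
  (forall x, circle x -> 0 < norm3 (m x) + c3 (m x)) -> 0 < r0 -> (forall x, circle x -> r0 <= r x) ->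
  0 < rho < 1 -> 0 < e ->
  exists P' Q' D, let F' := fun i => padd (F i) (D i) in stage P' Q' F' /\
    (forall i, pnorm rho (D i) <= e /\ pnorm rho (pder (D i)) <= e) /\
    (forall z, Cmod z <= 1 -> dist3 (Xmap F' z) (Xmap F z) <= e \/
       exists x v, circle x /\ Cmod (x - z) <= e /\ dist3 (Xmap F x) (Xmap F z) <= e /\
         dot3 v (m x) = 0 /\ norm3 v <= r x /\ dist3 (Xmap F' z) (add3 (Xmap F x) v) <= e) /\
    (forall x, circle x -> exists v, dot3 v (m x) = 0 /\ norm3 v = r x /\
         dist3 (Xmap F' x) (add3 (Xmap F x) v) <= e) /\
    exists a b c, rho < a < b /\ b < 1 /\ 0 < c /\ r0 / 100 <= c * (b - a) /\
      forall z, a <= Cmod z <= b -> c <= speed F' z.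
Proof.
  intros HS Hm Hr Hp Hr0 Hrr Hrho He.
  destruct (Xmap_lipschitz F) as [L [HL HLip]].
  destruct (cont_spin m r Hm Hr Hp) as [C1 C2]; [intros x Hx; specialize (Hrr x Hx); lra|].
  (* [2 e' <= e/2] converts coordinatewise errors into a norm, and [L e' <= e/2] pays for moving the
     base point from [z] to [x]. *)
  set (e' := Rmin (e / 4) (e / (2 * L))).
  assert (He' : 0 < e') by (apply Rmin_glb_lt; [lra|apply Rdiv_lt_0_compat; lra]).
  assert (He1 : e' <= e / 4) by apply Rmin_l.
  assert (He2 : L * e' <= e / 2).
  { assert (H : e' <= e / (2 * L)) by apply Rmin_r. apply Rle_div_r in H; lra. }
  destruct (spinor_step P Q F _ _ r0 rho e' HS C1 C2 Hr0) as [P' [Q' [D [H1 [H2 [H3 [H4 H5]]]]]]]; auto.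
  { intros x Hx. rewrite spin_norm; auto. specialize (Hrr x Hx); lra. }
  assert (Hlam : forall x w, circle x ->
    norm3 (revec (fun i => (w * qv i (spin1 (m x) (r x)) (spin2 (m x) (r x)))%C)) = Cmod w * r x).
  { intros x w Hx. rewrite (norm3_revec_scal (fun i => qv i (spin1 (m x) (r x)) (spin2 (m x) (r x))))
      by apply null_qv.
    rewrite lam_qv. f_equal. transitivity (Cmod (spin1 (m x) (r x)) ^ 2 + Cmod (spin2 (m x) (r x)) ^ 2); [ring|].
    apply spin_norm; [auto|]. specialize (Hrr x Hx); lra. }
  assert (Hdist : forall z x w, (forall i, Cmod (peval (D i) z - w * qv i (spin1 (m x) (r x)) (spin2 (m x) (r x))) <= e') ->
    dist3 (Xmap (fun i => padd (F i) (D i)) z)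
      (add3 (Xmap F z) (revec (fun i => (w * qv i (spin1 (m x) (r x)) (spin2 (m x) (r x)))%C))) <= e / 2).
  { intros z x w H. rewrite Xmap_padd. apply revec_le in H.
    replace (e / 2) with (2 * (e / 4)) by field. eapply Rle_trans; [|apply Rmult_le_compat_l; [lra|exact He1]].
    eapply Rle_trans; [|exact H]. rewrite dist3_add_l. apply Rle_refl. }
  exists P', Q', D. intros F'. split; [exact H1|]. split; [|split; [|split; [|exact H5]]].
  - intros i. destruct (H2 i). lra.
  - intros z Hz. destruct (H3 z Hz) as [Hs|[x [w [Hx [Hxz [Hw Hd]]]]]].
    + left. unfold F'; rewrite Xmap_padd, dist3_add. apply revec_le in Hs. lra.
    + right. exists x, (revec (fun i => (w * qv i (spin1 (m x) (r x)) (spin2 (m x) (r x)))%C)).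
      assert (HX : dist3 (Xmap F x) (Xmap F z) <= e / 2).
      { eapply Rle_trans; [apply HLip; [unfold circle in Hx; lra|lra]|].
        eapply Rle_trans; [apply Rmult_le_compat_l; [lra|exact Hxz]|lra]. }
      split; [auto|]. split; [lra|]. split; [lra|]. split; [apply spin_orthogonal|]. split.
      * rewrite Hlam by auto. specialize (Hrr x Hx). pose proof (Cmod_ge_0 w). nra.
      * specialize (Hdist z x w Hd). fold F' in Hdist.
        eapply Rle_trans; [apply dist3_triangle|]. apply Rle_trans with (e / 2 + e / 2); [|lra].
        apply Rplus_le_compat; [exact Hdist|]. eapply Rle_trans; [|exact HX].
        rewrite dist3_add_r, dist3_sym. apply Rle_refl.
  - intros x Hx. destruct (H4 x Hx) as [w [Hw Hd]].
    exists (revec (fun i => (w * qv i (spin1 (m x) (r x)) (spin2 (m x) (r x)))%C)).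
    split; [apply spin_orthogonal|]. split; [rewrite Hlam, Hw by auto; ring|].
    specialize (Hdist x x w Hd). fold F' in Hdist. lra.
Qed.

(** * Barriers for path lengths *)

Lemma conj_reflected_polynomial p : exists q, forall z, circle z ->
  peval q z = (z ^ length p * Cconj (peval p z))%C.
Proof.
  induction p as [|a p [q Hq]].
  - exists nil. intros z _. simpl. unfold Cconj, RtoC, Cmult; simpl. f_equal; ring.
  - exists (padd (pshift (length (a :: p)) [Cconj a]) q). intros z Hz.
    rewrite peval_padd, peval_pshift, Hq by auto. cbn [peval length]. rewrite Cplus_conj, Cmult_conj.
    pose proof (conj_unit z Hz) as E. rewrite !Cpow_S.
    transitivity (z * z ^ length p * Cconj a + z ^ length p * (z * Cconj z) * Cconj (peval p z))%C;
      [rewrite E; ring|ring].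
Qed.

(** On the unit circle [conj z = 1/z], so [2 z^n (Re p - t)] agrees with a polynomial. Taking [t]
    different from [Re p(1)] makes it nonzero, hence with finitely many roots. *)
Lemma re_level_set_finite p e : 0 < e -> exists t l, 0 < t < e /\
  forall z, circle z -> Re (peval p z) = t -> In z l.
Proof.
  intros He. destruct (exists_real_avoiding [Re (peval p 1)] e He) as [t [Ht Hav]].
  destruct (conj_reflected_polynomial p) as [q Hq].
  set (n := length p) in *.
  set (S := padd (pshift n p) (padd q (pshift n [RtoC (- 2 * t)]))).
  assert (HS : forall z, circle z -> peval S z = (z ^ n * RtoC (2 * (Re (peval p z) - t)))%C).
  { intros z Hz. unfold S. rewrite !peval_padd, !peval_pshift, (Hq z Hz). cbn [peval].
    transitivity (z ^ n * ((peval p z + Cconj (peval p z)) + RtoC (-2 * t)))%C; [ring|]. f_equal.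
    destruct (peval p z) as [u v]. unfold Cconj, RtoC, Cplus, Re; simpl. f_equal; ring. }
  assert (H1 : circle 1) by (unfold circle; apply Cmod_1).
  destruct (polynomial_finite_roots S) as [l Hl].
  { exists (RtoC 1). rewrite (HS _ H1), Cpow_1_l. intros E. apply Hav. left.
    assert (E2 : RtoC (2 * (Re (peval p 1) - t)) = RtoC 0) by (rewrite <- E; ring).
    apply RtoC_inj in E2. lra. }
  exists t, l. split; [exact Ht|]. intros z Hz Hre. apply Hl. rewrite (HS z Hz), Hre.
  replace (2 * (t - t)) with 0 by ring. ring.
Qed.

(** A generic vertical line meets the plane curve [(Re p1, Re p2)] for finitely many parameters
    only, so a generic point of that line is missed. *)
Lemma avoid_curve p1 p2 e : 0 < e -> exists t1 t2, 0 < t1 < e /\ 0 < t2 < e /\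
  forall z, circle z -> Re (peval p1 z) <> t1 \/ Re (peval p2 z) <> t2.
Proof.
  intros He. destruct (re_level_set_finite p1 e He) as [t1 [l [Ht1 Hl]]].
  destruct (exists_real_avoiding (map (fun z => Re (peval p2 z)) l) e He) as [t2 [Ht2 Hav]].
  exists t1, t2. split; [auto|split; [auto|]]. intros z Hz.
  destruct (Req_dec (Re (peval p1 z)) t1) as [E|E]; [right|left; auto].
  intros E2. apply Hav. apply in_map_iff. exists z; auto.
Qed.

(** * Closeness of polynomial maps on a smaller disc *)

Lemma padd_comm p q : padd p q = padd q p.
Proof.
  revert q; induction p as [|a p IH]; intros [|b q]; simpl; auto.
  rewrite IH; f_equal; ring.
Qed.

Lemma pder_padd p q : pder (padd p q) = padd (pder p) (pder q).
Proof.
  revert q; induction p as [|a p IH]; intros [|b q]; cbn [padd pder]; auto.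
  - rewrite padd_nil_r; reflexivity.
  - rewrite IH.
    replace (RtoC 0 :: padd (pder p) (pder q)) with (padd (RtoC 0 :: pder p) (RtoC 0 :: pder q))
      by (cbn [padd]; f_equal; ring).
    rewrite <- !padd_assoc. f_equal. rewrite !padd_assoc. f_equal. apply padd_comm.
Qed.

(** The coefficient norm is asked of the difference and of its derivative: the limit is later built
    by summing these very differences, and derivatives carry the metric. *)
Definition near_on (rho e : R) (F F' : dir3 -> list C) : Prop :=
  exists D : dir3 -> list C, forall i,
    F' i = padd (F i) (D i) /\ pnorm rho (D i) <= e /\ pnorm rho (pder (D i)) <= e.

Lemma near_on_refl rho F : near_on rho 0 F F.
Proof. exists (fun _ => nil). intros i. rewrite padd_nil_r. simpl. repeat split; lra. Qed.

Lemma near_on_mono rho rho' e e' F F' : 0 <= rho <= rho' -> e <= e' -> near_on rho' e F F' -> near_on rho e' F F'.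
Proof.
  intros Hr He [D HD]. exists D. intros i. destruct (HD i) as [H1 [H2 H3]].
  pose proof (pnorm_mono rho rho' (D i) Hr). pose proof (pnorm_mono rho rho' (pder (D i)) Hr).
  repeat split; auto; lra.
Qed.

Lemma near_on_trans rho e1 e2 F F1 F2 : 0 <= rho -> near_on rho e1 F F1 -> near_on rho e2 F1 F2 ->
  near_on rho (e1 + e2) F F2.
Proof.
  intros Hr [D1 H1] [D2 H2]. exists (fun i => padd (D1 i) (D2 i)). intros i.
  destruct (H1 i) as [E1 [B1 C1]]. destruct (H2 i) as [E2 [B2 C2]].
  rewrite E2, E1, pder_padd, padd_assoc.
  pose proof (pnorm_padd rho (D1 i) (D2 i) Hr). pose proof (pnorm_padd rho (pder (D1 i)) (pder (D2 i)) Hr).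
  repeat split; lra.
Qed.

Lemma near_on_value rho e F F' z : near_on rho e F F' -> Cmod z <= rho ->
  (forall i, Cmod (peval (F' i) z - peval (F i) z) <= e) /\
  (forall i, Cmod (peval (pder (F' i)) z - peval (pder (F i)) z) <= e).
Proof.
  intros [D HD] Hz. split; intros i; destruct (HD i) as [E [B1 B2]]; rewrite E.
  - rewrite peval_padd. replace (peval (F i) z + peval (D i) z - peval (F i) z)%C with (peval (D i) z) by ring.
    eapply Rle_trans; [apply (Cmod_peval_le rho); auto|auto].
  - rewrite pder_padd, peval_padd.
    replace (peval (pder (F i)) z + peval (pder (D i)) z - peval (pder (F i)) z)%C with (peval (pder (D i)) z) by ring.
    eapply Rle_trans; [apply (Cmod_peval_le rho); auto|auto].
Qed.

Lemma near_on_speed rho e F F' z : near_on rho e F F' -> Cmod z <= rho ->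
  Rabs (speed F' z - speed F z) <= 2 * e.
Proof.
  intros H Hz. destruct (near_on_value rho e F F' z H Hz) as [_ H2]. apply lam_close; auto.
Qed.

(** * Radial functions that grow no faster than the metric *)

Definition slope (f : R -> R) (t c : R) : Prop :=
  exists d, 0 < d /\ forall u, Rabs (u - t) < d -> Rabs (f u - f t) <= c * Rabs (u - t).

Lemma slope_le f t c c' : c <= c' -> slope f t c -> slope f t c'.
Proof.
  intros Hc [d [Hd H]]. exists d; split; auto. intros u Hu. eapply Rle_trans; [apply H; auto|].
  apply Rmult_le_compat_r; [apply Rabs_pos|auto].
Qed.

Lemma slope_locally_const f t c : 0 <= c ->
  (exists d, 0 < d /\ forall u, Rabs (u - t) < d -> f u = f t) -> slope f t c.
Proof.
  intros Hc [d [Hd H]]. exists d; split; auto. intros u Hu. rewrite H, Rminus_diag, Rabs_R0 by auto.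
  apply Rmult_le_pos; [auto|apply Rabs_pos].
Qed.

(* Crossing the annulus [a <= |z| <= b] costs at least [L] for a conformal metric of density above [w]. *)
Definition barrier (w : C -> R) (a b L : R) : Prop :=
  exists f : R -> R, (forall t, t <= a -> f t = 0) /\ (forall t, b <= t -> f t = L) /\
    forall z, a <= Cmod z <= b -> slope f (Cmod z) (w z).

Lemma barrier_annulus w a b c : a < b -> 0 < c -> (forall z, a <= Cmod z <= b -> c <= w z) ->
  barrier w a b (c * (b - a)).
Proof.
  intros Hab Hc Hw. exists (fun t => c * (Rmin b (Rmax a t) - a)). split; [|split].
  - intros t Ht. rewrite Rmax_left, Rmin_right by lra. ring.
  - intros t Ht. rewrite Rmax_right, Rmin_left by lra. ring.
  - intros z Hz. exists 1; split; [lra|]. intros u _.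
    replace (c * (Rmin b (Rmax a u) - a) - c * (Rmin b (Rmax a (Cmod z)) - a))
      with (c * (Rmin b (Rmax a u) - Rmin b (Rmax a (Cmod z)))) by ring.
    rewrite Rabs_mult, (Rabs_pos_eq c) by lra. apply Rmult_le_compat; try apply Rabs_pos; try lra.
    + apply Hw; auto.
    + rewrite (Rmax_right a (Cmod z)), (Rmin_right b (Cmod z)) by lra.
      unfold Rmin, Rmax. destruct (Rle_dec a u); destruct (Rle_dec b _); unfold Rabs;
        repeat destruct Rcase_abs; lra.
Qed.

Lemma barrier_mono w w' a b L : (forall z, a <= Cmod z <= b -> w z <= w' z) ->
  barrier w a b L -> barrier w' a b L.
Proof.
  intros Hw [f [H1 [H2 H3]]]. exists f. split; [auto|split; [auto|]].
  intros z Hz. apply (slope_le _ _ (w z)); auto.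
Qed.

Lemma barrier_widen w a b a' b' L : a' <= a -> b <= b' ->
  (forall z, a' <= Cmod z <= b' -> 0 <= w z) -> barrier w a b L -> barrier w a' b' L.
Proof.
  intros Ha Hb Hw [f [H1 [H2 H3]]]. exists f. split; [intros; apply H1; lra|split; [intros; apply H2; lra|]].
  intros z Hz. destruct (Rlt_or_le (Cmod z) a) as [Hlt|Hge].
  - apply slope_locally_const; [auto|]. exists (a - Cmod z); split; [lra|].
    intros u Hu. apply Rabs_def2 in Hu. rewrite !H1; lra.
  - destruct (Rlt_or_le b (Cmod z)) as [Hgt|Hle]; [|apply H3; lra].
    apply slope_locally_const; [auto|]. exists (Cmod z - b); split; [lra|].
    intros u Hu. apply Rabs_def2 in Hu. rewrite !H2; lra.
Qed.

(** The gap between [b] and [c] is strict, so near every radius at most one of the two functions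
    varies and their slopes never add up. *)
Lemma barrier_join w a b c d L1 L2 : a <= b -> b < c -> c <= d ->
  (forall z, a <= Cmod z <= d -> 0 <= w z) ->
  barrier w a b L1 -> barrier w c d L2 -> barrier w a d (L1 + L2).
Proof.
  intros Hab Hbc Hcd Hw [f [F1 [F2 F3]]] [g [G1 [G2 G3]]].
  exists (fun t => f t + g t). split; [|split].
  - intros t Ht. rewrite F1, G1 by lra. ring.
  - intros t Ht. rewrite F2, G2 by lra. ring.
  - intros z Hz. destruct (Rlt_or_le (Cmod z) c) as [Hlt|Hge].
    + assert (Sf : slope f (Cmod z) (w z)).
      { destruct (Rle_or_lt (Cmod z) b) as [H|H]; [apply F3; lra|].
        apply slope_locally_const; [auto|]. exists (Cmod z - b); split; [lra|].
        intros u Hu. apply Rabs_def2 in Hu. rewrite !F2; lra. }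
      destruct Sf as [e [He Hs]]. exists (Rmin e (c - Cmod z)). split; [apply Rmin_glb_lt; lra|].
      intros u Hu. pose proof (Rmin_l e (c - Cmod z)). pose proof (Rmin_r e (c - Cmod z)).
      rewrite (G1 (Cmod z)) by lra. rewrite (G1 u).
      * replace (f u + 0 - (f (Cmod z) + 0)) with (f u - f (Cmod z)) by ring. apply Hs; lra.
      * apply Rabs_lt_between in Hu. lra.
    + destruct (G3 z ltac:(lra)) as [e [He Hs]]. exists (Rmin e (Cmod z - b)). split; [apply Rmin_glb_lt; lra|].
      intros u Hu. pose proof (Rmin_l e (Cmod z - b)). pose proof (Rmin_r e (Cmod z - b)).
      rewrite (F2 (Cmod z)) by lra. rewrite (F2 u).
      * replace (L1 + g u - (L1 + g (Cmod z))) with (g u - g (Cmod z)) by ring. apply Hs; lra.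
      * apply Rabs_lt_between in Hu. lra.
Qed.

(** * Growing the intrinsic distance to the boundary *)

(** The spinor has no common zero, so compactness of the closed disc applies. *)
Lemma speed_min P Q F : stage P Q F -> exists c, 0 < c /\ forall z, Cmod z <= 1 -> c <= speed F z.
Proof.
  intros HS. destruct (cont_on_min (fun z => 0 <= Cmod z <= 1) (speed F) (compact2_annulus 0 1)) as [c [Hc H]].
  - apply cont_on_norm3. apply (Xmap_cont3 (fun i => pder (F i))). intros z Hz; lra.
  - intros z _. rewrite (speed_stage P Q F z HS). destruct HS as [_ [H _]].
    pose proof (pow2_ge_0 (Cmod (peval P z))); pose proof (pow2_ge_0 (Cmod (peval Q z))).
    destruct (H z) as [E|E]; apply Cmod_gt_0 in E; pose proof (pow_lt _ 2 E); lra.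
  - exists c; split; auto. intros z Hz. apply H. split; [apply Cmod_ge_0|auto].
Qed.

Lemma dot3_add_orth x v : dot3 v x = 0 -> dot3 (add3 x v) (add3 x v) = dot3 x x + dot3 v v.
Proof. intros H. replace (dot3 (add3 x v) (add3 x v)) with (dot3 x x + 2 * dot3 v x + dot3 v v) by (r3; ring). lra. Qed.

(** With [m = x - tau], orthogonality gives [|m + v|^2 = |m|^2 + |v|^2], so a step adds only [r^2]
    to the squared displacement [B^2]. The term in [q] collects the errors: recentring by [tau], the
    approximation of [y], and the change of reference point from [y0] to [z0]. *)
Lemma pythagoras_estimate x v y0 y yx tau B r q L :
  0 <= B -> 0 <= r -> 0 < q <= 1 -> 0 <= L ->
  norm3 x <= B -> norm3 tau <= 2 * q -> dot3 v (sub3 x tau) = 0 -> norm3 v <= r ->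
  dist3 y (add3 yx v) <= q -> dist3 yx (add3 x y0) <= 0 ->
  forall z0, dist3 y0 z0 <= L * q ->
  norm3 (sub3 y z0) * norm3 (sub3 y z0)
    <= B * B + r * r + q * (4 * B + 4 + 2 * (B + 2 + r) * (3 + L) + (3 + L) * (3 + L)).
Proof.
  intros HB Hr Hq HL Hx Ht Horth Hv Hy Hyx z0 Hz0.
  set (m := sub3 x tau) in *.
  assert (Hm : norm3 m <= B + 2 * q).
  { unfold m. pose proof (norm3_triangle x (scal3 (-1) tau)) as H. rewrite norm3_scal in H.
    replace (Rabs (-1)) with 1 in H by (rewrite Rabs_left; lra).
    replace (add3 x (scal3 (-1) tau)) with (sub3 x tau) in H by (apply R3_ext; intros []; r3; ring). lra. }
  assert (Hmv : norm3 (add3 m v) * norm3 (add3 m v) <= (B + 2 * q) * (B + 2 * q) + r * r).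
  { rewrite norm3_sq, dot3_add_orth, <- !norm3_sq by auto.
    pose proof (norm3_ge0 m); pose proof (norm3_ge0 v). nra. }
  assert (Hmv1 : norm3 (add3 m v) <= B + 2 + r).
  { pose proof (norm3_triangle m v). lra. }
  assert (Hfin : norm3 (sub3 y z0) <= norm3 (add3 m v) + (3 + L) * q).
  { pose proof (norm3_dist_le (sub3 y z0) (add3 m v)) as H.
    assert (H2 : dist3 (sub3 y z0) (add3 m v) <= q + 0 + 2 * q + L * q).
    { unfold dist3. 
      replace (sub3 (sub3 y z0) (add3 m v)) with
        (add3 (add3 (add3 (sub3 y (add3 yx v)) (sub3 yx (add3 x y0))) tau) (sub3 y0 z0)).
      2:{ unfold m. apply R3_ext; intros []; r3; ring. }
      eapply Rle_trans; [apply norm3_triangle|]. apply Rplus_le_compat; [|exact Hz0].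
      eapply Rle_trans; [apply norm3_triangle|]. apply Rplus_le_compat; [|exact Ht].
      eapply Rle_trans; [apply norm3_triangle|]. apply Rplus_le_compat; [exact Hy|exact Hyx]. }
    lra. }
  pose proof (norm3_ge0 (add3 m v)) as P0. pose proof (norm3_ge0 (sub3 y z0)) as P1.
  set (u := norm3 (add3 m v)) in *. set (w := norm3 (sub3 y z0)) in *.
  apply Rle_trans with ((u + (3 + L) * q) * (u + (3 + L) * q)); [apply Rmult_le_compat; lra|].
  assert (u * ((3 + L) * q) <= (B + 2 + r) * ((3 + L) * q)) by (apply Rmult_le_compat_r; nra).
  assert (q * q <= q) by nra.
  assert (HLL : 0 <= (3 + L) * (3 + L)) by nra.
  assert ((3 + L) * (3 + L) * (q * q) <= (3 + L) * (3 + L) * q) by (apply Rmult_le_compat_l; lra).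
  nra.
Qed.

(** Each substep adds [r^2] to the squared displacement but at least [r/200] to the barrier:
    displacement grows like [sqrt j], width like [j]. The number [tol] is a reserve subtracted from
    the speed, so that the barrier survives the next perturbation. *)
Lemma complete_substeps P Q F rho r : stage P Q F -> 0 < rho < 1 -> 0 < r ->
  forall j e, 0 < e -> exists P' Q' F' b tol L, stage P' Q' F' /\ near_on rho e F F' /\
    (forall z, Cmod z <= 1 -> dist3 (Xmap F' z) (Xmap F z) * dist3 (Xmap F' z) (Xmap F z) <= INR j * (r * r) + e) /\
    rho < b < 1 /\ 0 < tol /\ INR j * r / 200 <= L /\
    (forall z, Cmod z <= 1 -> tol <= speed F' z) /\
    barrier (fun z => speed F' z - tol) rho b L.
Proof.
  intros HS Hrho Hr. induction j as [|j IH]; intros e He.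
  - destruct (speed_min P Q F HS) as [c [Hc Hmin]].
    exists P, Q, F, ((1 + rho) / 2), c, 0. split; [auto|]. split.
    { apply (near_on_mono rho rho 0); [lra|lra|apply near_on_refl]. }
    split. { intros z _. rewrite dist3_refl. simpl INR. lra. }
    split; [lra|]. split; [auto|]. split; [simpl; lra|]. split; [auto|].
    exists (fun _ => 0). split; [auto|split; [auto|]]. intros z Hz.
    apply slope_locally_const; [specialize (Hmin z ltac:(lra)); lra|].
    exists 1; split; [lra|auto].
  - destruct (IH (e / 2) ltac:(lra)) as [P1 [Q1 [F1 [b1 [tol1 [L1 [HS1 [Hn1 [Hd1 [Hb1 [Ht1 [HL1 [Hmin1 Hbar1]]]]]]]]]]]]].
    pose proof (pos_INR j) as Hj. assert (Hjr : 0 <= INR j * (r * r)) by (apply Rmult_le_pos; nra).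
    set (B := sqrt (INR j * (r * r) + e / 2)).
    assert (HB0 : 0 <= B) by apply sqrt_pos.
    assert (HBB : B * B = INR j * (r * r) + e / 2) by (apply sqrt_sqrt; lra).
    assert (HdB : forall z, Cmod z <= 1 -> dist3 (Xmap F1 z) (Xmap F z) <= B).
    { intros z Hz. apply Rsqr_incr_0_var; auto. unfold Rsqr. rewrite HBB. auto. }
    destruct (Xmap_lipschitz F) as [L [HL HLip]].
    set (K := 4 * B + 4 + 2 * (B + 2 + r) * (3 + L) + (3 + L) * (3 + L)).
    assert (HK : 1 + 2 * B <= K).
    { unfold K. assert (0 <= 2 * (B + 2 + r) * (3 + L)) by (apply Rmult_le_pos; lra).
      assert (0 <= (3 + L) * (3 + L)) by nra. lra. }
    (* [q K <= e/2] closes the estimate of the squared displacement, and [q <= tol1/4] changes the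
       speed on the old barrier by at most half of its reserve. *)
    set (q := Rmin (Rmin 1 (e / 2)) (Rmin (e / 2 / K) (tol1 / 4))).
    assert (Hq : 0 < q).
    { unfold q; repeat apply Rmin_glb_lt; try lra. apply Rdiv_lt_0_compat; lra. }
    assert (Hq1 : q <= 1) by (unfold q; eapply Rle_trans; [apply Rmin_l|apply Rmin_l]).
    assert (Hq2 : q <= e / 2) by (unfold q; eapply Rle_trans; [apply Rmin_l|apply Rmin_r]).
    assert (Hq4 : q <= tol1 / 4) by (unfold q; eapply Rle_trans; [apply Rmin_r|apply Rmin_r]).
    assert (HqK : q * K <= e / 2).
    { assert (H : q <= e / 2 / K) by (unfold q; eapply Rle_trans; [apply Rmin_r|apply Rmin_l]).
      apply Rle_div_r in H; lra. }
    (* After recentring by [tau] the displacement is never vertical on the circle, so the planes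
       orthogonal to it come from a continuous spinor. A circle of radius [r] in these planes
       increases the squared displacement by [r^2] only. *)
    destruct (avoid_curve (padd (F1 X1) (pscale (- RtoC 1) (F X1))) (padd (F1 X2) (pscale (- RtoC 1) (F X2))) q Hq)
      as [t1 [t2 [Ht1' [Ht2' Hav]]]].
    set (tau := mk3 t1 t2 0).
    assert (Htau : norm3 tau <= 2 * q).
    { apply norm3_le_coords. intros []; unfold tau; r3; rewrite Rabs_pos_eq; lra. }
    set (m := fun z => sub3 (sub3 (Xmap F1 z) (Xmap F z)) tau).
    assert (HmC : cont3_on circle m).
    { assert (C1 := Xmap_cont3 F1 circle ltac:(intros z Hz; unfold circle in Hz; lra)).
      assert (C2 := Xmap_cont3 F circle ltac:(intros z Hz; unfold circle in Hz; lra)).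
      intros i. apply (cont_on_ext _ (fun z => coord i (Xmap F1 z) + ((-1) * coord i (Xmap F z) + - coord i tau))).
      - intros z _. unfold m. destruct i; r3; ring.
      - apply cont_on_plus; [apply C1|]. apply cont_on_plus; [|apply cont_on_const].
        apply cont_on_mult; [apply cont_on_const|apply C2]. }
    assert (HmP : forall x, circle x -> 0 < norm3 (m x) + c3 (m x)).
    { intros x Hx. assert (Hne : c1 (m x) <> 0 \/ c2 (m x) <> 0).
      { destruct (Hav x Hx) as [H|H]; [left|right]; intros E; apply H;
        rewrite peval_padd, peval_pscale; unfold m, tau, Xmap, revec in E; r3; unfold Re in *; simpl; simpl in E; lra. }
      pose proof (norm3_ge0 (m x)) as Hn0. pose proof (norm3_sq (m x)) as Hsq. unfold dot3 in Hsq.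
      destruct (Rlt_or_le 0 (norm3 (m x) + c3 (m x))) as [H|H]; [auto|exfalso].
      assert (0 < c1 (m x) * c1 (m x) + c2 (m x) * c2 (m x)) by (destruct Hne; nra).
      nra. }
    destruct (push P1 Q1 F1 m (fun _ => r) r b1 q HS1 HmC (cont_on_const _ _) HmP Hr)
      as [P2 [Q2 [D [HS2 [HD [Hz2 [_ [a [b [c [Hab [Hb [Hc [Hcr Hsp]]]]]]]]]]]]]]; [intros; lra|lra|lra|].
    set (F2 := fun i => padd (F1 i) (D i)) in *.
    assert (Hn2 : near_on b1 q F1 F2) by (exists D; intros i; destruct (HD i); repeat split; auto).
    destruct (speed_min P2 Q2 F2 HS2) as [c2' [Hc2 Hmin2]].
    (* What is left of the old reserve after this substep; on the new annulus at most [c/2] of the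
       speed is reserved, so density [c/2] remains and the gain is half of [r/100]. *)
    set (tol2 := Rmin (Rmin (tol1 / 2) (c / 2)) c2').
    assert (Htol2 : 0 < tol2) by (unfold tol2; repeat apply Rmin_glb_lt; lra).
    assert (T1 : tol2 <= tol1 / 2) by (unfold tol2; eapply Rle_trans; [apply Rmin_l|apply Rmin_l]).
    assert (T2 : tol2 <= c / 2) by (unfold tol2; eapply Rle_trans; [apply Rmin_l|apply Rmin_r]).
    assert (T3 : tol2 <= c2') by (unfold tol2; apply Rmin_r).
    exists P2, Q2, F2, b, tol2, (L1 + c / 2 * (b - a)).
    split; [exact HS2|]. split; [|split; [|split; [|split; [|split; [|split]]]]].
    + apply (near_on_mono rho rho (e / 2 + q)); [lra|lra|].
      apply near_on_trans with F1; [lra|auto|].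
      apply (near_on_mono rho b1 q q); [lra|lra|auto].
    + intros z Hz. rewrite S_INR. destruct (Hz2 z Hz) as [H|[x [v [Hx [Hxz [HXx [Horth [Hv Hdv]]]]]]]].
      * assert (H2 : dist3 (Xmap F2 z) (Xmap F z) <= B + q).
        { eapply Rle_trans; [apply (dist3_triangle _ (Xmap F1 z))|]. specialize (HdB z Hz). lra. }
        pose proof (dist3_ge0 (Xmap F2 z) (Xmap F z)).
        apply Rle_trans with ((B + q) * (B + q)); [apply Rmult_le_compat; auto|].
        assert (q * (1 + 2 * B) <= q * K) by (apply Rmult_le_compat_l; lra).
        assert (q * q <= q) by nra. assert (0 <= r * r) by nra. lra.
      * assert (Hx1 : Cmod x <= 1) by (unfold circle in Hx; lra).
        pose proof (pythagoras_estimate (sub3 (Xmap F1 x) (Xmap F x)) v (Xmap F x) (Xmap F2 z) (Xmap F1 x)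
          tau B r q L HB0 ltac:(lra) ltac:(lra) ltac:(lra) (HdB x Hx1) Htau Horth Hv Hdv) as HP.
        specialize (HP ltac:(right; replace (add3 (sub3 (Xmap F1 x) (Xmap F x)) (Xmap F x)) with (Xmap F1 x);
           [apply dist3_refl|apply R3_ext; intros []; r3; ring]) (Xmap F z)).
        fold K in HP. unfold dist3.
        eapply Rle_trans; [apply HP|lra].
        eapply Rle_trans; [apply (HLip x z Hx1 Hz)|]. apply Rmult_le_compat_l; lra.
    + lra.
    + exact Htol2.
    + rewrite S_INR. lra.
    + intros z Hz. specialize (Hmin2 z Hz). lra.
    + apply (barrier_join _ rho b1 a b); [lra|lra|lra| | |].
      * intros z Hz. specialize (Hmin2 z ltac:(lra)). lra.
      * apply (barrier_mono (fun z => speed F1 z - tol1)); [|exact Hbar1].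
        intros z Hz. pose proof (near_on_speed b1 q F1 F2 z Hn2 ltac:(lra)) as H.
        apply Rabs_le_between in H. lra.
      * apply barrier_annulus; [lra|lra|]. intros z Hz. specialize (Hsp z Hz). lra.
Qed.

(** With [J] substeps of radius [200/J] the barrier reaches length 1, while the squared displacement
    [J (200/J)^2 = 40000/J] tends to 0. *)
Lemma complete_step P Q F rho e : stage P Q F -> 0 < rho < 1 -> 0 < e ->
  exists P' Q' F' b tol L, stage P' Q' F' /\ near_on rho e F F' /\
    (forall z, Cmod z <= 1 -> dist3 (Xmap F' z) (Xmap F z) <= e) /\
    rho < b < 1 /\ 0 < tol /\ 1 <= L /\ barrier (fun z => speed F' z - tol) rho b L.
Proof.
  intros HS Hrho He.
  (* [J > 80000/e^2] bounds [40000/J] by [e^2/2]; the other half is left for the error [e']. *)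
  destruct (nfloor_ex (80000 / (e * e))) as [N HN].
  { left; apply Rdiv_lt_0_compat; nra. }
  set (J := INR (S N)).
  assert (HJ : 80000 / (e * e) < J) by (unfold J; rewrite S_INR; apply HN).
  assert (HJ0 : 0 < J) by (apply lt_0_INR; lia).
  set (e' := Rmin e (e * e / 2)).
  assert (He' : 0 < e') by (apply Rmin_glb_lt; nra).
  destruct (complete_substeps P Q F rho (200 / J) HS Hrho ltac:(apply Rdiv_lt_0_compat; lra) (S N) e' He')
    as [P' [Q' [F' [b [tol [L [H1 [H2 [H3 [H4 [H5 [H6 [H7 H8]]]]]]]]]]]]].
  exists P', Q', F', b, tol, L. fold J in H3, H6.
  split; [auto|]. split.
  { apply (near_on_mono rho rho e'); [lra|apply Rmin_l|auto]. }
  split; [|split; [auto|split; [auto|split; [|auto]]]].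
  - intros z Hz. specialize (H3 z Hz). apply Rsqr_incr_0_var; [|lra]. unfold Rsqr.
    eapply Rle_trans; [exact H3|].
    assert (e' <= e * e / 2) by apply Rmin_r.
    assert (J * (200 / J * (200 / J)) <= e * e / 2); [|lra].
    replace (J * (200 / J * (200 / J))) with (40000 / J) by (field; lra).
    apply Rlt_div_l in HJ; [|nra]. apply Rle_div_l; [lra|]. nra.
  - replace (J * (200 / J) / 200) with 1 in H6 by (field; lra). exact H6.
Qed.

(** * Second-order calculus in space *)

Definition cont3 (g : R3 -> R) (x : R3) : Prop :=
  forall e, 0 < e -> exists d, 0 < d /\ forall y, dist3 y x < d -> Rabs (g y - g x) < e.

Lemma coord_dist3 i x y : Rabs (coord i x - coord i y) <= dist3 x y.
Proof.
  unfold dist3. eapply Rle_trans; [|apply (coord_le_norm3 i)]. destruct i; r3; lra.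
Qed.

Lemma dist3_le_coords x y e : (forall i, Rabs (coord i x - coord i y) <= e) -> dist3 x y <= 2 * e.
Proof.
  intros H. unfold dist3. apply norm3_le_coords. intros i. specialize (H i).
  destruct i; r3; exact H.
Qed.

Lemma ball_of_dist3 (x y : R3) (e : posreal) : dist3 y x < e -> ball x e y.
Proof.
  intros H. pose proof (coord_dist3 X1 y x) as H1. pose proof (coord_dist3 X2 y x) as H2.
  pose proof (coord_dist3 X3 y x) as H3. unfold coord in *.
  destruct x as [[a b] c], y as [[a' b'] c']. unfold c1, c2, c3 in *; cbn [fst snd] in *.
  repeat split; cbn [fst snd]; (eapply Rle_lt_trans; [|exact H]); assumption.
Qed.

Lemma dist3_of_ball (x y : R3) (e : posreal) : ball x e y -> dist3 y x <= 2 * e.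
Proof.
  intros [[H1 H2] H3]. apply dist3_le_coords.
  destruct x as [[a b] c], y as [[a' b'] c'].
  intros []; unfold coord, c1, c2, c3; cbn [fst snd] in *; left; assumption.
Qed.

Lemma open_dist3 (U : R3 -> Prop) x : open U -> U x -> exists e, 0 < e /\ forall y, dist3 y x < e -> U y.
Proof.
  intros HU Hx. destruct (HU x Hx) as [e He]. exists e; split; [apply cond_pos|].
  intros y Hy. apply He, ball_of_dist3, Hy.
Qed.

Lemma open_of_dist3 (U : R3 -> Prop) :
  (forall x, U x -> exists e, 0 < e /\ forall y, dist3 y x < e -> U y) -> open U.
Proof.
  intros H x Hx. destruct (H x Hx) as [e [He Hy]]. assert (Hp : 0 < e / 3) by lra.
  exists (mkposreal _ Hp). intros y Hb. apply Hy. apply dist3_of_ball in Hb. simpl in Hb. lra.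
Qed.

Lemma continuous_cont3 (g : R3 -> R) x : continuous g x -> cont3 g x.
Proof.
  intros Hc e He. apply filterlim_locally with (eps := mkposreal e He) in Hc.
  destruct Hc as [d Hd]. exists d; split; [apply cond_pos|]. intros y Hy.
  apply (Hd y). apply ball_of_dist3, Hy.
Qed.

Definition grad (f : R3 -> R) (x : R3) : R3 := vec (fun i => part3 i f x).

Lemma mvt_increment g dg a b : (forall t, Rmin a b <= t <= Rmax a b -> is_derive g t (dg t)) ->
  exists c, Rmin a b <= c <= Rmax a b /\ g b - g a = dg c * (b - a).
Proof.
  intros H. apply MVT_gen.
  - intros t Ht. apply H; lra.
  - intros t Ht. apply continuity_pt_filterlim. apply (ex_derive_continuous g). exists (dg t); apply H; lra.
Qed.

Lemma between_dist a b c e : Rmin a b <= c <= Rmax a b -> Rabs (b - a) <= e -> Rabs (c - a) <= e.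
Proof.
  intros H1 H2. unfold Rmin, Rmax in H1. destruct (Rle_dec a b); revert H2;
  unfold Rabs; repeat destruct Rcase_abs; lra.
Qed.

(** The increment is split into three axis-parallel steps, each handled by the mean value theorem.
    The intermediate points lie within [2 |h|] of [x], whence the halved radius in the proof. *)
Lemma differentiable3 f p r x : (forall i y, ball3 p r y -> ex_part3 i f y) ->
  (forall i, cont3 (part3 i f) x) -> ball3 p r x ->
  forall e, 0 < e -> exists d, 0 < d /\ forall h, norm3 h < d ->
    Rabs (f (add3 x h) - f x - dot3 (grad f x) h) <= e * norm3 h.
Proof.
  intros Hex Hc Hx e He.
  destruct (Hc X1 (e / 3)) as [d1 [Hd1 H1]]; [lra|].
  destruct (Hc X2 (e / 3)) as [d2 [Hd2 H2]]; [lra|].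
  destruct (Hc X3 (e / 3)) as [d3 [Hd3 H3]]; [lra|].
  unfold ball3 in *.
  set (d := Rmin (Rmin d1 d2) (Rmin d3 (r - dist3 x p)) / 2).
  assert (Hd : 0 < Rmin (Rmin d1 d2) (Rmin d3 (r - dist3 x p))) by (repeat apply Rmin_glb_lt; lra).
  exists d; split; [unfold d; lra|]. intros h Hh.
  assert (D1 : 2 * norm3 h < d1 /\ 2 * norm3 h < d2 /\ 2 * norm3 h < d3 /\ 2 * norm3 h < r - dist3 x p).
  { pose proof (Rmin_l (Rmin d1 d2) (Rmin d3 (r - dist3 x p))).
    pose proof (Rmin_r (Rmin d1 d2) (Rmin d3 (r - dist3 x p))).
    pose proof (Rmin_l d1 d2). pose proof (Rmin_r d1 d2).
    pose proof (Rmin_l d3 (r - dist3 x p)). pose proof (Rmin_r d3 (r - dist3 x p)).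
    unfold d in Hh. repeat split; lra. }
  pose proof (coord_le_norm3 X1 h) as N1. pose proof (coord_le_norm3 X2 h) as N2.
  pose proof (coord_le_norm3 X3 h) as N3.
  destruct x as [[x1 x2] x3], h as [[h1 h2] h3].
  unfold coord, c1, c2, c3 in N1, N2, N3; cbn [fst snd] in N1, N2, N3.
  set (nh := norm3 (h1, h2, h3)) in *.
  pose proof (norm3_ge0 (h1, h2, h3)) as Hn0. fold nh in Hn0.
  assert (Hin : forall a b c, Rabs (a - x1) <= nh -> Rabs (b - x2) <= nh -> Rabs (c - x3) <= nh ->
     dist3 (mk3 a b c) (x1, x2, x3) <= 2 * nh).
  { intros a b c Ha Hb Hc'. apply dist3_le_coords. intros []; assumption. }
  assert (Hball : forall y, dist3 y (x1, x2, x3) <= 2 * nh -> dist3 y p < r).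
  { intros y Hy. eapply Rle_lt_trans; [apply (dist3_triangle _ (x1, x2, x3))|]. lra. }
  assert (Z : forall u, Rabs (u - u) <= nh) by (intros; rewrite Rminus_diag, Rabs_R0; auto).
  assert (Ah : forall u v, Rabs v <= nh -> Rabs (u + v - u) <= nh).
  { intros u v Hv. replace (u + v - u) with v by ring; auto. }
  destruct (mvt_increment (fun t => f (mk3 t (x2 + h2) (x3 + h3)))
    (fun t => part3 X1 f (mk3 t (x2 + h2) (x3 + h3))) x1 (x1 + h1)) as [k1 [K1 E1]].
  { intros t Ht. apply Derive_correct. apply (Hex X1 (mk3 t (x2 + h2) (x3 + h3))).
    apply Hball, Hin; auto. eapply between_dist; eauto. }
  destruct (mvt_increment (fun t => f (mk3 x1 t (x3 + h3)))
    (fun t => part3 X2 f (mk3 x1 t (x3 + h3))) x2 (x2 + h2)) as [k2 [K2 E2]].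
  { intros t Ht. apply Derive_correct. apply (Hex X2 (mk3 x1 t (x3 + h3))).
    apply Hball, Hin; auto. eapply between_dist; eauto. }
  destruct (mvt_increment (fun t => f (mk3 x1 x2 t))
    (fun t => part3 X3 f (mk3 x1 x2 t)) x3 (x3 + h3)) as [k3 [K3 E3]].
  { intros t Ht. apply Derive_correct. apply (Hex X3 (mk3 x1 x2 t)).
    apply Hball, Hin; auto. eapply between_dist; eauto. }
  assert (B1 : Rabs (part3 X1 f (mk3 k1 (x2 + h2) (x3 + h3)) - part3 X1 f (x1, x2, x3)) < e / 3).
  { apply H1. eapply Rle_lt_trans; [apply Hin; auto; eapply between_dist; eauto|lra]. }
  assert (B2 : Rabs (part3 X2 f (mk3 x1 k2 (x3 + h3)) - part3 X2 f (x1, x2, x3)) < e / 3).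
  { apply H2. eapply Rle_lt_trans; [apply Hin; auto; eapply between_dist; eauto|lra]. }
  assert (B3 : Rabs (part3 X3 f (mk3 x1 x2 k3) - part3 X3 f (x1, x2, x3)) < e / 3).
  { apply H3. eapply Rle_lt_trans; [apply Hin; auto; eapply between_dist; eauto|lra]. }
  replace (add3 (x1, x2, x3) (h1, h2, h3)) with (mk3 (x1 + h1) (x2 + h2) (x3 + h3)) by reflexivity.
  unfold dot3, grad, vec. change (c1 (h1, h2, h3)) with h1. change (c2 (h1, h2, h3)) with h2.
  change (c3 (h1, h2, h3)) with h3.
  unfold mk3 at 2 3 4, c1, c2, c3. cbn [fst snd].
  replace (f (mk3 (x1 + h1) (x2 + h2) (x3 + h3)) - f (x1, x2, x3) -
    (part3 X1 f (x1, x2, x3) * h1 + part3 X2 f (x1, x2, x3) * h2 + part3 X3 f (x1, x2, x3) * h3))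
  with ((part3 X1 f (mk3 k1 (x2 + h2) (x3 + h3)) - part3 X1 f (x1, x2, x3)) * h1
     + (part3 X2 f (mk3 x1 k2 (x3 + h3)) - part3 X2 f (x1, x2, x3)) * h2
     + (part3 X3 f (mk3 x1 x2 k3) - part3 X3 f (x1, x2, x3)) * h3).
  2:{ change (mk3 x1 x2 x3) with (x1, x2, x3) in *. replace (x1 + h1 - x1) with h1 in E1 by ring.
      replace (x2 + h2 - x2) with h2 in E2 by ring. replace (x3 + h3 - x3) with h3 in E3 by ring.
      cbn beta in *. lra. }
  assert (P : forall u v, Rabs u < e / 3 -> Rabs v <= nh -> Rabs (u * v) <= e / 3 * nh).
  { intros u v Hu Hv. rewrite Rabs_mult. apply Rmult_le_compat; try apply Rabs_pos; lra. }
  eapply Rle_trans; [apply Rabs_triang|].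
  pose proof (P _ _ B3 N3). pose proof (P _ _ B2 N2). pose proof (P _ _ B1 N1).
  pose proof (Rabs_triang ((part3 X1 f (mk3 k1 (x2 + h2) (x3 + h3)) - part3 X1 f (x1, x2, x3)) * h1)
     ((part3 X2 f (mk3 x1 k2 (x3 + h3)) - part3 X2 f (x1, x2, x3)) * h2)).
  lra.
Qed.

Lemma derive_along_line f p r y v t : (forall i x, ball3 p r x -> ex_part3 i f x) ->
  (forall i x, ball3 p r x -> cont3 (part3 i f) x) -> ball3 p r (add3 y (scal3 t v)) ->
  is_derive (fun s => f (add3 y (scal3 s v))) t (dot3 (grad f (add3 y (scal3 t v))) v).
Proof.
  intros Hex Hc Hb. apply is_derive_Reals. intros e He.
  set (x := add3 y (scal3 t v)) in *.
  pose proof (norm3_ge0 v) as Hv.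
  destruct (differentiable3 f p r x Hex (fun i => Hc i x Hb) Hb (e / (2 * (norm3 v + 1)))) as [d [Hd H]].
  { apply Rdiv_lt_0_compat; lra. }
  assert (Hd' : 0 < d / (norm3 v + 1)) by (apply Rdiv_lt_0_compat; lra).
  exists (mkposreal _ Hd'). intros h Hh0 Hh. simpl in Hh.
  assert (Hh1 : 0 < Rabs h) by (apply Rabs_pos_lt; auto).
  replace (add3 y (scal3 (t + h) v)) with (add3 x (scal3 h v)).
  2:{ unfold x. apply R3_ext; intros []; r3; ring. }
  specialize (H (scal3 h v)). rewrite norm3_scal in H.
  apply Rlt_div_r in Hh; [|lra].
  assert (Hlt : Rabs h * norm3 v < d) by nra. specialize (H Hlt).
  replace (dot3 (grad f x) (scal3 h v)) with (h * dot3 (grad f x) v) in H by (r3; ring).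
  replace ((f (add3 x (scal3 h v)) - f x) / h - dot3 (grad f x) v)
    with ((f (add3 x (scal3 h v)) - f x - h * dot3 (grad f x) v) / h) by (field; auto).
  unfold Rdiv at 1. rewrite Rabs_mult, Rabs_inv by auto.
  apply Rmult_lt_reg_r with (Rabs h); auto. rewrite Rmult_assoc, Rinv_l, Rmult_1_r by lra.
  eapply Rle_lt_trans; [exact H|].
  apply Rle_lt_trans with (e / 2 * Rabs h); [|nra].
  replace (e / (2 * (norm3 v + 1)) * (Rabs h * norm3 v)) with (e / 2 * Rabs h * (norm3 v / (norm3 v + 1)))
    by (field; lra).
  rewrite <- (Rmult_1_r (e / 2 * Rabs h)) at 2. apply Rmult_le_compat_l; [nra|].
  apply Rle_div_l; lra.
Qed.

Definition hess (f : R3 -> R) (x v : R3) : R :=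
  dot3 (vec (fun i => dot3 (grad (part3 i f) x) v)) v.

Lemma Cinf3_cont p r f ds x : Cinf3 (ball3 p r) f -> ball3 p r x -> cont3 (iter_part3 ds f) x.
Proof. intros H Hx. apply continuous_cont3, (H ds x Hx). Qed.

Lemma derive_line_Cinf3 f p r y v t ds : Cinf3 (ball3 p r) f -> ball3 p r (add3 y (scal3 t v)) ->
  is_derive (fun s => iter_part3 ds f (add3 y (scal3 s v))) t
    (dot3 (grad (iter_part3 ds f) (add3 y (scal3 t v))) v).
Proof.
  intros Hf Hb. apply (derive_along_line _ p r); auto.
  - intros i x Hx. apply (Hf ds x Hx).
  - intros i x Hx. apply (Cinf3_cont p r f (i :: ds) x Hf Hx).
Qed.

Lemma derive2_line_Cinf3 f p r y v t : Cinf3 (ball3 p r) f -> ball3 p r (add3 y (scal3 t v)) ->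
  is_derive (fun s => dot3 (grad f (add3 y (scal3 s v))) v) t (hess f (add3 y (scal3 t v)) v).
Proof.
  intros Hf Hb.
  assert (H : forall i, is_derive (fun s => part3 i f (add3 y (scal3 s v))) t
    (dot3 (grad (part3 i f) (add3 y (scal3 t v))) v)).
  { intros i. apply (derive_line_Cinf3 f p r y v t [i] Hf Hb). }
  apply (is_derive_ext (fun s => c1 v * part3 X1 f (add3 y (scal3 s v))
    + c2 v * part3 X2 f (add3 y (scal3 s v)) + c3 v * part3 X3 f (add3 y (scal3 s v)))).
  { intros s. generalize (add3 y (scal3 s v)); intros x.
    match goal with |- @eq _ ?a ?b => change (@eq R a b) end. unfold grad, vec, dot3.
    generalize (part3 X1 f x) (part3 X2 f x) (part3 X3 f x). clear. intros a b c. r3. ring. }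
  replace (hess f (add3 y (scal3 t v)) v) with
    (c1 v * dot3 (grad (part3 X1 f) (add3 y (scal3 t v))) v
     + c2 v * dot3 (grad (part3 X2 f) (add3 y (scal3 t v))) v
     + c3 v * dot3 (grad (part3 X3 f) (add3 y (scal3 t v))) v).
  2:{ generalize (add3 y (scal3 t v)); intros x. unfold hess, vec. generalize (dot3 (grad (part3 X1 f) x) v)
      (dot3 (grad (part3 X2 f) x) v) (dot3 (grad (part3 X3 f) x) v). clear. intros a b c. r3. ring. }
  apply @is_derive_plus; [apply @is_derive_plus|]; apply is_derive_scal; apply H.
Qed.

(** The mean value theorem twice: [g1] grows at rate at least [c], so subtracting
    [g1(0) t + c t^2 / 2] from [g] leaves a function with nonnegative derivative. *)
Lemma taylor2_lower g g1 g2 c : (forall t, 0 <= t <= 1 -> is_derive g t (g1 t)) ->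
  (forall t, 0 <= t <= 1 -> is_derive g1 t (g2 t)) -> (forall t, 0 <= t <= 1 -> c <= g2 t) ->
  g 0 + g1 0 + c / 2 <= g 1.
Proof.
  intros H1 H2 Hc.
  assert (Hm : forall t, 0 <= t <= 1 -> g1 0 + c * t <= g1 t).
  { intros t Ht. destruct (mvt_increment g1 g2 0 t) as [k [Hk E]].
    - intros s Hs. rewrite Rmin_left, Rmax_right in Hs by lra. apply H2; lra.
    - rewrite Rmin_left, Rmax_right in Hk by lra. specialize (Hc k ltac:(lra)). nra. }
  destruct (mvt_increment (fun t => g t - (g1 0 * t + c / 2 * (t * t))) (fun t => g1 t - (g1 0 + c * t)) 0 1)
    as [k [Hk E]].
  - intros t Ht. rewrite Rmin_left, Rmax_right in Ht by lra.
    apply @is_derive_minus; [apply H1; lra|]. auto_derive; [auto|]. field.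
  - rewrite Rmin_left, Rmax_right in Hk by lra. specialize (Hm k ltac:(lra)). lra.
Qed.

Lemma dot3_scal_r a x y : dot3 x (scal3 a y) = a * dot3 x y.
Proof. r3; ring. Qed.

Lemma hess_scal f x t v : hess f x (scal3 t v) = t * t * hess f x v.
Proof.
  unfold hess, vec. rewrite !dot3_scal_r.
  generalize (dot3 (grad (part3 X1 f) x) v) (dot3 (grad (part3 X2 f) x) v) (dot3 (grad (part3 X3 f) x) v).
  clear. intros a b c. r3. ring.
Qed.

Lemma second_order_bounds f p r y v c C : Cinf3 (ball3 p r) f ->
  (forall t, 0 <= t <= 1 -> ball3 p r (add3 y (scal3 t v))) ->
  (forall t, 0 <= t <= 1 -> c <= hess f (add3 y (scal3 t v)) v <= C) ->
  c / 2 <= f (add3 y v) - f y - dot3 (grad f y) v <= C / 2.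
Proof.
  intros Hf Hb Hh.
  assert (E0 : add3 y (scal3 0 v) = y) by (apply R3_ext; intros []; r3; ring).
  assert (E1 : add3 y (scal3 1 v) = add3 y v) by (apply R3_ext; intros []; r3; ring).
  assert (D1 : forall t, 0 <= t <= 1 -> is_derive (fun s => f (add3 y (scal3 s v))) t
    (dot3 (grad f (add3 y (scal3 t v))) v)).
  { intros t Ht. apply (derive_line_Cinf3 f p r y v t [] Hf). auto. }
  assert (D2 : forall t, 0 <= t <= 1 -> is_derive (fun s => dot3 (grad f (add3 y (scal3 s v))) v) t
    (hess f (add3 y (scal3 t v)) v)).
  { intros t Ht. apply (derive2_line_Cinf3 f p r); auto. }
  split.
  - assert (H := taylor2_lower (fun s => f (add3 y (scal3 s v))) (fun s => dot3 (grad f (add3 y (scal3 s v))) v)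
      (fun s => hess f (add3 y (scal3 s v)) v) c D1 D2 (fun t Ht => proj1 (Hh t Ht))).
    cbn beta in H. rewrite E0, E1 in H. lra.
  - pose proof (taylor2_lower (fun s => - f (add3 y (scal3 s v))) (fun s => - dot3 (grad f (add3 y (scal3 s v))) v)
      (fun s => - hess f (add3 y (scal3 s v)) v) (- C)) as H.
    cbn beta in H. rewrite E0, E1 in H.
    assert (- f y + - dot3 (grad f y) v + - C / 2 <= - f (add3 y v)); [|lra].
    apply H; intros t Ht.
    + apply (is_derive_opp (fun s => f (add3 y (scal3 s v)))); auto.
    + apply (is_derive_opp (fun s => dot3 (grad f (add3 y (scal3 s v))) v)); auto.
    + specialize (Hh t Ht). lra.
Qed.

Lemma first_order_bounds f p r y v c C : Cinf3 (ball3 p r) f ->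
  (forall t, 0 <= t <= 1 -> ball3 p r (add3 y (scal3 t v))) ->
  (forall t, 0 <= t <= 1 -> c <= dot3 (grad f (add3 y (scal3 t v))) v <= C) ->
  c <= f (add3 y v) - f y <= C.
Proof.
  intros Hf Hb Hh.
  assert (E0 : add3 y (scal3 0 v) = y) by (apply R3_ext; intros []; r3; ring).
  assert (E1 : add3 y (scal3 1 v) = add3 y v) by (apply R3_ext; intros []; r3; ring).
  destruct (mvt_increment (fun s => f (add3 y (scal3 s v))) (fun t => dot3 (grad f (add3 y (scal3 t v))) v) 0 1)
    as [k [Hk E]].
  - intros t Ht. rewrite Rmin_left, Rmax_right in Ht by lra.
    apply (derive_line_Cinf3 f p r y v t [] Hf). auto.
  - rewrite Rmin_left, Rmax_right in Hk by lra. cbn beta in E. rewrite E0, E1 in E.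
    specialize (Hh k Hk). lra.
Qed.

(** * A strictly convex boundary cap *)

Lemma ball3_cover M (d : R3 -> R) : (forall x, 0 < d x) ->
  exists l : list R3, forall x, norm3 x <= M -> exists c, In c l /\ dist3 x c < d c.
Proof.
  intros Hd.
  set (pt := fun t : R * (R * (R * unit)) => mk3 (fst t) (fst (snd t)) (fst (snd (snd t)))).
  assert (Hp : forall t, 0 < d (pt t) / 3) by (intros t; specialize (Hd (pt t)); lra).
  destruct (NNPP _ (compactness_list 3 (-M, (-M, (-M, tt))) (M, (M, (M, tt)))
    (fun t => mkposreal _ (Hp t)))) as [l Hl].
  exists (map pt l). intros x Hx.
  destruct (Hl (c1 x, (c2 x, (c3 x, tt)))) as [t [Ht [_ Hc]]].
  { pose proof (coord_le_norm3 X1 x) as N1. pose proof (coord_le_norm3 X2 x) as N2.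
    pose proof (coord_le_norm3 X3 x) as N3. unfold coord in *.
    assert (Rabs (c1 x) <= M) as A1 by lra. assert (Rabs (c2 x) <= M) as A2 by lra.
    assert (Rabs (c3 x) <= M) as A3 by lra.
    apply Rabs_le_between in A1. apply Rabs_le_between in A2. apply Rabs_le_between in A3.
    simpl. repeat split; lra. }
  destruct t as [a [b [c []]]]. simpl in Hc. destruct Hc as [K1 [K2 [K3 _]]].
  exists (pt (a, (b, (c, tt)))). split; [apply in_map; exact Ht|].
  specialize (Hd (pt (a, (b, (c, tt))))).
  apply Rle_lt_trans with (2 * (d (pt (a, (b, (c, tt)))) / 3)); [|lra].
  apply dist3_le_coords. intros []; unfold pt, coord, mk3, c1, c2, c3 in *; cbn [fst snd] in *; lra.
Qed.

(** If no limit point of [O] had norm at least the supremum [s], a ball of radius [s] would be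
    covered by finitely many neighbourhoods on each of which the norms in [O] stay below a bound
    less than [s]. The limit point found is not in [O], since an open set would reach further
    out. *)
Lemma farthest_point O : bounded_domain O ->
  exists p, boundary_pt O p /\ 0 < norm3 p /\ forall x, O x -> norm3 x <= norm3 p.
Proof.
  intros [[x0 Hx0] [Hop [_ [M HM]]]].
  destruct (completeness (fun t => exists x, O x /\ t = norm3 x)) as [s [Hub Hlub]].
  { exists M. intros t [x [Hx ->]]; auto. }
  { exists (norm3 x0), x0; auto. }
  assert (Hs : forall x, O x -> norm3 x <= s) by (intros x Hx; apply Hub; exists x; auto).
  assert (Hex : exists p, s <= norm3 p /\ forall e, 0 < e -> exists x, O x /\ dist3 x p < e).
  { apply NNPP. intros Hno.
    assert (H : forall p, exists ds : R * R, 0 < fst ds /\ snd ds < s /\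
      forall x, O x -> dist3 x p < fst ds -> norm3 x <= snd ds).
    { intros p. destruct (Rlt_or_le (norm3 p) s) as [Hlt|Hge].
      - exists ((s - norm3 p) / 2, (s + norm3 p) / 2). simpl. split; [lra|split; [lra|]].
        intros x _ Hd. pose proof (norm3_dist_le x p). lra.
      - destruct (classic (exists e, 0 < e /\ forall x, O x -> e <= dist3 x p)) as [[e [He H]]|Hn].
        + exists (e, s - 1). simpl. split; [auto|split; [lra|]]. intros x Hx Hd. specialize (H x Hx). lra.
        + exfalso. apply Hno. exists p. split; auto. intros e He. apply NNPP. intros Hn2. apply Hn.
          exists e; split; auto. intros x Hx. destruct (Rle_or_lt e (dist3 x p)); auto.
          exfalso; apply Hn2; exists x; auto. }
    apply choice in H. destruct H as [ds H].
    destruct (ball3_cover s (fun p => fst (ds p))) as [l Hl]; [intros p; apply H|].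
    assert (Hmax : exists m, m < s /\ forall p, In p l -> snd (ds p) <= m).
    { clear Hl. induction l as [|a l [m [Hm Hl]]].
      - exists (s - 1); split; [lra|intros p []].
      - exists (Rmax m (snd (ds a))). split; [apply Rmax_lub_lt; auto; apply H|].
        intros p [<-|Hp]; [apply Rmax_r|]. eapply Rle_trans; [apply Hl; auto|apply Rmax_l]. }
    destruct Hmax as [m [Hm Hml]].
    assert (s <= m); [|lra]. apply Hlub. intros t [x [Hx ->]].
    destruct (Hl x (Hs x Hx)) as [c [Hc Hd]].
    eapply Rle_trans; [apply (proj2 (proj2 (H c)) x Hx Hd)|auto]. }
  destruct Hex as [p [Hp Hlim]].
  assert (Hps : norm3 p <= s).
  { destruct (Rle_or_lt (norm3 p) s); auto. destruct (Hlim (norm3 p - s)) as [x [Hx Hd]]; [lra|].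
    specialize (Hs x Hx). pose proof (norm3_dist_le p x). rewrite dist3_sym in Hd. lra. }
  assert (Hs0 : 0 < s).
  { destruct (Rlt_or_le 0 s) as [H|H]; auto. exfalso.
    destruct (open_dist3 O x0 Hop Hx0) as [e [He Hb]].
    assert (O (add3 x0 (mk3 (e / 2) 0 0))).
    { apply Hb. rewrite dist3_add. apply Rle_lt_trans with (e / 2); [|lra].
      apply norm3_le; [lra|]. r3; lra. }
    pose proof (Hs _ H0) as H1. pose proof (Hs _ Hx0) as H2.
    pose proof (coord_le_norm3 X1 (add3 x0 (mk3 (e / 2) 0 0))) as N1.
    pose proof (coord_le_norm3 X1 x0) as N2. unfold coord in *.
    pose proof (Rabs_pos (c1 x0)). pose proof (Rabs_pos (c1 (add3 x0 (mk3 (e / 2) 0 0)))).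
    assert (Z1 : Rabs (c1 x0) = 0) by lra. assert (Z2 : Rabs (c1 (add3 x0 (mk3 (e / 2) 0 0))) = 0) by lra.
    apply Rabs_eq_0 in Z1. apply Rabs_eq_0 in Z2. r3. lra. }
  exists p. split; [split; [|exact Hlim]|split; [lra|]].
  - intros HO. destruct (open_dist3 O p Hop HO) as [e [He Hb]].
    set (t := e / (2 * (norm3 p + 1))).
    assert (Ht : 0 < t) by (apply Rdiv_lt_0_compat; lra).
    assert (Hin : O (add3 p (scal3 t p))).
    { apply Hb. rewrite dist3_add, norm3_scal, Rabs_pos_eq by lra.
      replace (t * norm3 p) with (e / 2 * (norm3 p / (norm3 p + 1))) by (unfold t; field; lra).
      apply Rle_lt_trans with (e / 2 * 1); [|lra]. apply Rmult_le_compat_l; [lra|].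
      apply Rle_div_l; lra. }
    specialize (Hs _ Hin). replace (add3 p (scal3 t p)) with (scal3 (1 + t) p) in Hs
      by (apply R3_ext; intros []; r3; ring).
    rewrite norm3_scal, Rabs_pos_eq in Hs by lra. nra.
  - intros x Hx. specialize (Hs x Hx). lra.
Qed.

Lemma dot3_comm x y : dot3 x y = dot3 y x.
Proof. r3; ring. Qed.

Lemma dot3_add_l x y z : dot3 (add3 x y) z = dot3 x z + dot3 y z.
Proof. r3; ring. Qed.

Lemma dot3_add_r x y z : dot3 z (add3 x y) = dot3 z x + dot3 z y.
Proof. r3; ring. Qed.

Lemma dot3_scal_l a x y : dot3 (scal3 a x) y = a * dot3 x y.
Proof. r3; ring. Qed.

Lemma defining_function_boundary O p f r : Cinf3 (ball3 p r) f -> 0 < r -> boundary_pt O p ->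
  (forall x, ball3 p r x -> (O x <-> f x < 0)) -> f p = 0.
Proof.
  intros Hf Hr [HnO Hlim] HO.
  assert (Hpp : ball3 p r p) by (unfold ball3; rewrite dist3_refl; auto).
  apply Rle_antisym.
  - destruct (Rle_or_lt (f p) 0) as [H|H]; auto. exfalso.
    destruct (Cinf3_cont p r f [] p Hf Hpp (f p) H) as [d [Hd Hc]]. simpl in Hc.
    destruct (Hlim (Rmin d r)) as [x [Hx Hdx]]; [apply Rmin_glb_lt; auto|].
    pose proof (Rmin_l d r); pose proof (Rmin_r d r).
    specialize (Hc x ltac:(lra)). apply Rabs_def2 in Hc.
    apply (HO x) in Hx; [lra|unfold ball3; lra].
  - destruct (Rle_or_lt 0 (f p)) as [H|H]; auto. exfalso. apply HnO, (HO p Hpp), H.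
Qed.

(** Directions [w] with [w . p > 0] leave the ball of radius [|p|], hence [O], so [f] cannot
    decrease along them. A linear form that is nonnegative on an open half-space is a nonnegative
    multiple of the pairing with [p], and this one is not zero. *)
Lemma farthest_gradient O p f r : Cinf3 (ball3 p r) f -> 0 < r -> 0 < norm3 p -> f p = 0 ->
  (forall x, O x -> norm3 x <= norm3 p) ->
  (forall x, ball3 p r x -> (O x <-> f x < 0)) -> grad f p <> mk3 0 0 0 ->
  0 < dot3 (grad f p) p /\ forall u, dot3 u p = 0 -> dot3 (grad f p) u = 0.
Proof.
  intros Hf Hr Hp Hfp Hfar HO Hg.
  assert (Hpp : ball3 p r p) by (unfold ball3; rewrite dist3_refl; auto).
  assert (Hw : forall w, 0 < dot3 w p -> 0 <= dot3 (grad f p) w).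
  { intros w Hw. destruct (Rle_or_lt 0 (dot3 (grad f p) w)) as [H|H]; auto. exfalso.
    set (a := dot3 (grad f p) w) in *.
    pose proof (norm3_ge0 w) as Hnw.
    destruct (differentiable3 f p r p) with (e := - a / (2 * (norm3 w + 1))) as [d [Hd Hdiff]]; auto.
    { intros i y Hy. apply (Hf [] y Hy). }
    { intros i. apply (Cinf3_cont p r f [i] p Hf Hpp). }
    { apply Rdiv_lt_0_compat; lra. }
    set (t := Rmin d r / (2 * (norm3 w + 1))).
    assert (Hm : 0 < Rmin d r) by (apply Rmin_glb_lt; auto).
    assert (Ht : 0 < t) by (apply Rdiv_lt_0_compat; lra).
    assert (Htw : t * norm3 w < Rmin d r).
    { replace (t * norm3 w) with (Rmin d r * (norm3 w / (2 * (norm3 w + 1)))) by (unfold t; field; lra).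
      rewrite <- (Rmult_1_r (Rmin d r)) at 2. apply Rmult_lt_compat_l; [auto|].
      apply Rlt_div_l; lra. }
    pose proof (Rmin_l d r); pose proof (Rmin_r d r).
    specialize (Hdiff (scal3 t w)). rewrite norm3_scal, Rabs_pos_eq in Hdiff by lra.
    specialize (Hdiff ltac:(lra)). rewrite dot3_scal_r in Hdiff. fold a in Hdiff. rewrite Hfp in Hdiff.
    apply Rabs_le_between in Hdiff.
    assert (Hq : - a / (2 * (norm3 w + 1)) * (t * norm3 w) <= - a * t / 2).
    { replace (- a / (2 * (norm3 w + 1)) * (t * norm3 w)) with (- a * t / 2 * (norm3 w / (norm3 w + 1)))
        by (field; lra).
      rewrite <- (Rmult_1_r (- a * t / 2)) at 2. apply Rmult_le_compat_l; [nra|]. apply Rle_div_l; lra. }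
    assert (Hin : O (add3 p (scal3 t w))).
    { apply HO; [unfold ball3; rewrite dist3_add, norm3_scal, Rabs_pos_eq; lra|]. nra. }
    apply Hfar in Hin. pose proof (norm3_ge0 (add3 p (scal3 t w))).
    assert (norm3 (add3 p (scal3 t w)) * norm3 (add3 p (scal3 t w)) <= norm3 p * norm3 p)
      by (apply Rmult_le_compat; auto).
    rewrite !norm3_sq in *.
    replace (dot3 (add3 p (scal3 t w)) (add3 p (scal3 t w)))
      with (dot3 p p + 2 * t * dot3 w p + t * t * dot3 w w) in * by (r3; ring).
    pose proof (dot3_ge0 w). assert (0 < t * dot3 w p) by (apply Rmult_lt_0_compat; auto). nra. }
  assert (Hpd : 0 < dot3 p p) by (rewrite <- norm3_sq; nra).
  assert (Horth : forall u, dot3 u p = 0 -> dot3 (grad f p) u = 0).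
  { assert (Hge : forall u, dot3 u p = 0 -> 0 <= dot3 (grad f p) u).
    { intros u Hu. destruct (Rle_or_lt 0 (dot3 (grad f p) u)) as [H|H]; auto. exfalso.
      set (b := dot3 (grad f p) p).
      assert (Hb : 0 <= b) by (apply Hw; auto).
      (* A tangential direction of decrease remains one after a small outward tilt: with [a < 0] the
         derivative along [u] and [b] that along [p], the tilt [-a/(2(b+1))] uses up at most half of
         [a]. *)
      specialize (Hw (add3 u (scal3 (- dot3 (grad f p) u / (2 * (b + 1))) p))).
      rewrite dot3_add_l, dot3_scal_l, dot3_add_r, dot3_scal_r, Hu in Hw. fold b in Hw.
      set (a := dot3 (grad f p) u) in *.
      assert (0 < - a / (2 * (b + 1))) by (apply Rdiv_lt_0_compat; lra).
      assert (0 <= a + - a / (2 * (b + 1)) * b) by (apply Hw; nra).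
      replace (- a / (2 * (b + 1)) * b) with (- a / 2 * (b / (b + 1))) in H1 by (field; lra).
      assert (b / (b + 1) <= 1) by (apply Rle_div_l; lra). nra. }
    intros u Hu. apply Rle_antisym; [|auto].
    assert (0 <= dot3 (grad f p) (scal3 (-1) u)) by (apply Hge; rewrite dot3_scal_l, Hu; ring).
    rewrite dot3_scal_r in H. lra. }
  split; [|auto].
  destruct (Rle_lt_or_eq_dec 0 (dot3 (grad f p) p)) as [H|H]; [apply Hw; auto|auto|].
  exfalso. apply Hg. set (g := grad f p) in *.
  assert (Hgg : dot3 g g = 0).
  { apply (Horth g). lra. }
  assert (N : norm3 g = 0) by (apply Rle_antisym; [apply norm3_le; lra|apply norm3_ge0]).
  apply R3_ext. intros i. pose proof (coord_le_norm3 i g) as Hc. rewrite N in Hc.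
  pose proof (Rabs_pos (coord i g)). assert (Z : Rabs (coord i g) = 0) by lra.
  apply Rabs_eq_0 in Z. rewrite Z. destruct i; reflexivity.
Qed.

Lemma dot3_sub_l x y z : dot3 (sub3 x y) z = dot3 x z - dot3 y z.
Proof. r3; ring. Qed.

Lemma grad_close f p r ds e : Cinf3 (ball3 p r) f -> 0 < r -> 0 < e ->
  exists d, 0 < d /\ forall x, dist3 x p < d ->
    norm3 (sub3 (grad (iter_part3 ds f) x) (grad (iter_part3 ds f) p)) <= e.
Proof.
  intros Hf Hr He.
  assert (Hp : ball3 p r p) by (unfold ball3; rewrite dist3_refl; auto).
  assert (H : forall i, exists d, 0 < d /\ forall x, dist3 x p < d ->
     Rabs (iter_part3 (i :: ds) f x - iter_part3 (i :: ds) f p) < e / 2).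
  { intros i. apply (Cinf3_cont p r f (i :: ds) p Hf Hp). lra. }
  destruct (H X1) as [d1 [D1 E1]]. destruct (H X2) as [d2 [D2 E2]]. destruct (H X3) as [d3 [D3 E3]].
  exists (Rmin d1 (Rmin d2 d3)). split; [repeat apply Rmin_glb_lt; auto|].
  intros x Hx. pose proof (Rmin_l d1 (Rmin d2 d3)). pose proof (Rmin_r d1 (Rmin d2 d3)).
  pose proof (Rmin_l d2 d3). pose proof (Rmin_r d2 d3).
  replace e with (2 * (e / 2)) by field. apply norm3_le_coords.
  intros []; left; [apply (E1 x)|apply (E2 x)|apply (E3 x)]; lra.
Qed.

Definition hvec (f : R3 -> R) (x v : R3) : R3 := vec (fun i => dot3 (grad (part3 i f) x) v).

Lemma hess_close f p r e : Cinf3 (ball3 p r) f -> 0 < r -> 0 < e ->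
  exists d, 0 < d /\ forall x v, dist3 x p < d -> Rabs (hess f x v - hess f p v) <= e * (norm3 v * norm3 v).
Proof.
  intros Hf Hr He.
  destruct (grad_close f p r [X1] (e / 2) Hf Hr ltac:(lra)) as [d1 [D1 E1]].
  destruct (grad_close f p r [X2] (e / 2) Hf Hr ltac:(lra)) as [d2 [D2 E2]].
  destruct (grad_close f p r [X3] (e / 2) Hf Hr ltac:(lra)) as [d3 [D3 E3]].
  exists (Rmin d1 (Rmin d2 d3)). split; [repeat apply Rmin_glb_lt; auto|].
  intros x v Hx. pose proof (Rmin_l d1 (Rmin d2 d3)). pose proof (Rmin_r d1 (Rmin d2 d3)).
  pose proof (Rmin_l d2 d3). pose proof (Rmin_r d2 d3).
  specialize (E1 x ltac:(lra)). specialize (E2 x ltac:(lra)). specialize (E3 x ltac:(lra)). simpl in E1, E2, E3.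
  replace (hess f x v - hess f p v) with (dot3 (sub3 (hvec f x v) (hvec f p v)) v)
    by (rewrite dot3_sub_l; reflexivity).
  eapply Rle_trans; [apply cauchy_schwarz3_abs|].
  pose proof (norm3_ge0 v). rewrite <- Rmult_assoc. apply Rmult_le_compat_r; [auto|].
  replace (e * norm3 v) with (2 * (e / 2 * norm3 v)) by field. apply norm3_le_coords.
  assert (T : forall a b, norm3 (sub3 a b) <= e / 2 -> Rabs (dot3 a v - dot3 b v) <= e / 2 * norm3 v).
  { intros a b Hab. rewrite <- dot3_sub_l. eapply Rle_trans; [apply cauchy_schwarz3_abs|].
    apply Rmult_le_compat_r; auto. }
  intros []; unfold coord, hvec, sub3, vec, mk3, c1, c2, c3; cbn [fst snd]; apply T; auto.
Qed.

(* The parabola [p + t u - s t^2 p] stays outside the sphere [|x| = |p|], where [f >= 0], as soon as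
   [s = |u|^2 / (2 |p|^2)]; this bounds the Hessian from below on the tangent plane. *)
Lemma farthest_hessian O p f r : Cinf3 (ball3 p r) f -> 0 < r -> 0 < norm3 p -> f p = 0 ->
  (forall x, O x -> norm3 x <= norm3 p) ->
  (forall x, ball3 p r x -> (O x <-> f x < 0)) ->
  (forall u, dot3 u p = 0 -> dot3 (grad f p) u = 0) ->
  forall u, dot3 u p = 0 -> dot3 (grad f p) p / dot3 p p * (norm3 u * norm3 u) <= hess f p u.
Proof.
  intros Hf Hr Hp Hfp Hfar HO Horth u Hu.
  set (b := dot3 (grad f p) p). 
  assert (Hpp : 0 < dot3 p p) by (rewrite <- norm3_sq; nra).
  set (pp := dot3 p p) in *.
  destruct (Rle_or_lt (b / pp * (norm3 u * norm3 u)) (hess f p u)) as [H|H]; [auto|exfalso].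
  set (eta := b / pp * (norm3 u * norm3 u) - hess f p u) in *.
  assert (Heta : 0 < eta) by (unfold eta; lra).
  pose proof (norm3_ge0 u) as Hnu.
  set (sg := norm3 u * norm3 u / (2 * pp)).
  assert (Hnu0 : 0 < norm3 u).
  { destruct (Rle_lt_or_eq_dec 0 (norm3 u) Hnu) as [E|E]; [auto|exfalso].
    assert (E2 := cauchy_schwarz3_abs (hvec f p u) u). rewrite <- E, Rmult_0_r in E2.
    change (dot3 (hvec f p u) u) with (hess f p u) in E2. apply Rabs_le_between in E2.
    rewrite <- E in H. lra. }
  assert (Hsg : 0 < sg) by (apply Rdiv_lt_0_compat; nra).
  destruct (hess_close f p r (eta / 4 / (norm3 u * norm3 u)) Hf Hr) as [d1 [Hd1 E1]].
  { apply Rdiv_lt_0_compat; nra. }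
  destruct (grad_close f p r [] (eta / 8 / (sg * norm3 p)) Hf Hr) as [d2 [Hd2 E2]].
  { apply Rdiv_lt_0_compat; [lra|]. apply Rmult_lt_0_compat; auto. }
  simpl in E2.
  set (D := Rmin (Rmin d1 d2) r). assert (HD : 0 < D) by (repeat apply Rmin_glb_lt; auto).
  assert (HD1 : D <= d1) by (unfold D; eapply Rle_trans; [apply Rmin_l|apply Rmin_l]).
  assert (HD2 : D <= d2) by (unfold D; eapply Rle_trans; [apply Rmin_l|apply Rmin_r]).
  assert (HD3 : D <= r) by (unfold D; apply Rmin_r).
  set (W := norm3 u + sg * norm3 p + 1).
  assert (HW : 1 < W) by (unfold W; assert (0 < sg * norm3 p) by (apply Rmult_lt_0_compat; auto); lra).
  set (t := Rmin 1 (D / (2 * W))).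
  assert (Ht : 0 < t) by (apply Rmin_glb_lt; [lra|apply Rdiv_lt_0_compat; lra]).
  assert (Ht1 : t <= 1) by apply Rmin_l.
  assert (HtW : t * W < D).
  { assert (t <= D / (2 * W)) by apply Rmin_r. apply Rle_div_r in H0; lra. }
  set (w := scal3 (- (sg * (t * t))) p).
  assert (Hw : norm3 w <= t * (sg * norm3 p)).
  { unfold w. rewrite norm3_scal, Rabs_Ropp, Rabs_pos_eq by (apply Rmult_le_pos; nra).
    replace (t * (sg * norm3 p)) with (sg * (t * 1) * norm3 p) by ring.
    apply Rmult_le_compat_r; [lra|]. apply Rmult_le_compat_l; [lra|]. apply Rmult_le_compat_l; lra. }
  assert (Hline : forall s s', 0 <= s <= 1 -> 0 <= s' <= 1 ->
     dist3 (add3 (add3 p (scal3 s (scal3 t u))) (scal3 s' w)) p < D).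
  { intros s s' Hs Hs'.
    replace (add3 (add3 p (scal3 s (scal3 t u))) (scal3 s' w))
      with (add3 p (add3 (scal3 s (scal3 t u)) (scal3 s' w))) by (unfold w; apply R3_ext; intros []; r3; ring).
    rewrite dist3_add. eapply Rle_lt_trans; [apply norm3_triangle|].
    rewrite !norm3_scal, !Rabs_pos_eq by lra. pose proof (norm3_ge0 w).
    apply Rle_lt_trans with (1 * (t * norm3 u) + 1 * norm3 w); [|unfold W in HtW; nra].
    apply Rplus_le_compat; apply Rmult_le_compat_r; try lra; nra. }
  assert (Hline0 : forall s, 0 <= s <= 1 -> dist3 (add3 p (scal3 s (scal3 t u))) p < D).
  { intros s Hs. specialize (Hline s 0 Hs ltac:(lra)).
    replace (add3 (add3 p (scal3 s (scal3 t u))) (scal3 0 w)) with (add3 p (scal3 s (scal3 t u))) in Hline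
      by (apply R3_ext; intros []; r3; ring). exact Hline. }
  assert (S1 : f (add3 p (scal3 t u)) <= t * t * (hess f p u + eta / 4) / 2).
  { assert (HS := second_order_bounds f p r p (scal3 t u) (t * t * (hess f p u - eta / 4)) (t * t * (hess f p u + eta / 4)) Hf).
    rewrite dot3_scal_r, (Horth u Hu), Hfp in HS.
    assert (t * t * (hess f p u - eta / 4) / 2 <= f (add3 p (scal3 t u)) - 0 - t * 0 <= t * t * (hess f p u + eta / 4) / 2); [|lra].
    apply HS.
    - intros s Hs. unfold ball3. specialize (Hline0 s Hs). lra.
    - intros s Hs. rewrite hess_scal. specialize (E1 (add3 p (scal3 s (scal3 t u))) u ltac:(specialize (Hline0 s Hs); lra)).
      replace (eta / 4 / (norm3 u * norm3 u) * (norm3 u * norm3 u)) with (eta / 4) in E1 by (field; lra).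
      apply Rabs_le_between in E1. split; apply Rmult_le_compat_l; nra. }
  set (q := add3 p (scal3 t u)) in *.
  assert (S2 : f (add3 q w) - f q <= sg * (t * t) * (eta / 8 / sg - b)).
  { assert (HS := first_order_bounds f p r q w (sg * (t * t) * (- (eta / 8 / sg) - b)) (sg * (t * t) * (eta / 8 / sg - b)) Hf).
    apply HS.
    - intros s Hs. specialize (Hline 1 s ltac:(lra) Hs).
      replace (scal3 1 (scal3 t u)) with (scal3 t u) in Hline by (apply R3_ext; intros []; r3; ring).
      fold q in Hline. unfold ball3. lra.
    - intros s Hs. specialize (Hline 1 s ltac:(lra) Hs).
      replace (scal3 1 (scal3 t u)) with (scal3 t u) in Hline by (apply R3_ext; intros []; r3; ring).
      fold q in Hline. set (x := add3 q (scal3 s w)) in *.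
      specialize (E2 x ltac:(lra)).
      assert (E3 : Rabs (dot3 (grad f x) p - b) <= eta / 8 / sg).
      { unfold b. rewrite <- dot3_sub_l. eapply Rle_trans; [apply cauchy_schwarz3_abs|].
        apply Rle_trans with (eta / 8 / (sg * norm3 p) * norm3 p); [apply Rmult_le_compat_r; lra|].
        apply Req_le. field. split; lra. }
      apply Rabs_le_between in E3. unfold w. rewrite dot3_scal_r.
      assert (0 <= sg * (t * t)) by (apply Rmult_le_pos; nra).
      split; [replace (- (sg * (t * t)) * dot3 (grad f x) p) with (sg * (t * t) * - dot3 (grad f x) p) by ring|
        replace (- (sg * (t * t)) * dot3 (grad f x) p) with (sg * (t * t) * - dot3 (grad f x) p) by ring];
      apply Rmult_le_compat_l; lra. }
  assert (Hsb : sg * b = (eta + hess f p u) / 2).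
  { unfold eta, sg. field. lra. }
  replace (sg * (t * t) * (eta / 8 / sg - b)) with (t * t * (eta / 8 - sg * b)) in S2 by (field; lra).
  rewrite Hsb in S2.
  (* The coefficient of [t^2] is at most [(H + eta/4)/2 + eta/8 - (eta + H)/2 = -eta/4], where
     [H = hess f p u]. *)
  assert (Hneg : f (add3 q w) < 0) by (assert (0 < t * t) by nra; nra).
  assert (Hin : O (add3 q w)).
  { apply HO; [|exact Hneg]. specialize (Hline 1 1 ltac:(lra) ltac:(lra)).
    replace (add3 (add3 p (scal3 1 (scal3 t u))) (scal3 1 w)) with (add3 q w) in Hline
      by (unfold q; apply R3_ext; intros []; r3; ring). unfold ball3; lra. }
  apply Hfar in Hin. pose proof (norm3_ge0 (add3 q w)).
  assert (Hle : norm3 (add3 q w) * norm3 (add3 q w) <= norm3 p * norm3 p) by (apply Rmult_le_compat; auto).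
  rewrite !norm3_sq in Hle.
  assert (Hexp : dot3 (add3 q w) (add3 q w)
     = pp - 2 * (sg * (t * t)) * pp + (sg * (t * t)) * (sg * (t * t)) * pp + t * t * dot3 u u
       + 2 * t * (1 - sg * (t * t)) * dot3 u p).
  { unfold q, w, pp. clear. r3. ring. }
  rewrite Hexp, Hu, <- (norm3_sq u) in Hle. fold pp in Hle.
  (* The choice of [sg] cancels the terms of order [t^2]; the remainder [(sg t^2)^2 |p|^2] puts the
     point strictly outside the sphere. *)
  assert (Hs2 : 2 * (sg * (t * t)) * pp = t * t * (norm3 u * norm3 u)) by (unfold sg; field; lra).
  rewrite Hs2 in Hle.
  assert (0 < sg * (t * t)) by (apply Rmult_lt_0_compat; nra).
  assert (0 < sg * (t * t) * (sg * (t * t)) * pp) by (apply Rmult_lt_0_compat; [apply Rmult_lt_0_compat|]; assumption).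
  lra.
Qed.

(** What the construction retains of the domain near [p]. The field [m], the gradient up to sign, is
    normal to the level sets of [f] and avoids the half-axis where spinors break down. Along [nu]
    the function grows at rate [k], which produces points outside [O]; [c] and [C] bound its
    quadratic growth along tangent planes. *)
Record convex_cap (O : R3 -> Prop) (p : R3) (f : R3 -> R) (m : R3 -> R3) (nu : R3)
    (R1 L c C k : R) : Prop := {
  cap_R : 0 < R1; cap_L : 0 < L; cap_c : 0 < c; cap_C : 0 < C; cap_k : 0 < k;
  cap_nu : norm3 nu = 1;
  cap_p : f p = 0;
  cap_O : forall y, dist3 y p <= R1 -> (O y <-> f y < 0);
  cap_lip : forall y y', dist3 y p <= R1 -> dist3 y' p <= R1 -> Rabs (f y' - f y) <= L * dist3 y' y;
  cap_cont : forall i y, dist3 y p <= R1 -> cont3 (fun x => coord i (m x)) y;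
  cap_pos : forall y, dist3 y p <= R1 -> 0 < norm3 (m y) + c3 (m y);
  cap_quad : forall y v, dist3 y p <= R1 -> dist3 (add3 y v) p <= R1 -> dot3 v (m y) = 0 ->
    c * (norm3 v * norm3 v) <= f (add3 y v) - f y <= C * (norm3 v * norm3 v);
  cap_exit : forall y t, 0 <= t -> dist3 y p <= R1 -> dist3 (add3 y (scal3 t nu)) p <= R1 ->
    k * t <= f (add3 y (scal3 t nu)) - f y }.

Lemma segment_in_ball p R y v t : dist3 y p <= R -> dist3 (add3 y v) p <= R -> 0 <= t <= 1 ->
  dist3 (add3 y (scal3 t v)) p <= R.
Proof.
  intros H1 H2 Ht. unfold dist3 in *.
  replace (sub3 (add3 y (scal3 t v)) p) with (add3 (scal3 (1 - t) (sub3 y p)) (scal3 t (sub3 (add3 y v) p)))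
    by (apply R3_ext; intros []; r3; ring).
  eapply Rle_trans; [apply norm3_triangle|]. rewrite !norm3_scal, !Rabs_pos_eq by lra. nra.
Qed.

(** The form is expanded bilinearly and every term containing [w] is bounded through [M]. It serves
    for vectors tangent to a nearby level set, [w] being their small component along [p]. *)
Lemma hess_tangential_lower f p c M v w : 0 <= c -> 0 <= M ->
  (forall u, norm3 (hvec f p u) <= M * norm3 u) ->
  dot3 w v = 0 -> c * (norm3 v * norm3 v) <= hess f p v ->
  c * (norm3 v * norm3 v) - 2 * M * norm3 v * norm3 w - M * norm3 w * norm3 w <= hess f p (add3 v w).
Proof.
  intros Hc HM Hb Hwv Hv.
  assert (E : hess f p (add3 v w) = hess f p v + dot3 (hvec f p v) w + dot3 (hvec f p w) v + dot3 (hvec f p w) w).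
  { change (hess f p (add3 v w)) with (dot3 (hvec f p (add3 v w)) (add3 v w)).
    replace (hvec f p (add3 v w)) with (add3 (hvec f p v) (hvec f p w)).
    2:{ unfold hvec, vec. rewrite !dot3_add_r. reflexivity. }
    rewrite !dot3_add_l, !dot3_add_r. change (hess f p v) with (dot3 (hvec f p v) v). ring. }
  rewrite E.
  pose proof (norm3_ge0 v); pose proof (norm3_ge0 w).
  assert (T : forall a b, - (M * norm3 a * norm3 b) <= dot3 (hvec f p a) b).
  { intros a b. pose proof (cauchy_schwarz3_abs (hvec f p a) b) as H1. apply Rabs_le_between in H1.
    pose proof (norm3_ge0 b). assert (norm3 (hvec f p a) * norm3 b <= M * norm3 a * norm3 b)
      by (apply Rmult_le_compat_r; auto). lra. }
  pose proof (T v w); pose proof (T w v); pose proof (T w w). lra.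
Qed.

(** At the farthest point the gradient is a positive multiple of [p] and the Hessian is positive on
    the plane orthogonal to [p]; the ball is then shrunk until gradient and Hessian vary little. *)
Lemma exists_convex_cap O : bounded_domain O -> smooth_boundary O ->
  exists p f m nu R1 L c C k, convex_cap O p f m nu R1 L c C k.
Proof.
  intros HO Hsm. destruct (farthest_point O HO) as [p [Hbp [Hp Hfar]]].
  destruct (Hsm p Hbp) as [r [f [Hr [Hf [HOf Hg]]]]].
  assert (Hpp : ball3 p r p) by (unfold ball3; rewrite dist3_refl; auto).
  assert (Hfp0 : f p = 0) by (apply (defining_function_boundary O p f r); auto).
  assert (Hg0 : grad f p <> mk3 0 0 0).
  { intros Eg. assert (Ei : forall i, part3 i f p = 0).
    { intros i. apply (f_equal (coord i)) in Eg. destruct i; exact Eg. }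
    destruct (Hg p Hpp Hfp0) as [H|[H|H]]; apply H, Ei. }
  destruct (farthest_gradient O p f r) as [Hb Horth]; auto.
  pose proof (farthest_hessian O p f r Hf Hr Hp Hfp0 Hfar HOf Horth) as Hhess.
  assert (Hppd : dot3 p p = norm3 p * norm3 p) by (rewrite norm3_sq; auto).
  set (b := dot3 (grad f p) p) in *. set (n := norm3 p) in *.
  assert (Hpp0 : 0 < dot3 p p) by (rewrite Hppd; nra).
  set (c0 := b / dot3 p p) in *.
  assert (Hc0 : 0 < c0) by (apply Rdiv_lt_0_compat; auto).
  set (ka := b / n). assert (Hka : 0 < ka) by (apply Rdiv_lt_0_compat; auto).
  set (G := grad f p) in *.
  assert (HGk : ka <= norm3 G).
  { unfold ka. apply Rle_div_l; auto. unfold b, n. apply cauchy_schwarz3. }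
  set (M := 2 * (norm3 (grad (part3 X1 f) p) + norm3 (grad (part3 X2 f) p) + norm3 (grad (part3 X3 f) p))).
  pose proof (norm3_ge0 (grad (part3 X1 f) p)) as Q1. pose proof (norm3_ge0 (grad (part3 X2 f) p)) as Q2.
  pose proof (norm3_ge0 (grad (part3 X3 f) p)) as Q3.
  assert (HM : 0 <= M) by (unfold M; lra).
  assert (HMb : forall u, norm3 (hvec f p u) <= M * norm3 u).
  { intros u. pose proof (norm3_ge0 u). unfold M. rewrite Rmult_assoc. apply norm3_le_coords.
    assert (T : forall a, norm3 a <= norm3 (grad (part3 X1 f) p) + norm3 (grad (part3 X2 f) p) + norm3 (grad (part3 X3 f) p) ->
      Rabs (dot3 a u) <= (norm3 (grad (part3 X1 f) p) + norm3 (grad (part3 X2 f) p) + norm3 (grad (part3 X3 f) p)) * norm3 u).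
    { intros a Ha. eapply Rle_trans; [apply cauchy_schwarz3_abs|]. apply Rmult_le_compat_r; auto. }
    intros []; unfold coord, hvec, vec, mk3, c1, c2, c3; cbn [fst snd]; apply T; lra. }
  (* A vector tangent to a nearby level set has a component along [p] of size at most [e1 |v|]; as
     [e1 (c0 + 3M) = c0/4], this lowers the Hessian bound at [p] from [c0] to [3 c0/4]. *)
  set (e1 := c0 / (4 * (c0 + 3 * M))).
  assert (He1 : 0 < e1) by (apply Rdiv_lt_0_compat; lra).
  assert (He1a : e1 * (c0 + 3 * M) = c0 / 4) by (unfold e1; field; lra).
  assert (He1b : e1 <= 1).
  { apply Rmult_le_reg_r with (c0 + 3 * M); lra. }
  set (e := Rmin (e1 * ka) (ka / 4)).
  assert (He : 0 < e) by (apply Rmin_glb_lt; [apply Rmult_lt_0_compat; auto|lra]).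
  assert (Hea : e <= e1 * ka) by apply Rmin_l. assert (Heb : e <= ka / 4) by apply Rmin_r.
  destruct (grad_close f p r [] e Hf Hr He) as [d1 [Hd1 E1]]. simpl in E1. fold G in E1.
  destruct (hess_close f p r (c0 / 4) Hf Hr ltac:(lra)) as [d2 [Hd2 E2]].
  set (D := Rmin (Rmin d1 d2) r). assert (HD : 0 < D) by (repeat apply Rmin_glb_lt; auto).
  assert (HD1 : D <= d1) by (unfold D; eapply Rle_trans; [apply Rmin_l|apply Rmin_l]).
  assert (HD2 : D <= d2) by (unfold D; eapply Rle_trans; [apply Rmin_l|apply Rmin_r]).
  assert (HD3 : D <= r) by (unfold D; apply Rmin_r).
  (* Both signs of the gradient are normal; the one with nonnegative third component at [p] stays
     away from the negative third axis on the whole cap. *)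
  assert (Hs : exists s, Rabs s = 1 /\ 0 <= s * c3 G).
  { destruct (Rle_or_lt 0 (c3 G)); [exists 1|exists (-1)]; split; try lra.
    - apply Rabs_R1.
    - rewrite Rabs_left; lra. }
  destruct Hs as [s [Hs1 Hs3]].
  assert (Hs0 : s <> 0) by (intros E; rewrite E, Rabs_R0 in Hs1; lra).
  assert (Hgl : forall x, dist3 x p <= D / 2 -> norm3 (sub3 (grad f x) G) <= e) by (intros x Hx; apply E1; lra).
  assert (Hgnorm : forall x, dist3 x p <= D / 2 -> norm3 (grad f x) <= norm3 G + ka /\ norm3 G - e <= norm3 (grad f x)).
  { intros x Hx. specialize (Hgl x Hx). pose proof (norm3_dist_le (grad f x) G) as A1.
    pose proof (norm3_dist_le G (grad f x)) as A2. rewrite dist3_sym in A2. unfold dist3 in A1, A2. lra. }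
  (* Away from [p] the Hessian loses another [c0/4], and the factor 1/2 of Taylor's formula turns
     [c0/2] into [c0/4]. The derivative along [p/|p|] is [ka] at [p] and varies by at most
     [ka/4]. *)
  exists p, f, (fun x => scal3 s (grad f x)), (scal3 (/ n) p), (D / 2), (norm3 G + ka), (c0 / 4), (M + c0), (ka / 2).
  assert (Hin : forall x, dist3 x p <= D / 2 -> ball3 p r x) by (intros x Hx; unfold ball3; lra).
  split; try lra.
  - rewrite norm3_scal, Rabs_pos_eq by (left; apply Rinv_0_lt_compat; auto). fold n. field; lra.
  - intros y Hy. apply HOf, Hin, Hy.
  - intros y y' Hy Hy'. set (v := sub3 y' y).
    assert (Ey : y' = add3 y v) by (unfold v; apply R3_ext; intros []; r3; ring).
    change (dist3 y' y) with (norm3 v). rewrite Ey.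
    rewrite Ey in Hy'. pose proof (norm3_ge0 v).
    assert (HS := first_order_bounds f p r y v (- ((norm3 G + ka) * norm3 v)) ((norm3 G + ka) * norm3 v) Hf).
    apply Rabs_le. apply HS.
    + intros t Ht. apply Hin, segment_in_ball; auto.
    + intros t Ht. apply Rabs_le_between. eapply Rle_trans; [apply cauchy_schwarz3_abs|].
      apply Rmult_le_compat_r; auto. apply Hgnorm, segment_in_ball; auto.
  - intros i y Hy e' He'. destruct (Cinf3_cont p r f [i] y Hf (Hin y Hy) e' He') as [d [Hd Hc]].
    exists d; split; auto. intros x Hx. specialize (Hc x Hx). simpl in Hc.
    replace (coord i (scal3 s (grad f x)) - coord i (scal3 s (grad f y))) with (s * (part3 i f x - part3 i f y)).
    + rewrite Rabs_mult, Hs1. lra.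
    + unfold grad, vec.
      destruct i; unfold coord, scal3, mk3, c1, c2, c3; cbn [fst snd]; ring.
  - intros y Hy. destruct (Hgnorm y Hy) as [_ H]. rewrite norm3_scal, Hs1.
    specialize (Hgl y Hy). pose proof (coord_le_norm3 X3 (sub3 (grad f y) G)) as H2.
    assert (Ec : c3 (scal3 s (grad f y)) = s * c3 G + s * coord X3 (sub3 (grad f y) G)).
    { generalize (grad f y). intros g. r3. ring. }
    rewrite Ec. assert (H3 : Rabs (s * coord X3 (sub3 (grad f y) G)) <= e) by (rewrite Rabs_mult, Hs1; lra).
    apply Rabs_le_between in H3. lra.
  - intros y v Hy Hyv Hv. rewrite dot3_scal_r in Hv.
    assert (Hv0 : dot3 (grad f y) v = 0).
    { rewrite dot3_comm. apply Rmult_integral in Hv. tauto. }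
    set (nv := norm3 v). assert (Hnv : 0 <= nv) by apply norm3_ge0.
    set (sv := dot3 v p / dot3 p p). set (w := scal3 sv p). set (vT := add3 v (scal3 (-1) w)).
    assert (HvT : dot3 vT p = 0).
    { unfold vT, w. rewrite dot3_add_l, !dot3_scal_l. unfold sv. field. lra. }
    assert (Hsum : add3 vT w = v) by (unfold vT; apply R3_ext; intros []; r3; ring).
    assert (HwvT : dot3 w vT = 0) by (unfold w; rewrite dot3_scal_l, dot3_comm, HvT; ring).
    assert (Hw : norm3 w <= e1 * nv).
    { assert (HG : dot3 G v = sv * b).
      { rewrite <- Hsum, dot3_add_r, (Horth vT HvT). unfold w. rewrite dot3_scal_r. fold b. ring. }
      assert (HG2 : Rabs (dot3 G v) <= e * nv).
      { replace (dot3 G v) with (- dot3 (sub3 (grad f y) G) v) by (rewrite dot3_sub_l, Hv0; ring).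
        rewrite Rabs_Ropp. eapply Rle_trans; [apply cauchy_schwarz3_abs|]. apply Rmult_le_compat_r; auto. }
      rewrite HG, Rabs_mult, (Rabs_pos_eq b) in HG2 by lra.
      unfold w. rewrite norm3_scal. fold n.
      apply Rmult_le_reg_r with ka; [auto|].
      replace (Rabs sv * n * ka) with (Rabs sv * b) by (unfold ka; field; lra).
      eapply Rle_trans; [exact HG2|]. replace (e1 * nv * ka) with (e1 * ka * nv) by ring.
      apply Rmult_le_compat_r; auto. }
    assert (Hpyth : nv * nv = norm3 vT * norm3 vT + norm3 w * norm3 w).
    { unfold nv. rewrite <- Hsum at 1 2. rewrite !norm3_sq. apply dot3_add_orth; auto. }
    pose proof (norm3_ge0 vT) as HnT. pose proof (norm3_ge0 w) as Hnw.
    assert (HTv : norm3 vT <= nv) by nra.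
    assert (Hlow : 3 * c0 / 4 * (nv * nv) <= hess f p v).
    { rewrite <- Hsum at 1. eapply Rle_trans; [|apply (hess_tangential_lower f p c0 M vT w); auto; lra].
      assert (norm3 w * norm3 w <= e1 * nv * nv) by (apply Rle_trans with (e1 * nv * (e1 * nv)); [nra|]; 
        assert (0 <= e1 * (nv * nv)) by nra; nra).
      assert (norm3 vT * norm3 w <= nv * (e1 * nv)) by (apply Rmult_le_compat; auto).
      assert (T1 : c0 * (norm3 vT * norm3 vT) >= c0 * (nv * nv) - c0 * (e1 * nv * nv)) by nra.
      assert (T2 : M * (norm3 vT * norm3 w) <= M * (nv * (e1 * nv))) by (apply Rmult_le_compat_l; auto).
      assert (T3 : M * (norm3 w * norm3 w) <= M * (e1 * nv * nv)) by (apply Rmult_le_compat_l; auto).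
      assert (T4 : c0 * (e1 * nv * nv) + 2 * (M * (nv * (e1 * nv))) + M * (e1 * nv * nv) = c0 / 4 * (nv * nv)).
      { rewrite <- He1a. ring. }
      lra. }
    assert (Hup : hess f p v <= M * (nv * nv)).
    { change (hess f p v) with (dot3 (hvec f p v) v). eapply Rle_trans; [apply cauchy_schwarz3|].
      fold nv. rewrite <- Rmult_assoc. apply Rmult_le_compat_r; auto. }
    assert (HS := second_order_bounds f p r y v (c0 / 2 * (nv * nv)) ((M + c0) * (nv * nv)) Hf).
    rewrite Hv0 in HS.
    assert (c0 / 2 * (nv * nv) / 2 <= f (add3 y v) - f y - 0 <= (M + c0) * (nv * nv) / 2).
    { apply HS.
      - intros t Ht. apply Hin, segment_in_ball; auto.
      - intros t Ht. pose proof (segment_in_ball p (D / 2) y v t Hy Hyv Ht) as Hd.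
        specialize (E2 (add3 y (scal3 t v)) v ltac:(lra)). fold nv in E2. apply Rabs_le_between in E2.
        assert (0 <= c0 * (nv * nv)) by nra. lra. }
    assert (0 <= (M + c0) * (nv * nv)) by nra. lra.
  - intros y t Ht Hy Hyt.
    assert (HS := first_order_bounds f p r y (scal3 t (scal3 (/ n) p)) (ka / 2 * t) ((norm3 G + ka) * t) Hf).
    apply HS.
    + intros u Hu. apply Hin, segment_in_ball; auto.
    + intros u Hu. set (x := add3 y (scal3 u (scal3 t (scal3 (/ n) p)))).
      assert (Hx : dist3 x p <= D / 2) by (apply segment_in_ball; auto).
      rewrite dot3_scal_r. 
      assert (Hn1 : norm3 (scal3 (/ n) p) = 1).
      { rewrite norm3_scal, Rabs_pos_eq by (left; apply Rinv_0_lt_compat; auto). fold n. field; lra. }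
      assert (H1 : dot3 (grad f x) (scal3 (/ n) p) <= norm3 G + ka).
      { eapply Rle_trans; [apply cauchy_schwarz3|]. rewrite Hn1, Rmult_1_r. apply Hgnorm, Hx. }
      assert (H2 : ka / 2 <= dot3 (grad f x) (scal3 (/ n) p)).
      { assert (E : dot3 (grad f x) (scal3 (/ n) p) = ka + dot3 (sub3 (grad f x) G) (scal3 (/ n) p)).
        { rewrite dot3_sub_l, (dot3_scal_r (/ n) G p). fold b. unfold ka. field. lra. }
        pose proof (cauchy_schwarz3_abs (sub3 (grad f x) G) (scal3 (/ n) p)) as H3.
        rewrite Hn1, Rmult_1_r in H3. specialize (Hgl x Hx). apply Rabs_le_between in H3. lra. }
      split; nra.
Qed.

(** * Approaching the boundary *)

(* [K * sqrt a] bounds the sum of all later displacements: each is [O(sqrt a)] and [a] decays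
   geometrically. *)
Record good (p : R3) (f : R3 -> R) (K R1 : R) (P Q : list C) (F : dir3 -> list C) (a rho : R) : Prop := {
  good_stage : stage P Q F; good_a : 0 < a; good_rho : 0 < rho < 1;
  good_ball : forall z, Cmod z <= 1 -> dist3 (Xmap F z) p + K * sqrt a <= R1;
  good_neg : forall z, Cmod z <= 1 -> f (Xmap F z) < 0;
  good_circle : forall z, circle z -> - a <= f (Xmap F z);
  good_annulus : forall z, rho <= Cmod z <= 1 -> - (2 * a) <= f (Xmap F z) }.

Lemma cap_comp_lipschitz O p f m nu R1 L c C k F : convex_cap O p f m nu R1 L c C k ->
  (forall z, Cmod z <= 1 -> dist3 (Xmap F z) p <= R1) ->
  exists M, 0 < M /\ forall z w, Cmod z <= 1 -> Cmod w <= 1 ->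
    Rabs (f (Xmap F z) - f (Xmap F w)) <= M * Cmod (z - w).
Proof.
  intros Hcap Hb. destruct (Xmap_lipschitz F) as [M [HM HL]].
  pose proof (cap_L _ _ _ _ _ _ _ _ _ _ Hcap) as HL0.
  exists (L * M). split; [apply Rmult_lt_0_compat; auto|]. intros z w Hz Hw.
  eapply Rle_trans; [apply (cap_lip _ _ _ _ _ _ _ _ _ _ Hcap); auto|].
  rewrite Rmult_assoc. apply Rmult_le_compat_l; [lra|auto].
Qed.

Lemma cont3_comp_Xmap g F S : (forall z, S z -> Cmod z <= 1) -> (forall z, S z -> cont3 g (Xmap F z)) ->
  cont_on S (fun z => g (Xmap F z)).
Proof.
  intros HS Hg z Hz e He. destruct (Hg z Hz e He) as [d [Hd H]].
  destruct (Xmap_lipschitz F) as [M [HM HL]].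
  exists (d / M). split; [apply Rdiv_lt_0_compat; auto|]. intros w Hw Hd'. apply H.
  eapply Rle_lt_trans; [apply HL; auto|]. apply Rlt_div_r in Hd'; [lra|auto].
Qed.

(** [complete_step] comes first, with negligible displacement, then [push] with squared radius
    [-f/(2C)]. Up to errors, [f] rises by at most [C r^2 = -f/2], so the surface stays inside, and
    on the circle by at least [c r^2], so [-f] shrinks by the factor [1 - c/(2C)]; the larger [ga]
    absorbs the errors. Since [r <= sqrt a / sqrt C], the condition on [K (1 - sqrt ga)] makes the
    displacement fit into the decrease of the budget [K sqrt a]. *)
Lemma main_step O p f m nu R1 L c C k K ga : convex_cap O p f m nu R1 L c C k ->
  c <= C -> 1 - c / (2 * C) < ga < 1 -> / sqrt C + 1 <= K * (1 - sqrt ga) -> / sqrt C + 1 <= K ->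
  forall P Q F a rho d, good p f K R1 P Q F a rho -> 0 < d ->
  exists P' Q' F' rho' tol, good p f K R1 P' Q' F' (ga * a) rho' /\ near_on rho d F F' /\
    rho < rho' /\ 1 - rho' <= (1 - rho) / 2 /\ 0 < tol /\
    (exists l, 1 <= l /\ barrier (fun z => speed F' z - tol) rho rho' l) /\
    forall z, rho <= Cmod z <= 1 -> - (3 * a) <= f (Xmap F' z).
Proof.
  intros Hcap HcC Hga HK HK0 P Q F a rho d Hgood Hd.
  destruct Hcap as [HR1 HL Hc HC Hk Hnu Hfp HO Hlip Hcont Hpos Hquad Hexit] eqn:Ecap.
  destruct Hgood as [HS Ha Hrho Hball Hneg Hcirc Hann].
  assert (HsC : 0 < sqrt C) by (apply sqrt_lt_R0; auto).
  assert (Hsa : 0 < sqrt a) by (apply sqrt_lt_R0; auto).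
  assert (HiC : 0 < / sqrt C) by (apply Rinv_0_lt_compat; auto).
  assert (HKa : sqrt a * (/ sqrt C + 1) <= K * sqrt a) by nra.
  assert (HinF : forall z, Cmod z <= 1 -> dist3 (Xmap F z) p <= R1).
  { intros z Hz. specialize (Hball z Hz). nra. }
  destruct (cap_comp_lipschitz O p f m nu R1 L c C k F Hcap HinF) as [MF [HMF HLF]].
  destruct (cont_on_min (fun z => 0 <= Cmod z <= 1) (fun z => - f (Xmap F z)) (compact2_annulus 0 1)) as [be [Hbe Hbe2]].
  { apply (cont_on_of_lipschitz _ _ MF HMF). intros z w Hz Hw.
    replace (- f (Xmap F w) - - f (Xmap F z)) with (f (Xmap F z) - f (Xmap F w)) by ring.
    rewrite (Cmod_sub_sym w). apply HLF; lra. }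
  { intros z Hz. specialize (Hneg z ltac:(lra)). lra. }
  assert (Hbeta : forall z, Cmod z <= 1 -> f (Xmap F z) <= - be).
  { intros z Hz. specialize (Hbe2 z ltac:(split; [apply Cmod_ge_0|auto])). lra. }
  set (g' := 1 - c / (2 * C)) in *.
  assert (Hg' : 0 <= g').
  { unfold g'. assert (c / (2 * C) <= 1) by (apply Rle_div_l; lra). lra. }
  assert (Hg'1 : g' < 1) by lra.
  (* In order: half of the closeness [d]; three such errors fit into [sqrt a]; [f] stays negative;
     [-f] stays below [2a] on the circle before the push; the contraction on the circle stays below
     [ga]. *)
  set (e := Rmin (Rmin (d / 2) (sqrt a / 3)) (Rmin (be / (8 * L)) (Rmin (a / (4 * L)) ((ga - g') * a / (4 * L))))).
  assert (He : 0 < e).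
  { unfold e; repeat apply Rmin_glb_lt; try lra; apply Rdiv_lt_0_compat; try lra.
    apply Rmult_lt_0_compat; lra. }
  assert (He1 : e <= d / 2) by (unfold e; eapply Rle_trans; [apply Rmin_l|apply Rmin_l]).
  assert (He2 : e <= sqrt a / 3) by (unfold e; eapply Rle_trans; [apply Rmin_l|apply Rmin_r]).
  assert (He3 : L * e <= be / 8).
  { assert (H : e <= be / (8 * L)) by (unfold e; eapply Rle_trans; [apply Rmin_r|apply Rmin_l]).
    apply Rle_div_r in H; lra. }
  assert (He4 : L * e <= a / 4).
  { assert (H : e <= a / (4 * L)) by (unfold e; eapply Rle_trans; [apply Rmin_r|eapply Rle_trans; [apply Rmin_r|apply Rmin_l]]).
    apply Rle_div_r in H; lra. }
  assert (He5 : L * e <= (ga - g') * a / 4).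
  { assert (H : e <= (ga - g') * a / (4 * L)) by (unfold e; eapply Rle_trans; [apply Rmin_r|eapply Rle_trans; [apply Rmin_r|apply Rmin_r]]).
    apply Rle_div_r in H; lra. }
  destruct (complete_step P Q F rho e HS Hrho He) as [P1 [Q1 [F1 [b [tol1 [l [HS1 [Hn1 [Hd1 [Hb [Ht1 [Hl Hbar]]]]]]]]]]]].
  assert (Hin1 : forall z, Cmod z <= 1 -> dist3 (Xmap F1 z) p <= R1 - K * sqrt a + e).
  { intros z Hz. specialize (Hball z Hz). specialize (Hd1 z Hz).
    pose proof (dist3_triangle (Xmap F1 z) (Xmap F z) p). lra. }
  assert (Hin1' : forall z, Cmod z <= 1 -> dist3 (Xmap F1 z) p <= R1).
  { intros z Hz. specialize (Hin1 z Hz). nra. }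
  assert (Hf1 : forall z, Cmod z <= 1 -> f (Xmap F z) - L * e <= f (Xmap F1 z) <= f (Xmap F z) + L * e).
  { intros z Hz. pose proof (Hlip (Xmap F z) (Xmap F1 z) (HinF z Hz) (Hin1' z Hz)) as H.
    specialize (Hd1 z Hz). apply Rabs_le_between in H.
    assert (L * dist3 (Xmap F1 z) (Xmap F z) <= L * e) by (apply Rmult_le_compat_l; lra). lra. }
  set (r := fun x => sqrt (- f (Xmap F1 x) / (2 * C))).
  assert (Hrr : forall x, circle x -> r x * r x = - f (Xmap F1 x) / (2 * C) /\ r x <= sqrt a * / sqrt C /\ 0 <= r x).
  { intros x Hx. assert (Hx1 : Cmod x <= 1) by (unfold circle in Hx; lra).
    specialize (Hf1 x Hx1). specialize (Hbeta x Hx1). specialize (Hcirc x Hx).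
    split; [|split; [|apply sqrt_pos]].
    - apply sqrt_sqrt. apply Rdiv_le_0_compat; lra.
    - unfold r. rewrite <- sqrt_inv, <- sqrt_mult by (try lra; left; apply Rinv_0_lt_compat; auto).
      apply sqrt_le_1_alt. unfold Rdiv. rewrite Rinv_mult, <- Rmult_assoc.
      apply Rmult_le_compat_r; [left; apply Rinv_0_lt_compat; auto|]. lra. }
  set (r0 := sqrt (be / 2 / (2 * C))).
  assert (Hr0 : 0 < r0) by (apply sqrt_lt_R0, Rdiv_lt_0_compat; lra).
  (* The push needs its own precision, as it must not use up the reserve [tol1] of the barrier just
     built. *)
  set (q := Rmin e (tol1 / 8)).
  assert (Hq : 0 < q) by (apply Rmin_glb_lt; lra).
  assert (Hqe : q <= e) by apply Rmin_l. assert (Hqt : q <= tol1 / 8) by apply Rmin_r.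
  destruct (push P1 Q1 F1 (fun x => m (Xmap F1 x)) r r0 b q HS1) as
    [P2 [Q2 [D [HS2 [HD [Hz2q [Hc2q _]]]]]]]; auto.
  { intros i. apply (cont3_comp_Xmap (fun y => coord i (m y))); intros z Hz; unfold circle in Hz; [lra|].
    apply Hcont, Hin1'; lra. }
  { unfold r. apply cont_on_sqrt.
    - destruct (cap_comp_lipschitz O p f m nu R1 L c C k F1 Hcap Hin1') as [M1 [HM1 HL1]].
      unfold Rdiv. apply cont_on_mult; [|apply cont_on_const].
      apply (cont_on_of_lipschitz _ _ M1 HM1). intros z w Hz Hw. unfold circle in *.
      replace (- f (Xmap F1 w) - - f (Xmap F1 z)) with (f (Xmap F1 z) - f (Xmap F1 w)) by ring.
      rewrite (Cmod_sub_sym w). apply HL1; lra.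
    - intros x Hx. assert (Hx1 : Cmod x <= 1) by (unfold circle in Hx; lra).
      specialize (Hf1 x Hx1). specialize (Hbeta x Hx1). apply Rdiv_le_0_compat; lra. }
  { intros x Hx. apply Hpos, Hin1'. unfold circle in Hx; lra. }
  { intros x Hx. assert (Hx1 : Cmod x <= 1) by (unfold circle in Hx; lra).
    specialize (Hf1 x Hx1). specialize (Hbeta x Hx1). unfold r0, r. apply sqrt_le_1_alt.
    unfold Rdiv. apply Rmult_le_compat_r; [left; apply Rinv_0_lt_compat; lra|]. lra. }
  { lra. }
  set (F2 := fun i => padd (F1 i) (D i)) in *.
  assert (Hn2 : near_on b q F1 F2) by (exists D; intros i; destruct (HD i); repeat split; auto).
  assert (Hz2 : forall z, Cmod z <= 1 -> dist3 (Xmap F2 z) (Xmap F1 z) <= e \/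
     exists x v, circle x /\ dist3 (Xmap F1 x) (Xmap F1 z) <= e /\
       dot3 v (m (Xmap F1 x)) = 0 /\ norm3 v <= r x /\ dist3 (Xmap F2 z) (add3 (Xmap F1 x) v) <= e).
  { intros z Hz. destruct (Hz2q z Hz) as [H|[x [v [Hx [_ [HXx [Hort [Hv Hdv]]]]]]]]; [left; lra|right].
    exists x, v. repeat split; auto; lra. }
  assert (Hc2 : forall x, circle x -> exists v, dot3 v (m (Xmap F1 x)) = 0 /\ norm3 v = r x /\
         dist3 (Xmap F2 x) (add3 (Xmap F1 x) v) <= e).
  { intros x Hx. destruct (Hc2q x Hx) as [v [Hort [Hv Hdv]]]. exists v. repeat split; auto; lra. }
  assert (Hyv : forall x v, circle x -> norm3 v <= r x -> dist3 (add3 (Xmap F1 x) v) p <= R1).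
  { intros x v Hx Hv. assert (Hx1 : Cmod x <= 1) by (unfold circle in Hx; lra).
    specialize (Hin1 x Hx1). destruct (Hrr x Hx) as [_ [Hr1 _]].
    pose proof (dist3_triangle (add3 (Xmap F1 x) v) (Xmap F1 x) p) as H. rewrite dist3_add in H. nra. }
  assert (Hdisp : forall z, Cmod z <= 1 -> dist3 (Xmap F2 z) (Xmap F z) <= sqrt a * (/ sqrt C + 1)).
  { intros z Hz. specialize (Hd1 z Hz) as Hd1z. destruct (Hz2 z Hz) as [H|[x [v [Hx [HXx [Hort [Hv Hdv]]]]]]].
    - pose proof (dist3_triangle (Xmap F2 z) (Xmap F1 z) (Xmap F z)). nra.
    - destruct (Hrr x Hx) as [_ [Hr1 _]].
      pose proof (dist3_triangle (Xmap F2 z) (add3 (Xmap F1 x) v) (Xmap F z)).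
      pose proof (dist3_triangle (add3 (Xmap F1 x) v) (Xmap F1 x) (Xmap F z)) as H2. rewrite dist3_add in H2.
      pose proof (dist3_triangle (Xmap F1 x) (Xmap F1 z) (Xmap F z)). nra. }
  assert (Hin2 : forall z, Cmod z <= 1 -> dist3 (Xmap F2 z) p <= R1).
  { intros z Hz. specialize (Hdisp z Hz). specialize (Hball z Hz).
    pose proof (dist3_triangle (Xmap F2 z) (Xmap F z) p). lra. }
  assert (Hcase : forall z, Cmod z <= 1 -> f (Xmap F2 z) < 0 /\
     (f (Xmap F z) - 2 * (L * e) <= f (Xmap F2 z) \/ - a - 2 * (L * e) <= f (Xmap F2 z))).
  { intros z Hz. specialize (Hbeta z Hz) as Hbz. specialize (Hf1 z Hz) as Hf1z.
    destruct (Hz2 z Hz) as [H|[x [v [Hx [HXx [Hort [Hv Hdv]]]]]]].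
    - pose proof (Hlip (Xmap F1 z) (Xmap F2 z) (Hin1' z Hz) (Hin2 z Hz)) as HL2.
      assert (L * dist3 (Xmap F2 z) (Xmap F1 z) <= L * e) by (apply Rmult_le_compat_l; lra).
      apply Rabs_le_between in HL2. lra.
    - assert (Hx1 : Cmod x <= 1) by (unfold circle in Hx; lra).
      pose proof (Hyv x v Hx Hv) as Hin3.
      pose proof (Hquad (Xmap F1 x) v (Hin1' x Hx1) Hin3 Hort) as HQ.
      pose proof (Hlip (add3 (Xmap F1 x) v) (Xmap F2 z) Hin3 (Hin2 z Hz)) as HL2.
      assert (L * dist3 (Xmap F2 z) (add3 (Xmap F1 x) v) <= L * e) by (apply Rmult_le_compat_l; lra).
      apply Rabs_le_between in HL2. destruct (Hrr x Hx) as [Hr2 [_ Hr3]].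
      specialize (Hf1 x Hx1). specialize (Hbeta x Hx1). specialize (Hcirc x Hx).
      pose proof (norm3_ge0 v).
      assert (Hvv : norm3 v * norm3 v <= - f (Xmap F1 x) / (2 * C)) by (rewrite <- Hr2; apply Rmult_le_compat; auto).
      assert (C * (norm3 v * norm3 v) <= - f (Xmap F1 x) / 2).
      { apply Rle_trans with (C * (- f (Xmap F1 x) / (2 * C))); [apply Rmult_le_compat_l; lra|].
        apply Req_le; field; lra. }
      assert (0 <= c * (norm3 v * norm3 v)) by (apply Rmult_le_pos; nra).
      split; [|right]; lra. }
  assert (Hcirc2 : forall x, circle x -> - (ga * a) <= f (Xmap F2 x)).
  { intros x Hx. assert (Hx1 : Cmod x <= 1) by (unfold circle in Hx; lra).
    destruct (Hc2 x Hx) as [v [Hort [Hv Hdv]]].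
    pose proof (Hyv x v Hx ltac:(lra)) as Hin3.
    pose proof (Hquad (Xmap F1 x) v (Hin1' x Hx1) Hin3 Hort) as HQ.
    pose proof (Hlip (add3 (Xmap F1 x) v) (Xmap F2 x) Hin3 (Hin2 x Hx1)) as HL2.
    assert (L * dist3 (Xmap F2 x) (add3 (Xmap F1 x) v) <= L * e) by (apply Rmult_le_compat_l; lra).
    apply Rabs_le_between in HL2. destruct (Hrr x Hx) as [Hr2 _].
    specialize (Hf1 x Hx1). specialize (Hbeta x Hx1). specialize (Hcirc x Hx).
    rewrite Hv, Hr2 in HQ.
    replace (c * (- f (Xmap F1 x) / (2 * C))) with (- f (Xmap F1 x) * (1 - g')) in HQ by (unfold g'; field; lra).
    assert (g' * f (Xmap F1 x) >= g' * (- a - L * e)) by (apply Rle_ge, Rmult_le_compat_l; lra).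
    assert (g' * (L * e) <= 1 * (L * e)) by (apply Rmult_le_compat_r; nra). lra. }
  destruct (cap_comp_lipschitz O p f m nu R1 L c C k F2 Hcap Hin2) as [M2 [HM2 HL2]].
  (* The new collar is so thin that [f], at least [-ga a] on the circle, is at least [-2 ga a] on
     it; the bound [1 - b] keeps the barrier inside the new radius. *)
  set (w := Rmin (Rmin (1 - b) ((1 - rho) / 2)) (ga * a / M2)).
  assert (Hgaa : 0 < ga * a) by (apply Rmult_lt_0_compat; lra).
  assert (Hw : 0 < w).
  { unfold w; repeat apply Rmin_glb_lt; try lra. apply Rdiv_lt_0_compat; lra. }
  assert (Hw1 : w <= 1 - b) by (unfold w; eapply Rle_trans; [apply Rmin_l|apply Rmin_l]).
  assert (Hw2 : w <= (1 - rho) / 2) by (unfold w; eapply Rle_trans; [apply Rmin_l|apply Rmin_r]).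
  assert (Hw3 : w * M2 <= ga * a).
  { assert (H : w <= ga * a / M2) by (unfold w; apply Rmin_r). apply Rle_div_r in H; lra. }
  destruct (speed_min P2 Q2 F2 HS2) as [s2 [Hs2 Hmin2]].
  set (tol := Rmin (tol1 / 2) s2).
  assert (Htol : 0 < tol) by (apply Rmin_glb_lt; lra).
  assert (Tl : tol <= tol1 / 2) by apply Rmin_l. assert (Tr : tol <= s2) by apply Rmin_r.
  exists P2, Q2, F2, (1 - w), tol.
  split; [split; auto; try lra|split; [|split; [lra|split; [lra|split; [auto|split]]]]].
  - intros z Hz. rewrite sqrt_mult by lra. specialize (Hdisp z Hz). specialize (Hball z Hz).
    pose proof (dist3_triangle (Xmap F2 z) (Xmap F z) p).
    assert (sqrt a * (/ sqrt C + 1) <= sqrt a * (K * (1 - sqrt ga))) by (apply Rmult_le_compat_l; lra).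
    lra.
  - intros z Hz. apply Hcase, Hz.
  - intros z Hz. assert (Hz0 : z <> RtoC 0) by (intros ->; rewrite Cmod_0 in Hz; lra).
    assert (Hu : circle (unitize z)) by (apply Cmod_unitize; auto).
    specialize (Hcirc2 _ Hu). unfold circle in Hu.
    pose proof (HL2 z (unitize z) ltac:(lra) ltac:(lra)) as H.
    rewrite (Cmod_sub_sym z), unitize_dist in H by (auto; lra).
    apply Rabs_le_between in H.
    assert (M2 * (1 - Cmod z) <= M2 * w) by (apply Rmult_le_compat_l; lra). lra.
  - apply (near_on_mono rho rho (e + q)); [lra|lra|]. apply near_on_trans with F1; [lra|auto|].
    apply (near_on_mono rho b q q); [lra|lra|auto].
  - exists l. split; [auto|]. apply (barrier_widen _ rho b); [lra|lra| |].
    + intros z Hz. specialize (Hmin2 z ltac:(lra)). lra.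
    + apply (barrier_mono (fun z => speed F1 z - tol1)); [|exact Hbar].
      intros z Hz. pose proof (near_on_speed b q F1 F2 z Hn2 ltac:(lra)) as H.
      apply Rabs_le_between in H. lra.
  - intros z Hz. destruct (Hcase z ltac:(lra)) as [_ [H|H]]; [specialize (Hann z Hz)|]; lra.
Qed.

(** The seed is a tiny flat disc [y + h Re (z, i z, 0)], with spinor [(sqrt h, 0)], centred at depth
    [t] below [p]. At the centre [f] lies between [-L t] and [-k t], so [a = 2 L t] leaves room for
    the variation [2 L h] over the disc. *)
Lemma initial_stage O p f m nu R1 L c C k K : convex_cap O p f m nu R1 L c C k -> 0 < K ->
  exists P Q F a, good p f K R1 P Q F a (1 / 2).
Proof.
  intros Hcap HK.
  destruct Hcap as [HR1 HL Hc HC Hk Hnu Hfp HO Hlip Hcont Hpos Hquad Hexit].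
  (* The distance to [p], at most [2t], and the budget [K sqrt (2 L t)] each take at most half of
     [R1]. *)
  set (t := Rmin (R1 / 4) ((R1 / (2 * K)) ^ 2 / (2 * L))).
  assert (HRK : 0 < R1 / (2 * K)) by (apply Rdiv_lt_0_compat; lra).
  assert (Ht : 0 < t).
  { apply Rmin_glb_lt; [lra|]. apply Rdiv_lt_0_compat; [apply pow_lt; auto|lra]. }
  assert (Ht1 : t <= R1 / 4) by apply Rmin_l.
  assert (Ht2 : sqrt (2 * L * t) <= R1 / (2 * K)).
  { rewrite <- (sqrt_pow2 (R1 / (2 * K))) by lra. apply sqrt_le_1_alt.
    assert (H : t <= (R1 / (2 * K)) ^ 2 / (2 * L)) by apply Rmin_r. apply Rle_div_r in H; lra. }
  set (y := add3 p (scal3 (- t) nu)).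
  set (h := Rmin t (k * t / L) / 4).
  assert (Hh0 : 0 < Rmin t (k * t / L)).
  { apply Rmin_glb_lt; auto. apply Rdiv_lt_0_compat; auto. apply Rmult_lt_0_compat; auto. }
  assert (Hh : 0 < h) by (unfold h; lra).
  assert (Hh1 : 4 * h <= t) by (unfold h; pose proof (Rmin_l t (k * t / L)); lra).
  assert (Hh2 : 4 * (L * h) <= k * t).
  { assert (H : 4 * h <= k * t / L) by (unfold h; pose proof (Rmin_r t (k * t / L)); lra).
    apply Rle_div_r in H; lra. }
  set (F := fun i => match i with X1 => [RtoC (c1 y); RtoC h] | X2 => [RtoC (c2 y); (Ci * RtoC h)%C]
                       | X3 => [RtoC (c3 y)] end).
  assert (Hs2 : (RtoC (sqrt h) * RtoC (sqrt h))%C = RtoC h) by (rewrite <- RtoC_mult, sqrt_sqrt; auto; lra).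
  assert (Hdy : dist3 y p <= t).
  { unfold y. rewrite dist3_add, norm3_scal, Hnu, Rabs_Ropp, Rabs_pos_eq; lra. }
  assert (Hpy : dist3 p y <= t) by (rewrite dist3_sym; auto).
  assert (Hyp : add3 y (scal3 t nu) = p) by (unfold y; apply R3_ext; intros []; r3; ring).
  assert (Hpp : dist3 p p <= R1) by (rewrite dist3_refl; lra).
  assert (Hfy1 : f y <= - (k * t)).
  { pose proof (Hexit y t ltac:(lra) ltac:(lra)) as H. rewrite Hyp, Hfp in H. specialize (H Hpp). lra. }
  assert (Hfy2 : - (L * t) <= f y).
  { pose proof (Hlip p y Hpp ltac:(lra)) as H. rewrite Hfp in H. apply Rabs_le_between in H.
    assert (L * dist3 y p <= L * t) by (apply Rmult_le_compat_l; lra). lra. }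
  assert (HX : forall z, Cmod z <= 1 -> dist3 (Xmap F z) y <= 2 * h).
  { intros z Hz. apply dist3_le_coords. pose proof (re_le_Cmod (z * RtoC h)) as R1'.
    pose proof (re_le_Cmod (z * (Ci * RtoC h))) as R2'.
    rewrite Cmod_mult, Cmod_R, (Rabs_pos_eq h) in R1' by lra.
    rewrite !Cmod_mult, Cmod_Ci, Cmod_R, (Rabs_pos_eq h) in R2' by lra.
    pose proof (Cmod_ge_0 z).
    assert (T : forall (a : R) (w : Complex.C), Re (RtoC a + w)%C - a = Re w).
    { intros a [w1 w2]. unfold Re, RtoC, Cplus; simpl. ring. }
    intros i. change (coord i (Xmap F z)) with (coord i (revec (fun i => peval (F i) z))).
    assert (E : peval (F X1) z = (RtoC (c1 y) + z * RtoC h)%C) by (unfold F; cbn [peval]; ring).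
    assert (E' : peval (F X2) z = (RtoC (c2 y) + z * (Ci * RtoC h))%C) by (unfold F; cbn [peval]; ring).
    assert (E'' : peval (F X3) z = (RtoC (c3 y) + RtoC 0)%C) by (unfold F; cbn [peval]; ring).
    unfold revec, vec. rewrite E, E', E''.
    destruct i; unfold coord.
    - change (Rabs (Re (RtoC (c1 y) + z * RtoC h)%C - c1 y) <= h). rewrite T. nra.
    - change (Rabs (Re (RtoC (c2 y) + z * (Ci * RtoC h))%C - c2 y) <= h). rewrite T. nra.
    - change (Rabs (Re (RtoC (c3 y) + RtoC 0)%C - c3 y) <= h). rewrite T.
      change (Re (RtoC 0)) with 0. rewrite Rabs_R0. lra. }
  assert (Hin : forall z, Cmod z <= 1 -> dist3 (Xmap F z) p <= 2 * t).
  { intros z Hz. specialize (HX z Hz). pose proof (dist3_triangle (Xmap F z) y p). lra. }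
  assert (HfX : forall z, Cmod z <= 1 -> f y - 2 * (L * h) <= f (Xmap F z) <= f y + 2 * (L * h)).
  { intros z Hz. specialize (Hin z Hz). specialize (HX z Hz).
    pose proof (Hlip y (Xmap F z) ltac:(lra) ltac:(lra)) as H. apply Rabs_le_between in H.
    assert (L * dist3 (Xmap F z) y <= L * (2 * h)) by (apply Rmult_le_compat_l; lra). lra. }
  assert (Hkt : 0 < k * t) by (apply Rmult_lt_0_compat; auto).
  assert (HLt : L * (4 * h) <= L * t) by (apply Rmult_le_compat_l; lra).
  exists [RtoC (sqrt h)], nil, F, (2 * L * t).
  assert (Hsh : RtoC (sqrt h) <> RtoC 0).
  { intros E. apply RtoC_inj in E. pose proof (sqrt_lt_R0 h Hh). lra. }
  split.
  - split; [|split].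
    + intros i z. destruct i; cbn [F pder padd peval qv].
      * rewrite <- Hs2; ring.
      * rewrite <- Hs2; ring.
      * ring.
    + intros z. left. cbn [peval]. intros E. apply Hsh. rewrite <- E; ring.
    + cbn [peval]. intros E. apply Hsh. rewrite <- E; ring.
  - apply Rmult_lt_0_compat; lra.
  - lra.
  - intros z Hz. specialize (Hin z Hz).
    assert (K * sqrt (2 * L * t) <= K * (R1 / (2 * K))) by (apply Rmult_le_compat_l; lra).
    replace (K * (R1 / (2 * K))) with (R1 / 2) in H by (field; lra). lra.
  - intros z Hz. specialize (HfX z Hz). lra.
  - intros z Hz. unfold circle in Hz. specialize (HfX z ltac:(lra)). lra.
  - intros z Hz. specialize (HfX z ltac:(lra)). lra.
Qed.

(** * Series of polynomials *)

Definition Cseries (a : nat -> C) : C := (Series (fun n => Re (a n)), Series (fun n => Im (a n))).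
Definition abs_summable (a : nat -> C) : Prop := ex_series (fun n => Cmod (a n)).

Lemma im_le_Cmod z : Rabs (Im z) <= Cmod z.
Proof. eapply Rle_trans; [|apply Rmax_Cmod]. apply Rmax_r. Qed.

Lemma abs_summable_parts a : abs_summable a -> ex_series (fun n => Re (a n)) /\ ex_series (fun n => Im (a n)).
Proof.
  intros H; split; apply ex_series_Rabs.
  - apply (ex_series_le (fun n => Rabs (Re (a n))) (fun n => Cmod (a n))); [|exact H].
    intros n. change (Rabs (Rabs (Re (a n))) <= Cmod (a n)). rewrite Rabs_Rabsolu. apply re_le_Cmod.
  - apply (ex_series_le (fun n => Rabs (Im (a n))) (fun n => Cmod (a n))); [|exact H].
    intros n. change (Rabs (Rabs (Im (a n))) <= Cmod (a n)). rewrite Rabs_Rabsolu. apply im_le_Cmod.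
Qed.

Lemma abs_summable_le a b : (forall n, Cmod (a n) <= b n) -> ex_series b -> abs_summable a.
Proof.
  intros H Hb. apply (ex_series_le (fun n => Cmod (a n)) b); [|exact Hb].
  intros n. change (Rabs (Cmod (a n)) <= b n). rewrite Rabs_pos_eq by apply Cmod_ge_0. apply H.
Qed.

(** The factor 2 is the price of summing real and imaginary parts separately. *)
Lemma Cseries_bound a b : (forall n, Cmod (a n) <= b n) -> ex_series b -> Cmod (Cseries a) <= 2 * Series b.
Proof.
  intros H Hb. assert (Ha := abs_summable_le a b H Hb).
  assert (HR : ex_series (fun n => Rabs (Re (a n)))).
  { apply (ex_series_le (fun n => Rabs (Re (a n))) b); [|exact Hb].
    intros n. change (Rabs (Rabs (Re (a n))) <= b n). rewrite Rabs_Rabsolu.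
    eapply Rle_trans; [apply re_le_Cmod|apply H]. }
  assert (HI : ex_series (fun n => Rabs (Im (a n)))).
  { apply (ex_series_le (fun n => Rabs (Im (a n))) b); [|exact Hb].
    intros n. change (Rabs (Rabs (Im (a n))) <= b n). rewrite Rabs_Rabsolu.
    eapply Rle_trans; [apply im_le_Cmod|apply H]. }
  eapply Rle_trans; [apply Cmod_le_parts|]. unfold Cseries; simpl Re; simpl Im.
  pose proof (Series_Rabs _ HR) as H1. pose proof (Series_Rabs _ HI) as H2.
  assert (H3 : Series (fun n => Rabs (Re (a n))) <= Series b).
  { apply Series_le; auto. intros n; split; [apply Rabs_pos|]. eapply Rle_trans; [apply re_le_Cmod|apply H]. }
  assert (H4 : Series (fun n => Rabs (Im (a n))) <= Series b).
  { apply Series_le; auto. intros n; split; [apply Rabs_pos|]. eapply Rle_trans; [apply im_le_Cmod|apply H]. }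
  lra.
Qed.

Lemma Cseries_plus a b : abs_summable a -> abs_summable b -> Cseries (fun n => (a n + b n)%C) = (Cseries a + Cseries b)%C.
Proof.
  intros Ha Hb. destruct (abs_summable_parts a Ha) as [A1 A2]. destruct (abs_summable_parts b Hb) as [B1 B2].
  unfold Cseries, Cplus; simpl. f_equal; [rewrite <- Series_plus by auto|rewrite <- Series_plus by auto];
  apply Series_ext; intros n; reflexivity.
Qed.

Lemma Cseries_scal c a : abs_summable a -> Cseries (fun n => (c * a n)%C) = (c * Cseries a)%C.
Proof.
  intros Ha. destruct (abs_summable_parts a Ha) as [A1 A2]. destruct c as [u v].
  assert (Sc : forall k s, ex_series s -> ex_series (fun n => k * s n)).
  { intros k s Hs. apply (ex_series_scal_l k s Hs). }
  unfold Cseries, Cmult; simpl. f_equal.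
  - rewrite <- !Series_scal_l, <- Series_minus by auto. apply Series_ext; intros n; reflexivity.
  - rewrite <- !Series_scal_l, <- Series_plus by auto. apply Series_ext; intros n; reflexivity.
Qed.

Lemma Cseries_ext a b : (forall n, a n = b n) -> Cseries a = Cseries b.
Proof. intros H. unfold Cseries. f_equal; apply Series_ext; intros n; rewrite H; reflexivity. Qed.

(** Normal convergence on every smaller disc, stated on coefficients; it passes to derivatives at
    the price of a slightly larger radius. *)
Definition summable (T : nat -> list C) : Prop :=
  forall r, 0 <= r < 1 -> ex_series (fun n => pnorm r (T n)).
Definition sumC (T : nat -> list C) (z : C) : C := Cseries (fun n => peval (T n) z).

Lemma summable_abs T z : summable T -> Cmod z < 1 -> abs_summable (fun n => peval (T n) z).
Proof.
  intros HT Hz. apply (abs_summable_le _ (fun n => pnorm (Cmod z) (T n))).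
  - intros n. apply Cmod_peval_le. lra.
  - apply HT. split; [apply Cmod_ge_0|auto].
Qed.

Lemma summable_pder T : summable T -> summable (fun n => pder (T n)).
Proof.
  intros HT r Hr. set (r' := (1 + r) / 2).
  apply (ex_series_le (fun n => pnorm r (pder (T n))) (fun n => / (r' - r) * pnorm r' (T n))).
  - intros n. change (Rabs (pnorm r (pder (T n))) <= / (r' - r) * pnorm r' (T n)).
    rewrite Rabs_pos_eq by (apply pnorm_ge0; lra).
    eapply Rle_trans; [apply (pnorm_pder r r'); unfold r'; lra|]. unfold Rdiv. lra.
  - apply (ex_series_scal_l (/ (r' - r)) (fun n => pnorm r' (T n))). apply HT. unfold r'; lra.
Qed.

Lemma summable_pscale c T : summable T -> summable (fun n => pscale c (T n)).
Proof.
  intros HT r Hr. apply (ex_series_ext (fun n => Cmod c * pnorm r (T n))).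
  - intros n. rewrite pnorm_pscale. reflexivity.
  - apply (ex_series_scal_l (Cmod c) (fun n => pnorm r (T n))), HT, Hr.
Qed.

Lemma sumC_pscale c T z : summable T -> Cmod z < 1 -> sumC (fun n => pscale c (T n)) z = (c * sumC T z)%C.
Proof.
  intros HT Hz. unfold sumC. rewrite <- Cseries_scal by (apply summable_abs; auto).
  apply Cseries_ext; intros n. apply peval_pscale.
Qed.

(** The quadratic remainders of the polynomials are summed term by term. Continuity and complex
    differentiability, with the termwise derivative, both follow. *)
Lemma sumC_quadratic T r : summable T -> 0 <= r < 1 -> exists B, 0 <= B /\
  forall z h, Cmod z <= r -> Cmod (z + h) <= r ->
    Cmod (sumC T (z + h) - sumC T z - h * sumC (fun n => pder (T n)) z) <= B * Cmod h ^ 2.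
Proof.
  intros HT Hr. set (r' := (1 + r) / 2).
  assert (Hr' : 0 <= r' < 1) by (unfold r'; lra).
  assert (Hd : 0 < (r' - r) ^ 2) by (apply pow_lt; unfold r'; lra).
  exists (2 * (/ (r' - r) ^ 2 * Series (fun n => pnorm r' (T n)))). split.
  { apply Rmult_le_pos; [lra|]. apply Rmult_le_pos; [left; apply Rinv_0_lt_compat; auto|].
    rewrite <- (Rmult_0_l (Series (fun n => pnorm r' (T n)))), <- Series_scal_l.
    apply Series_le; [|apply HT; auto]. intros n. pose proof (pnorm_ge0 r' (T n) ltac:(lra)). lra. }
  intros z h Hz Hzh. unfold sumC.
  assert (A1 := summable_abs T (z + h) HT ltac:(lra)). assert (A2 := summable_abs T z HT ltac:(lra)).
  assert (A3 := summable_abs _ z (summable_pder T HT) ltac:(lra)).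
  assert (Sc : forall c a, abs_summable a -> abs_summable (fun n => (c * a n)%C)).
  { intros c a Ha. unfold abs_summable. apply (ex_series_ext (fun n => Cmod c * Cmod (a n))).
    - intros n; rewrite Cmod_mult; reflexivity.
    - apply (ex_series_scal_l (Cmod c) (fun n => Cmod (a n))), Ha. }
  assert (Ad : forall a b, abs_summable a -> abs_summable b -> abs_summable (fun n => (a n + b n)%C)).
  { intros a b Ha Hb. apply (abs_summable_le _ (fun n => Cmod (a n) + Cmod (b n))).
    - intros n. apply Cmod_triangle.
    - apply (ex_series_plus (fun n => Cmod (a n)) (fun n => Cmod (b n))); auto. }
  replace (Cseries (fun n => peval (T n) (z + h)) - Cseries (fun n => peval (T n) z) - h * Cseries (fun n => peval (pder (T n)) z))%C
    with (Cseries (fun n => (peval (T n) (z + h) + (- RtoC 1) * peval (T n) z + (- h) * peval (pder (T n)) z)%C)).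
  2:{ rewrite Cseries_plus by auto. rewrite Cseries_plus by auto. rewrite !Cseries_scal by auto. ring. }
  eapply Rle_trans.
  - apply (Cseries_bound _ (fun n => (Cmod h ^ 2 * / (r' - r) ^ 2) * pnorm r' (T n))).
    + intros n.
      replace (peval (T n) (z + h) + - RtoC 1 * peval (T n) z + - h * peval (pder (T n)) z)%C
        with (peval (T n) (z + h) - peval (T n) z - h * peval (pder (T n)) z)%C by ring.
      eapply Rle_trans; [apply (peval_quadratic_remainder r r'); unfold r' in *; auto; lra|].
      unfold Rdiv. apply Req_le; ring.
    + apply (ex_series_scal_l _ (fun n => pnorm r' (T n))), HT, Hr'.
  - rewrite Series_scal_l. apply Req_le; ring.
Qed.

Definition re_sum (T : nat -> list C) (p : R2) : R := Re (sumC T p).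
(** The partial derivatives of [Re F] are [Re F'] and [Re (i F')], again real parts of series of the
    same kind, so differentiation can be iterated. *)
Definition pder_dir (i : bool) (T : nat -> list C) : nat -> list C :=
  if i then (fun n => pder (T n)) else (fun n => pscale Ci (pder (T n))).

Lemma summable_pder_dir i T : summable T -> summable (pder_dir i T).
Proof. intros H; destruct i; simpl; [|apply summable_pscale]; apply summable_pder, H. Qed.

Lemma Cadd_sub (p q : C) : q = (p + (q - p))%C.
Proof. ring. Qed.

Lemma disk_Cmod p : disk p <-> Cmod p < 1.
Proof.
  unfold disk, Cmod. split; intros H.
  - rewrite <- sqrt_1. apply sqrt_lt_1_alt. split; [nra|auto].
  - rewrite <- sqrt_1 in H at 1. apply sqrt_lt_0_alt in H. exact H.
Qed.

Definition dirC (i : bool) : C := if i then RtoC 1 else Ci.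

Lemma re_sum_is_derive i T (p : C) : summable T -> disk p ->
  is_derive (fun t => re_sum T (Cplus p (RtoC t * dirC i)%C)) 0 (re_sum (pder_dir i T) p).
Proof.
  intros HT Hp. apply disk_Cmod in Hp. pose proof (Cmod_ge_0 p) as Hp0.
  set (r := (1 + Cmod p) / 2).
  destruct (sumC_quadratic T r HT) as [B [HB HQ]]; [unfold r; lra|].
  assert (Hdir : Cmod (dirC i) = 1) by (destruct i; simpl; [apply Cmod_1|apply Cmod_Ci]).
  apply is_derive_Reals. intros e He.
  assert (Hd : 0 < Rmin (r - Cmod p) (e / (B + 1))).
  { apply Rmin_glb_lt; [unfold r; lra|apply Rdiv_lt_0_compat; lra]. }
  exists (mkposreal _ Hd). intros h Hh0 Hh. simpl in Hh.
  pose proof (Rmin_l (r - Cmod p) (e / (B + 1))). pose proof (Rmin_r (r - Cmod p) (e / (B + 1))).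
  assert (Hh1 : Cmod (RtoC h * dirC i) = Rabs h) by (rewrite Cmod_mult, Hdir, Cmod_R; ring).
  specialize (HQ p (RtoC h * dirC i)%C ltac:(unfold r; lra)).
  rewrite Hh1 in HQ. assert (Hin : Cmod (p + RtoC h * dirC i) <= r).
  { eapply Rle_trans; [apply Cmod_triangle|]. rewrite Hh1. lra. }
  specialize (HQ Hin). rewrite Rplus_0_l.
  replace (Cplus p (RtoC 0 * dirC i)%C) with p by ring.
  assert (E : re_sum (pder_dir i T) p * h = Re (RtoC h * dirC i * sumC (fun n => pder (T n)) p)%C).
  { unfold re_sum. destruct i; simpl pder_dir; simpl dirC.
    - destruct (sumC (fun n => pder (T n)) p) as [u v]. unfold Re, Cmult, RtoC; simpl; ring.
    - rewrite sumC_pscale by (auto; apply summable_pder; auto).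
      destruct (sumC (fun n => pder (T n)) p) as [u v]. unfold Re, Cmult, RtoC, Ci; simpl; ring. }
  assert (HR : Rabs (re_sum T (p + RtoC h * dirC i)%C - re_sum T p - re_sum (pder_dir i T) p * h) <= B * Rabs h ^ 2).
  { eapply Rle_trans; [|exact HQ]. rewrite E. unfold re_sum.
    eapply Rle_trans; [|apply re_le_Cmod]. apply Req_le; reflexivity. }
  assert (Hhp : 0 < Rabs h) by (apply Rabs_pos_lt; auto).
  replace ((re_sum T (p + RtoC h * dirC i)%C - re_sum T p) / h - re_sum (pder_dir i T) p)
    with ((re_sum T (p + RtoC h * dirC i)%C - re_sum T p - re_sum (pder_dir i T) p * h) / h) by (field; auto).
  unfold Rdiv. rewrite Rabs_mult, Rabs_inv by auto.
  apply Rmult_lt_reg_r with (Rabs h); auto. rewrite Rmult_assoc, Rinv_l, Rmult_1_r by lra.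
  eapply Rle_lt_trans; [exact HR|]. simpl. rewrite Rmult_1_r.
  assert (Rabs h * (B + 1) < e) by (apply Rlt_div_r; lra). nra.
Qed.

Lemma re_sum_continuous T (p : C) : summable T -> disk p -> continuous (re_sum T) p.
Proof.
  intros HT Hp. apply disk_Cmod in Hp. pose proof (Cmod_ge_0 p) as Hp0.
  set (r := (1 + Cmod p) / 2).
  destruct (sumC_quadratic T r HT) as [B [HB HQ]]; [unfold r; lra|].
  set (W := Cmod (sumC (fun n => pder (T n)) p)).
  apply filterlim_locally. intros e.
  pose proof (Cmod_ge_0 (sumC (fun n => pder (T n)) p)) as HW. fold W in HW.
  assert (Hd : 0 < Rmin (Rmin 1 (r - Cmod p)) (e / (B + W + 1)) / 2).
  { assert (0 < Rmin (Rmin 1 (r - Cmod p)) (e / (B + W + 1))); [|lra].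
    repeat apply Rmin_glb_lt; try (unfold r; lra). apply Rdiv_lt_0_compat; [apply cond_pos|lra]. }
  exists (mkposreal _ Hd). intros q [Hq1 Hq2]. simpl in Hq1, Hq2.
  set (h := (q - p)%C).
  assert (Hh : Cmod h < Rmin (Rmin 1 (r - Cmod p)) (e / (B + W + 1))).
  { eapply Rle_lt_trans; [apply Cmod_le_parts|].
    change (Rabs (fst q - fst p) + Rabs (snd q - snd p) < Rmin (Rmin 1 (r - Cmod p)) (e / (B + W + 1))).
    change (Rabs (fst q - fst p) < Rmin (Rmin 1 (r - Cmod p)) (e / (B + W + 1)) / 2) in Hq1.
    change (Rabs (snd q - snd p) < Rmin (Rmin 1 (r - Cmod p)) (e / (B + W + 1)) / 2) in Hq2. lra. }
  pose proof (Rmin_l (Rmin 1 (r - Cmod p)) (e / (B + W + 1))). pose proof (Rmin_r (Rmin 1 (r - Cmod p)) (e / (B + W + 1))).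
  pose proof (Rmin_l 1 (r - Cmod p)). pose proof (Rmin_r 1 (r - Cmod p)).
  assert (Eq : @eq C q (p + h)%C) by exact (Cadd_sub p q).
  assert (Hin : Cmod (p + h) <= r) by (eapply Rle_trans; [apply Cmod_triangle|lra]).
  specialize (HQ p h ltac:(unfold r; lra) Hin).
  change (Rabs (re_sum T q - re_sum T p) < e). rewrite Eq. unfold re_sum.
  change (Re (sumC T (p + h)) - Re (sumC T p)) with (Re (sumC T (p + h) - sumC T p)%C).
  eapply Rle_lt_trans; [apply re_le_Cmod|].
  replace (sumC T (p + h) - sumC T p)%C with
    ((sumC T (p + h) - sumC T p - h * sumC (fun n => pder (T n)) p) + h * sumC (fun n => pder (T n)) p)%C by ring.
  eapply Rle_lt_trans; [apply Cmod_triangle|]. rewrite Cmod_mult. fold W.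
  pose proof (Cmod_ge_0 h).
  assert (Cmod h * (B + W + 1) < e) by (apply Rlt_div_r; lra).
  assert (B * Cmod h ^ 2 <= B * Cmod h) by (apply Rmult_le_compat_l; [auto|simpl; nra]). nra.
Qed.

Lemma re_sum_part2_is_derive (i : bool) T (p : R2) : summable T -> disk p ->
  if i return Prop then is_derive (fun t : R => re_sum T (t, snd p)) (fst p) (re_sum (pder_dir true T) p)
  else is_derive (fun t : R => re_sum T (fst p, t)) (snd p) (re_sum (pder_dir false T) p).
Proof.
  intros HT Hp. pose proof (re_sum_is_derive i T p HT Hp) as H. destruct p as [x y]. destruct i; simpl fst; simpl snd.
  - apply (is_derive_ext (fun t => re_sum T (Cplus (x, y) (RtoC (t - x) * dirC true)%C))).
    { intros t. f_equal. unfold Cplus, Cmult, RtoC, dirC; simpl. f_equal; ring. }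
    replace (re_sum (pder_dir true T) (x, y)) with (1 * re_sum (pder_dir true T) (x, y)) by ring.
    apply (is_derive_comp (fun t => re_sum T (Cplus (x, y) (RtoC t * dirC true)%C)) (fun t => t - x)).
    + replace (x - x) with 0 by ring. exact H.
    + auto_derive; [auto|ring].
  - apply (is_derive_ext (fun t => re_sum T (Cplus (x, y) (RtoC (t - y) * dirC false)%C))).
    { intros t. f_equal. unfold Cplus, Cmult, RtoC, dirC, Ci; simpl. f_equal; ring. }
    replace (re_sum (pder_dir false T) (x, y)) with (1 * re_sum (pder_dir false T) (x, y)) by ring.
    apply (is_derive_comp (fun t => re_sum T (Cplus (x, y) (RtoC t * dirC false)%C)) (fun t => t - y)).
    + replace (y - y) with 0 by ring. exact H.
    + auto_derive; [auto|ring].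
Qed.

Lemma disk_open (p : C) : disk p -> exists e : posreal, forall q : C, Rabs (fst q - fst p) < e -> Rabs (snd q - snd p) < e -> disk q.
Proof.
  intros Hp. apply disk_Cmod in Hp.
  assert (He : 0 < (1 - Cmod p) / 2) by lra. exists (mkposreal _ He). intros q H1 H2. simpl in H1, H2.
  apply disk_Cmod. rewrite (Cadd_sub p q).
  eapply Rle_lt_trans; [apply Cmod_triangle|].
  pose proof (Cmod_le_parts (q - p)) as H.
  change (Cmod (q - p) <= Rabs (fst q - fst p) + Rabs (snd q - snd p)) in H. lra.
Qed.

(** Iterated partial derivatives are identified with series on the disc only; since the disc is
    open, this determines [Derive] there. *)
Lemma part2_on_disk i f T p : summable T -> (forall q, disk q -> f q = re_sum T q) -> disk p ->
  ex_part2 i f p /\ part2 i f p = re_sum (pder_dir i T) p.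
Proof.
  intros HT Hf Hp. destruct (disk_open p Hp) as [e He].
  pose proof (re_sum_part2_is_derive i T p HT Hp) as H. destruct i; simpl.
  - assert (H' : is_derive (fun t => f (t, snd p)) (fst p) (re_sum (pder_dir true T) p)).
    { apply (is_derive_ext_loc (fun t => re_sum T (t, snd p))); [|exact H].
      exists e. intros t Ht. symmetry. apply Hf, He; simpl; [exact Ht|].
      rewrite Rminus_diag, Rabs_R0. apply cond_pos. }
    split; [exists (re_sum (pder_dir true T) p); exact H'|apply is_derive_unique; exact H'].
  - assert (H' : is_derive (fun t => f (fst p, t)) (snd p) (re_sum (pder_dir false T) p)).
    { apply (is_derive_ext_loc (fun t => re_sum T (fst p, t))); [|exact H].
      exists e. intros t Ht. symmetry. apply Hf, He; simpl; [|exact Ht].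
      rewrite Rminus_diag, Rabs_R0. apply cond_pos. }
    split; [exists (re_sum (pder_dir false T) p); exact H'|apply is_derive_unique; exact H'].
Qed.

Lemma iter_part2_re_sum ds T : summable T -> summable (fold_right pder_dir T ds) /\
  forall p, disk p -> iter_part2 ds (re_sum T) p = re_sum (fold_right pder_dir T ds) p.
Proof.
  intros HT. induction ds as [|i ds [IH1 IH2]]; [auto|]. split.
  - simpl. apply summable_pder_dir, IH1.
  - intros p Hp. simpl. apply part2_on_disk; auto.
Qed.

Lemma re_sum_Cinf2 T : summable T -> Cinf2 disk (re_sum T).
Proof.
  intros HT ds p Hp. destruct (iter_part2_re_sum ds T HT) as [H1 H2]. split.
  - destruct (disk_open p Hp) as [e He].
    apply (continuous_ext_loc _ (re_sum (fold_right pder_dir T ds))); [|apply re_sum_continuous; auto].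
    exists e. intros q [Hq1 Hq2]. symmetry. apply H2, He; [exact Hq1|exact Hq2].
  - intros i. apply (part2_on_disk i _ (fold_right pder_dir T ds) p); auto.
Qed.

(** * The limit surface *)

Lemma half_pow_lim c e : 0 <= c -> 0 < e -> exists N, forall n, (N <= n)%nat -> c * (1 / 2) ^ n <= e.
Proof.
  intros Hc He. destruct (eventually_pow_le (1 / 2) (e / (c + 1))) as [N HN]; [lra|apply Rdiv_lt_0_compat; lra|].
  exists N. intros n Hn. specialize (HN n Hn). assert (0 <= (1 / 2) ^ n) by (apply pow_le; lra).
  apply Rle_div_r in HN; [|lra]. nra.
Qed.

Lemma geometric_bound (d : nat -> R) : (forall n, d (S n) <= d n / 2) -> forall n, d n <= d 0%nat * (1 / 2) ^ n.
Proof.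
  intros H n. induction n as [|n IH]; [simpl; lra|]. specialize (H n). simpl. lra.
Qed.

Lemma Cmod_lim_le (a : nat -> C) (l c : C) e : is_lim_seq (fun n => Re (a n)) (Re l) ->
  is_lim_seq (fun n => Im (a n)) (Im l) -> (exists N, forall n, (N <= n)%nat -> Cmod (a n - c) <= e) ->
  Cmod (l - c) <= e.
Proof.
  intros H1 H2 [N HN]. apply Rle_plus_epsilon. intros ep Hep.
  apply is_lim_seq_spec in H1. apply is_lim_seq_spec in H2.
  assert (Hp : 0 < ep / 2) by lra.
  destruct (H1 (mkposreal _ Hp)) as [N1 HN1]. destruct (H2 (mkposreal _ Hp)) as [N2 HN2].
  set (n := (N + N1 + N2)%nat). specialize (HN n ltac:(unfold n; lia)).
  specialize (HN1 n ltac:(unfold n; lia)). specialize (HN2 n ltac:(unfold n; lia)). simpl in HN1, HN2.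
  replace (l - c)%C with ((a n - c) + - (a n - l))%C by ring.
  eapply Rle_trans; [apply Cmod_triangle|]. rewrite Cmod_opp.
  pose proof (Cmod_le_parts (a n - l)) as H.
  change (Cmod (a n - l) <= Rabs (Re (a n) - Re l) + Rabs (Im (a n) - Im l)) in H. lra.
Qed.

(** Both [d] and [1 - rho] are at least halved, so the discs exhaust the unit disc and [d n]
    majorises the sum of all later perturbations. *)
Definition nested (F : nat -> dir3 -> list C) (rho d : nat -> R) : Prop :=
  forall n, near_on (rho n) (d n / 2) (F n) (F (S n)) /\ d (S n) <= d n / 2 /\ 0 < d n /\
    0 < rho n /\ rho n < rho (S n) < 1 /\ 1 - rho (S n) <= (1 - rho n) / 2.

Lemma nested_rho_le F rho d : nested F rho d -> forall n m, (n <= m)%nat -> rho n <= rho m.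
Proof.
  intros H n m Hnm. induction Hnm; [lra|]. destruct (H m) as [_ [_ [_ [_ [Hr _]]]]]. lra.
Qed.

Lemma nested_rho_lim F rho d r : nested F rho d -> r < 1 -> exists N, forall n, (N <= n)%nat -> r <= rho n.
Proof.
  intros H Hr.
  assert (Hg : forall n, 1 - rho n <= (1 - rho 0%nat) * (1 / 2) ^ n).
  { apply (geometric_bound (fun n => 1 - rho n)). intros n. apply H. }
  destruct (half_pow_lim (1 - rho 0%nat) (1 - r)) as [N HN]; [|lra|].
  { destruct (H 0%nat) as [_ [_ [_ [_ [Hr0 _]]]]]. lra. }
  exists N. intros n Hn. specialize (HN n Hn). specialize (Hg n). lra.
Qed.

Lemma nested_d_lim F rho d e : nested F rho d -> 0 < e -> exists N, forall n, (N <= n)%nat -> d n <= e.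
Proof.
  intros H He. assert (Hg := geometric_bound d (fun n => proj1 (proj2 (H n)))).
  destruct (half_pow_lim (d 0%nat) e) as [N HN]; [left; apply H|auto|].
  exists N. intros n Hn. specialize (HN n Hn). specialize (Hg n). lra.
Qed.

(** Since [d m / 2 <= d m - d (m+1)], the errors telescope. *)
Lemma nested_near F rho d : nested F rho d -> forall n m, (n <= m)%nat -> near_on (rho n) (d n - d m) (F n) (F m).
Proof.
  intros H n m Hnm. destruct (H n) as [_ [_ [_ [Hr0 _]]]].
  induction Hnm as [|m Hnm IH].
  - rewrite Rminus_diag. apply near_on_refl.
  - destruct (H m) as [Hm [Hd [Hd0 _]]]. pose proof (nested_rho_le F rho d H n m Hnm).
    apply (near_on_mono _ (rho n) (d n - d m + d m / 2)); [lra|lra|].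
    apply near_on_trans with (F m); [lra|auto|].
    apply (near_on_mono _ (rho m) (d m / 2)); [lra|lra|auto].
Qed.

Lemma limit_map F rho d : nested F rho d ->
  exists T : dir3 -> nat -> list C, (forall i, summable (T i)) /\
    forall n z i, Cmod z <= rho n -> Cmod (sumC (T i) z - peval (F n i) z) <= d n /\
      Cmod (sumC (fun k => pder (T i k)) z - peval (pder (F n i)) z) <= d n.
Proof.
  intros H.
  assert (HD : exists D : nat -> dir3 -> list C, forall n i,
    F (S n) i = padd (F n i) (D n i) /\ pnorm (rho n) (D n i) <= d n / 2 /\ pnorm (rho n) (pder (D n i)) <= d n / 2).
  { apply (choice (fun n (Dn : dir3 -> list C) => forall i,
      F (S n) i = padd (F n i) (Dn i) /\ pnorm (rho n) (Dn i) <= d n / 2 /\ pnorm (rho n) (pder (Dn i)) <= d n / 2)).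
    intros n. apply H. }
  destruct HD as [D HD].
  (* The limit as a series of increments: its partial sum up to index [n] is exactly [F n], which
     transfers the bounds of [nested_near] to the sum. *)
  set (T := fun (i : dir3) (n : nat) => match n with O => F 0%nat i | S k => D k i end).
  assert (HT : forall i, summable (T i)).
  (* The increments are bounded by a geometric sequence on the disc of radius [r] only from index
     [N] on, once [rho] has passed [r]. *)
  { intros i r Hr. destruct (nested_rho_lim F rho d r H (proj2 Hr)) as [N HN].
    apply (ex_series_incr_n _ (S N)).
    apply (ex_series_le (fun k => pnorm r (T i (S N + k)%nat)) (fun k => d 0%nat * (1 / 2) ^ k)).
    - intros k. change (Rabs (pnorm r (D (N + k)%nat i)) <= d 0%nat * (1 / 2) ^ k).
      rewrite Rabs_pos_eq by (apply pnorm_ge0; lra).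
      eapply Rle_trans; [apply (pnorm_mono r (rho (N + k)%nat)); specialize (HN (N + k)%nat ltac:(lia)); lra|].
      destruct (HD (N + k)%nat i) as [_ [Hb _]].
      pose proof (geometric_bound d (fun n => proj1 (proj2 (H n))) (N + k)%nat) as Hg.
      destruct (H 0%nat) as [_ [_ [Hd0 _]]]. destruct (H (N + k)%nat) as [_ [_ [Hdk _]]].
      assert ((1 / 2) ^ (N + k) <= (1 / 2) ^ k).
      { rewrite pow_add. assert (0 <= (1 / 2) ^ k) by (apply pow_le; lra).
        assert ((1 / 2) ^ N <= 1) by (apply Rle_trans with (1 ^ N); [apply pow_incr; lra|rewrite pow1; lra]). nra. }
      assert (d 0%nat * (1 / 2) ^ (N + k) <= d 0%nat * (1 / 2) ^ k) by (apply Rmult_le_compat_l; lra). lra.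
    - apply (ex_series_scal_l (d 0%nat) (fun k => (1 / 2) ^ k)). exists (/ (1 - 1 / 2)). apply is_series_geom.
      rewrite Rabs_pos_eq; lra. }
  exists T. split; [exact HT|].
  assert (Hpart : forall (pr : C -> R) z i, (forall a b : C, pr (a + b)%C = pr a + pr b) -> forall n,
    sum_n (fun k => pr (peval (T i k) z)) n = pr (peval (F n i) z)).
  { intros pr z i Hpr n. induction n as [|n IH]; [rewrite sum_O; reflexivity|].
    rewrite sum_Sn, IH. destruct (HD n i) as [E _]. rewrite E, peval_padd, Hpr. reflexivity. }
  assert (Hpart' : forall (pr : C -> R) z i, (forall a b : C, pr (a + b)%C = pr a + pr b) -> forall n,
    sum_n (fun k => pr (peval (pder (T i k)) z)) n = pr (peval (pder (F n i)) z)).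
  { intros pr z i Hpr n. induction n as [|n IH]; [rewrite sum_O; reflexivity|].
    rewrite sum_Sn, IH. destruct (HD n i) as [E _]. rewrite E, pder_padd, peval_padd, Hpr. reflexivity. }
  assert (Hrho1 : forall n, rho n < 1) by (intros n; destruct (H n) as [_ [_ [_ [_ [Hr _]]]]]; lra).
  intros n z i Hz. assert (Hz1 : Cmod z < 1) by (specialize (Hrho1 n); lra). split.
  - destruct (abs_summable_parts _ (summable_abs (T i) z (HT i) Hz1)) as [S1 S2].
    apply (Cmod_lim_le (fun m => peval (F m i) z)).
    + apply Series_correct in S1. apply (is_lim_seq_ext (sum_n (fun k => Re (peval (T i k) z)))); [|exact S1].
      intros m. apply (Hpart Re). reflexivity.
    + apply Series_correct in S2. apply (is_lim_seq_ext (sum_n (fun k => Im (peval (T i k) z)))); [|exact S2].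
      intros m. apply (Hpart Im). reflexivity.
    + exists n. intros m Hm. destruct (near_on_value _ _ _ _ z (nested_near F rho d H n m Hm) Hz) as [V _].
      eapply Rle_trans; [apply V|]. destruct (H m) as [_ [_ [Hd0 _]]]. lra.
  - destruct (abs_summable_parts _ (summable_abs _ z (summable_pder (T i) (HT i)) Hz1)) as [S1 S2].
    apply (Cmod_lim_le (fun m => peval (pder (F m i)) z)).
    + apply Series_correct in S1. apply (is_lim_seq_ext (sum_n (fun k => Re (peval (pder (T i k)) z)))); [|exact S1].
      intros m. apply (Hpart' Re). reflexivity.
    + apply Series_correct in S2. apply (is_lim_seq_ext (sum_n (fun k => Im (peval (pder (T i k)) z)))); [|exact S2].
      intros m. apply (Hpart' Im). reflexivity.
    + exists n. intros m Hm. destruct (near_on_value _ _ _ _ z (nested_near F rho d H n m Hm) Hz) as [_ V].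
      eapply Rle_trans; [apply V|]. destruct (H m) as [_ [_ [Hd0 _]]]. lra.
Qed.

(** * Conformality, minimality and first-order geometry of the limit *)

Definition limW (T : dir3 -> nat -> list C) (z : C) (i : dir3) : C := sumC (fun k => pder (T i k)) z.
Definition limX (T : dir3 -> nat -> list C) (z : C) : R3 := revec (fun i => sumC (T i) z).

Lemma null_limit (w : nat -> dir3 -> C) W : (forall n, null (w n)) ->
  (forall e, 0 < e -> exists n, forall i, Cmod (W i - w n i) <= e) -> null W.
Proof.
  intros Hn Hlim. unfold null. apply Cmod_eq_0. apply Rle_antisym; [|apply Cmod_ge_0].
  set (M := Cmod (W X1) + Cmod (W X2) + Cmod (W X3) + 1).
  pose proof (Cmod_ge_0 (W X1)); pose proof (Cmod_ge_0 (W X2)); pose proof (Cmod_ge_0 (W X3)).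
  apply Rle_plus_epsilon. intros ep Hep. rewrite Rplus_0_l.
  destruct (Hlim (Rmin 1 (ep / (6 * M)))) as [n Hw].
  { apply Rmin_glb_lt; [lra|]. apply Rdiv_lt_0_compat; unfold M; lra. }
  set (e := Rmin 1 (ep / (6 * M))) in *.
  assert (He1 : e <= 1) by apply Rmin_l.
  assert (He2 : e * (6 * M) <= ep).
  { assert (H2 : e <= ep / (6 * M)) by apply Rmin_r. apply Rle_div_r in H2; unfold M in *; lra. }
  assert (T : forall i, Cmod (W i * W i - w n i * w n i) <= e * (2 * M)).
  { intros i. replace (W i * W i - w n i * w n i)%C with ((W i - w n i) * (2 * W i + - (W i - w n i)))%C by ring.
    rewrite Cmod_mult. pose proof (Cmod_triangle (2 * W i) (- (W i - w n i))) as Tr.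
    rewrite Cmod_mult, Cmod_2, Cmod_opp in Tr. specialize (Hw i).
    apply Rmult_le_compat; try apply Cmod_ge_0; auto.
    assert (Cmod (W i) + 1 <= M) by (destruct i; unfold M; lra). lra. }
  replace (W X1 * W X1 + W X2 * W X2 + W X3 * W X3)%C with
    ((W X1 * W X1 - w n X1 * w n X1) + (W X2 * W X2 - w n X2 * w n X2) + (W X3 * W X3 - w n X3 * w n X3))%C.
  2:{ specialize (Hn n). unfold null in Hn.
      transitivity (W X1 * W X1 + W X2 * W X2 + W X3 * W X3 - (w n X1 * w n X1 + w n X2 * w n X2 + w n X3 * w n X3))%C;
        [ring|rewrite Hn; ring]. }
  eapply Rle_trans; [apply Cmod_triangle|].
  pose proof (Cmod_triangle (W X1 * W X1 - w n X1 * w n X1) (W X2 * W X2 - w n X2 * w n X2)).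
  pose proof (T X1); pose proof (T X2); pose proof (T X3). lra.
Qed.

Lemma limX_smooth T : (forall i, summable (T i)) -> smooth_on_disk (limX T).
Proof.
  intros H. split; [apply (re_sum_Cinf2 (T X1))|split; [apply (re_sum_Cinf2 (T X2))|apply (re_sum_Cinf2 (T X3))]]; auto.
Qed.

Lemma limX_deriv T ds p : (forall i, summable (T i)) -> disk p ->
  dpsi ds (limX T) p = vec (fun i => re_sum (fold_right pder_dir (T i) ds) p).
Proof.
  intros H Hp. unfold dpsi, vec. f_equal.
  - apply (iter_part2_re_sum ds (T X1)); auto.
  - apply (iter_part2_re_sum ds (T X2)); auto.
  - apply (iter_part2_re_sum ds (T X3)); auto.
Qed.

Lemma limX_deriv1 T p : (forall i, summable (T i)) -> disk p ->
  dpsi [true] (limX T) p = revec (limW T p) /\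
  dpsi [false] (limX T) p = revec (fun i => (Ci * limW T p i)%C).
Proof.
  intros H Hp. split; rewrite limX_deriv by auto; [reflexivity|].
  assert (Hp' := proj1 (disk_Cmod p) Hp).
  assert (E : forall i, re_sum (fold_right pder_dir (T i) [false]) p = Re (Ci * limW T p i)%C).
  { intros i. change (re_sum (fold_right pder_dir (T i) [false]) p) with (Re (sumC (fun n => pscale Ci (pder (T i n))) p)).
    rewrite (sumC_pscale Ci (fun n => pder (T i n))); auto. apply summable_pder; auto. }
  unfold revec, vec. rewrite !E. reflexivity.
Qed.

Lemma pder_pscale c p : pder (pscale c p) = pscale c (pder p).
Proof.
  induction p as [|a p IH]; [reflexivity|]. cbn [pscale pder]. rewrite IH.
  generalize (pder p) as q. clear IH. intros q.
  assert (E : forall u v, pscale c (padd u v) = padd (pscale c u) (pscale c v)).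
  { intros u; induction u as [|x u IHu]; intros [|y v]; cbn [pscale padd]; auto.
    rewrite IHu; f_equal; ring. }
  rewrite E. cbn [pscale]. f_equal. f_equal. ring.
Qed.

Lemma limX_harmonic T p : (forall i, summable (T i)) -> disk p ->
  dpsi [false; false] (limX T) p = scal3 (-1) (dpsi [true; true] (limX T) p).
Proof.
  intros H Hp. rewrite !limX_deriv by auto. assert (Hp' := proj1 (disk_Cmod p) Hp).
  assert (E : forall i, re_sum (fold_right pder_dir (T i) [false; false]) p = (-1) * re_sum (fold_right pder_dir (T i) [true; true]) p).
  { intros i.
    change (re_sum (fold_right pder_dir (T i) [false; false]) p)
      with (Re (sumC (fun n => pscale Ci (pder (pscale Ci (pder (T i n))))) p)).
    change (re_sum (fold_right pder_dir (T i) [true; true]) p) with (Re (sumC (fun n => pder (pder (T i n))) p)).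
    assert (Hs := summable_pder _ (summable_pder _ (H i))).
    replace (sumC (fun n => pscale Ci (pder (pscale Ci (pder (T i n))))) p) with
      (Ci * (Ci * sumC (fun n => pder (pder (T i n))) p))%C.
    - rewrite Cmult_assoc, Ci_sq. destruct (sumC (fun n => pder (pder (T i n))) p) as [u v].
      unfold Re, Cmult, Copp, RtoC; simpl. ring.
    - rewrite <- (sumC_pscale Ci (fun n => pder (pder (T i n)))) by auto.
      rewrite <- (sumC_pscale Ci (fun n => pscale Ci (pder (pder (T i n))))) by (auto; apply summable_pscale; auto).
      apply Cseries_ext. intros n. rewrite pder_pscale. reflexivity. }
  unfold vec. rewrite !E. reflexivity.
Qed.

(** A combination [a X_u + b X_v] is [Re ((a + i b) W)], of length [|a + i b|] times the conformal
    factor. *)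
Lemma limX_immersion T : (forall i, summable (T i)) -> (forall p, disk p -> null (limW T p)) ->
  (forall p, disk p -> 0 < lam (limW T p)) -> immersion (limX T).
Proof.
  intros H Hnull Hlam. split; [apply limX_smooth; auto|]. intros p Hp a b E.
  destruct (limX_deriv1 T p H Hp) as [E1 E2]. change (true :: nil) with [true] in E.
  rewrite E1, E2 in E.
  assert (Ew : revec (fun i => ((a, b) * limW T p i)%C) = mk3 0 0 0).
  { rewrite <- E. unfold revec, vec, add3, scal3, mk3, c1, c2, c3; cbn [fst snd].
    unfold Re, Cmult, Ci; cbn [fst snd]. f_equal; [f_equal|]; ring. }
  pose proof (norm3_revec_scal (limW T p) (a, b) (Hnull p Hp)) as HN. rewrite Ew in HN.
  assert (Z : norm3 (mk3 0 0 0) = 0).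
  { apply Rle_antisym; [apply norm3_le; [lra|r3; lra]|apply norm3_ge0]. }
  rewrite Z in HN. symmetry in HN. apply Rmult_integral in HN. specialize (Hlam p Hp).
  destruct HN as [HN|HN]; [|lra]. apply Cmod_eq_0 in HN. injection HN; auto.
Qed.

(** Conformality gives [E = G] and [F = 0], so the numerator is [E (L + N)]; harmonicity
    [X_uu + X_vv = 0] makes it vanish, whatever the normal. *)
Lemma limX_minimal T : (forall i, summable (T i)) -> (forall p, disk p -> null (limW T p)) ->
  (forall p, disk p -> 0 < lam (limW T p)) -> minimal_immersion (limX T).
Proof.
  intros H Hnull Hlam. split; [apply limX_immersion; auto|]. intros p Hp.
  unfold mean_curvature. change (true :: nil) with [true]. change (false :: nil) with [false].
  change (true :: [false]) with [true; false].
  destruct (limX_deriv1 T p H Hp) as [E1 E2].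
  rewrite (limX_harmonic T p H Hp). rewrite E1, E2.
  destruct (null_parts _ (Hnull p Hp)) as [N1 N2].
  set (Xu := revec (limW T p)). set (Xv := revec (fun i => (Ci * limW T p i)%C)).
  assert (HG : dot3 Xv Xv = dot3 Xu Xu).
  { unfold Xu, Xv, revec, vec, dot3, mk3, c1, c2, c3; cbn [fst snd].
    unfold Re, Cmult, Ci; cbn [fst snd]. rewrite N1. ring. }
  assert (HF : dot3 Xu Xv = 0).
  { unfold Xu, Xv, revec, vec, dot3, mk3, c1, c2, c3; cbn [fst snd].
    unfold Re, Cmult, Ci; cbn [fst snd]. match type of N2 with ?s = 0 => transitivity (- s); [ring|rewrite N2; ring] end. }
  rewrite HG, HF.
  generalize (scal3 (/ norm3 (cross3 Xu Xv)) (cross3 Xu Xv)) as nn. intros nn.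
  assert (HL : dot3 (scal3 (-1) (dpsi [true; true] (limX T) p)) nn = - dot3 (dpsi [true; true] (limX T) p) nn).
  { generalize (dpsi [true; true] (limX T) p). intros x. r3; ring. }
  rewrite HL. unfold Rdiv. apply Rmult_eq_0_compat_r. ring.
Qed.

(** The differential at [z] is a similarity of ratio [lam], and the error is the quadratic remainder
    of the series. *)
Lemma limX_expansion T z : (forall i, summable (T i)) -> Cmod z < 1 -> null (limW T z) ->
  exists d B, 0 < d /\ 0 <= B /\ forall w, Cmod (w - z) < d ->
    Rabs (dist3 (limX T w) (limX T z) - lam (limW T z) * Cmod (w - z)) <= B * Cmod (w - z) ^ 2.
Proof.
  intros H Hz Hn. set (r := (1 + Cmod z) / 2). pose proof (Cmod_ge_0 z) as Hz0.
  assert (Hr : 0 <= r < 1) by (unfold r; lra).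
  destruct (sumC_quadratic (T X1) r (H X1) Hr) as [B1 [P1 Q1]].
  destruct (sumC_quadratic (T X2) r (H X2) Hr) as [B2 [P2 Q2]].
  destruct (sumC_quadratic (T X3) r (H X3) Hr) as [B3 [P3 Q3]].
  exists (r - Cmod z), (2 * (B1 + B2 + B3)). split; [unfold r; lra|]. split; [lra|].
  intros w Hw. set (h := (w - z)%C) in *. assert (Ew : w = (z + h)%C) by (unfold h; ring).
  assert (Hin : Cmod (z + h) <= r) by (eapply Rle_trans; [apply Cmod_triangle|lra]).
  assert (Hzr : Cmod z <= r) by (unfold r; lra).
  pose proof (pow2_ge_0 (Cmod h)) as Hh2.
  set (rm := fun i => (sumC (T i) (z + h) - sumC (T i) z - h * limW T z i)%C).
  assert (Hrm : norm3 (revec rm) <= 2 * ((B1 + B2 + B3) * Cmod h ^ 2)).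
  { apply revec_le. intros i. unfold rm, limW. destruct i.
    - eapply Rle_trans; [apply Q1; auto|]. apply Rmult_le_compat_r; lra.
    - eapply Rle_trans; [apply Q2; auto|]. apply Rmult_le_compat_r; lra.
    - eapply Rle_trans; [apply Q3; auto|]. apply Rmult_le_compat_r; lra. }
  rewrite <- (Rmult_comm (Cmod h)), <- norm3_revec_scal by auto.
  unfold dist3. rewrite Ew. unfold limX. rewrite <- revec_sub.
  set (u := revec (fun i => (sumC (T i) (z + h) - sumC (T i) z)%C)).
  set (v := revec (fun i => (h * limW T z i)%C)).
  assert (E : dist3 u v = norm3 (revec rm)) by reflexivity.
  pose proof (norm3_dist_le u v). pose proof (norm3_dist_le v u) as H2. rewrite dist3_sym in H2.
  apply Rabs_le. lra.
Qed.

Lemma limX_lipschitz T r : (forall i, summable (T i)) -> 0 <= r < 1 ->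
  exists M, 0 < M /\ forall z w, Cmod z <= r -> Cmod w <= r -> dist3 (limX T w) (limX T z) <= M * Cmod (w - z).
Proof.
  intros H Hr. set (r' := (1 + r) / 2). assert (Hr' : 0 <= r' < 1) by (unfold r'; lra).
  assert (HB : forall i, exists B, 0 <= B /\ forall z w, Cmod z <= r -> Cmod w <= r ->
     Cmod (sumC (T i) w - sumC (T i) z) <= B * Cmod (w - z)).
  { intros i. exists (2 * (/ (r' - r) * Series (fun n => pnorm r' (T i n)))). split.
    { apply Rmult_le_pos; [lra|]. apply Rmult_le_pos; [left; apply Rinv_0_lt_compat; unfold r'; lra|].
      rewrite <- (Rmult_0_l (Series (fun n => pnorm r' (T i n)))), <- Series_scal_l.
      apply Series_le; [|apply H; auto]. intros n. pose proof (pnorm_ge0 r' (T i n) ltac:(lra)). lra. }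
    intros z w Hz Hw.
    assert (A1 := summable_abs (T i) w (H i) ltac:(lra)). assert (A2 := summable_abs (T i) z (H i) ltac:(lra)).
    replace (sumC (T i) w - sumC (T i) z)%C with (Cseries (fun n => (peval (T i n) w + (- RtoC 1) * peval (T i n) z)%C)).
    2:{ rewrite Cseries_plus.
        - rewrite Cseries_scal by auto. unfold sumC. ring.
        - auto.
        - apply (abs_summable_le _ (fun n => Cmod (peval (T i n) z))); [|exact A2].
          intros n. rewrite Cmod_mult, Cmod_opp, Cmod_1. lra. }
    eapply Rle_trans.
    - apply (Cseries_bound _ (fun n => (Cmod (w - z) * / (r' - r)) * pnorm r' (T i n))).
      + intros n. pose proof (peval_lipschitz r r' (T i n) z (w - z)) as HL.
        replace (z + (w - z))%C with w in HL by ring.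
        replace (peval (T i n) w + - RtoC 1 * peval (T i n) z)%C with (peval (T i n) w - peval (T i n) z)%C by ring.
        eapply Rle_trans; [apply HL; auto; unfold r'; lra|]. apply Req_le. unfold Rdiv; ring.
      + apply (ex_series_scal_l _ (fun n => pnorm r' (T i n))), (H i), Hr'.
    - rewrite Series_scal_l. apply Req_le; ring. }
  destruct (HB X1) as [B1 [P1 Q1]]. destruct (HB X2) as [B2 [P2 Q2]]. destruct (HB X3) as [B3 [P3 Q3]].
  exists (2 * (B1 + B2 + B3 + 1)). split; [lra|]. intros z w Hz Hw.
  unfold dist3, limX. rewrite <- revec_sub, Rmult_assoc. apply revec_le. intros i.
  pose proof (Cmod_ge_0 (w - z)). destruct i.
  - eapply Rle_trans; [apply Q1; auto|]. apply Rmult_le_compat_r; lra.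
  - eapply Rle_trans; [apply Q2; auto|]. apply Rmult_le_compat_r; lra.
  - eapply Rle_trans; [apply Q3; auto|]. apply Rmult_le_compat_r; lra.
Qed.

(** * Path lengths *)

Lemma polylen_cons2 c a b l : polylen c (a :: b :: l) = dist3 (c a) (c b) + polylen c (b :: l).
Proof. reflexivity. Qed.

(** Continuous induction on the left endpoint, in the direction in which lists grow: the set of [t]
    for which [[t, 1]] has a good partition contains 1, contains its infimum, and can be extended to
    the left of it. The substitution [t = 1 - s] makes [completeness] applicable. *)
Lemma fine_partition c h : (forall t, 0 <= t <= 1 -> exists d, 0 < d /\
    forall u, 0 <= u <= 1 -> Rabs (u - t) < d -> Rabs (h u - h t) <= dist3 (c u) (c t)) ->
  exists l, partition01 l /\ h 1 - h 0 <= polylen c l.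
Proof.
  intros Hloc.
  set (P := fun t => 0 <= t <= 1 /\ exists l, Sorted Rlt (t :: l) /\ last (t :: l) 0 = 1 /\
     h 1 - h t <= polylen c (t :: l)).
  assert (Hext : forall t u, P t -> 0 <= u < t -> Rabs (h t - h u) <= dist3 (c u) (c t) -> P u).
  { intros t u [Ht [l [Hs [Hla Hp]]]] Hu Hd. split; [lra|]. exists (t :: l). split; [|split].
    - constructor; [exact Hs|]. constructor. lra.
    - exact Hla.
    - rewrite polylen_cons2. apply Rabs_le_between in Hd. lra. }
  destruct (completeness (fun s => P (1 - s))) as [s [Hub Hlub]].
  { exists 1. intros s [Hs _]. lra. }
  { exists 0. rewrite Rminus_0_r. split; [lra|]. exists nil. split; [repeat constructor|]. simpl. split; lra. }
  assert (Hs0 : 0 <= s).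
  { apply Hub. rewrite Rminus_0_r. split; [lra|]. exists nil. split; [repeat constructor|]. simpl. split; lra. }
  assert (Hs1 : s <= 1) by (apply Hlub; intros x [Hx _]; lra).
  destruct (Hloc (1 - s)) as [d [Hd Hdl]]; [lra|].
  assert (Hex : exists x, P (1 - x) /\ s - d < x <= s).
  { apply NNPP. intros Hn. assert (s <= s - d); [|lra]. apply Hlub. intros x Hx.
    destruct (Rle_or_lt x (s - d)); auto. exfalso; apply Hn. exists x. split; [exact Hx|split; [auto|apply Hub; exact Hx]]. }
  destruct Hex as [x [Px [Hx1 Hx2]]]. assert (Hx01 := proj1 Px).
  assert (Ps : P (1 - s)).
  { destruct (Rle_lt_or_eq_dec x s Hx2) as [Hlt| ->]; [|exact Px].
    apply (Hext (1 - x)); [exact Px|lra|]. rewrite dist3_sym. apply Hdl; [lra|].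
    apply Rabs_def1; lra. }
  destruct (Rle_lt_or_eq_dec s 1 Hs1) as [Hlt| ->].
  - exfalso. set (u := Rmax 0 (1 - s - d / 2)).
    assert (Hu1 : 0 <= u) by apply Rmax_l.
    assert (Hu2 : u < 1 - s) by (apply Rmax_lub_lt; lra).
    assert (Hu3 : 1 - s - d / 2 <= u) by apply Rmax_r.
    assert (Pu : P u).
    { apply (Hext (1 - s)); [exact Ps|lra|]. rewrite Rabs_minus_sym. apply Hdl; [lra|]. apply Rabs_def1; lra. }
    assert (1 - u <= s); [|lra]. apply Hub. replace (1 - (1 - u)) with u by ring. exact Pu.
  - replace (1 - 1) with 0 in Ps by ring. destruct Ps as [_ [l [H1 [H2 H3]]]].
    exists (0 :: l). split; [split; [exact H1|split; [reflexivity|exact H2]]|exact H3].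
Qed.

Lemma curve_length_lower c h L : curve_length c = Finite L ->
  (forall t, 0 <= t <= 1 -> exists d, 0 < d /\
    forall u, 0 <= u <= 1 -> Rabs (u - t) < d -> Rabs (h u - h t) <= dist3 (c u) (c t)) ->
  forall t0, 0 <= t0 <= 1 -> h t0 - h 0 <= L.
Proof.
  intros HL Hloc t0 Ht0.
  (* Freezing [h] after [t0] yields the bound at an intermediate time from partitions of the whole
     interval. *)
  destruct (fine_partition c (fun t => h (Rmin t t0))) as [l [Hl Hp]].
  { intros t Ht. destruct (Hloc t Ht) as [d [Hd H]].
    destruct (Rtotal_order t t0) as [Hlt|[Heq|Hgt]].
    - exists (Rmin d (t0 - t)). split; [apply Rmin_glb_lt; lra|]. intros u Hu Hut.
      pose proof (Rmin_l d (t0 - t)); pose proof (Rmin_r d (t0 - t)).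
      assert (Hut2 := Hut). apply Rabs_def2 in Hut2.
      rewrite !Rmin_left by lra. apply H; [auto|lra].
    - exists d. split; [auto|]. intros u Hu Hut. rewrite (Rmin_left t) by lra.
      destruct (Rle_or_lt u t0) as [Hle|Hgt].
      + rewrite Rmin_left by lra. apply H; auto.
      + rewrite Rmin_right by lra. rewrite Heq, Rminus_diag, Rabs_R0. apply dist3_ge0.
    - exists (t - t0). split; [lra|]. intros u Hu Hut. apply Rabs_def2 in Hut.
      rewrite !Rmin_right by lra. rewrite Rminus_diag, Rabs_R0. apply dist3_ge0. }
  rewrite Rmin_right, Rmin_left in Hp by lra. eapply Rle_trans; [exact Hp|].
  destruct (Lub_Rbar_correct (fun L => exists l, partition01 l /\ L = polylen c l)) as [Hub _].
  specialize (Hub (polylen c l) ltac:(exists l; auto)). unfold curve_length in HL. rewrite HL in Hub. exact Hub.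
Qed.

Lemma polylen_upper c K : 0 <= K -> (forall a b, 0 <= a <= 1 -> 0 <= b <= 1 -> dist3 (c a) (c b) <= K * Rabs (a - b)) ->
  forall l a, Sorted Rlt (a :: l) -> 0 <= a -> last (a :: l) 0 = 1 -> a <= 1 /\ polylen c (a :: l) <= K * (1 - a).
Proof.
  intros HK Hc. induction l as [|b l IH]; intros a Hs Ha Hl.
  - simpl in Hl. simpl. subst a. lra.
  - inversion Hs as [|x y Hs' Hh]; subst. inversion Hh as [|x y Hab]; subst.
    destruct (IH b Hs' ltac:(lra) Hl) as [Hb Hp]. split; [lra|].
    rewrite polylen_cons2. specialize (Hc a b ltac:(lra) ltac:(lra)).
    rewrite Rabs_left in Hc by lra. lra.
Qed.

(** The Lipschitz bound excludes plus infinity as supremum, and the two-point partition excludes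
    minus infinity. *)
Lemma curve_length_upper c K : 0 <= K ->
  (forall a b, 0 <= a <= 1 -> 0 <= b <= 1 -> dist3 (c a) (c b) <= K * Rabs (a - b)) ->
  exists L, curve_length c = Finite L /\ L <= K.
Proof.
  intros HK Hc. unfold curve_length.
  set (E := fun L => exists l, partition01 l /\ L = polylen c l).
  destruct (Lub_Rbar_correct E) as [Hub Hlub].
  assert (HK' : Rbar_le (Lub_Rbar E) (Finite K)).
  { apply Hlub. intros x [l [[Hs [Hn Hl]] ->]]. simpl.
    destruct l as [|a l]; [simpl; lra|]. simpl in Hn. subst a.
    destruct (polylen_upper c K HK Hc l 0 Hs ltac:(lra) Hl) as [_ H]. lra. }
  assert (H0 : Rbar_le (Finite (polylen c [0; 1])) (Lub_Rbar E)).
  { apply Hub. exists [0; 1]. split; [|reflexivity]. split; [|split; reflexivity].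
    repeat constructor. lra. }
  destruct (Lub_Rbar E) as [L| |]; simpl in *; [exists L; auto|contradiction|contradiction].
Qed.

Lemma induced_dist_path psi p q e : Rbar_lt (induced_dist psi p q) (Finite e) ->
  exists g L, disk_path g p q /\ curve_length (fun t => psi (g t)) = Finite L /\ L < e.
Proof.
  intros H. apply NNPP. intros Hn. apply (Rbar_lt_not_le _ _ H).
  unfold induced_dist. apply Glb_Rbar_correct. intros L [g [Hg HL]]. simpl.
  destruct (Rle_or_lt e L); auto. exfalso. apply Hn. exists g, L. auto.
Qed.

Lemma path_continuous (g : R -> R2) t e : continuous g t -> 0 < e ->
  exists d, 0 < d /\ forall u, Rabs (u - t) < d -> Cmod (g u - g t) < e.
Proof.
  intros Hc He. assert (Hp : 0 < e / 2) by lra.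
  apply filterlim_locally with (eps := mkposreal _ Hp) in Hc. destruct Hc as [d Hd].
  exists d; split; [apply cond_pos|]. intros u Hu. destruct (Hd u Hu) as [H1 H2].
  eapply Rle_lt_trans; [apply Cmod_le_parts|].
  change (Rabs (fst (g u) - fst (g t)) < e / 2) in H1. change (Rabs (snd (g u) - snd (g t)) < e / 2) in H2.
  change (Rabs (fst (g u) - fst (g t)) + Rabs (snd (g u) - snd (g t)) < e). lra.
Qed.

Definition locally_1_lipschitz (psi : C -> R3) (H : C -> R) : Prop :=
  forall z, Cmod z < 1 -> exists d, 0 < d /\ forall w, Cmod w < 1 -> Cmod (w - z) < d ->
    Rabs (H w - H z) <= dist3 (psi w) (psi z).

Lemma dominated_along_path psi H g p q L : disk_path g p q -> curve_length (fun t => psi (g t)) = Finite L ->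
  (forall t, 0 <= t <= 1 -> exists d, 0 < d /\ forall w, Cmod w < 1 -> Cmod (w - g t) < d ->
    Rabs (H w - H (g t)) <= dist3 (psi w) (psi (g t))) ->
  forall t, 0 <= t <= 1 -> H (g t) - H p <= L.
Proof.
  intros [Hc [Hd [H0 H1]]] HL Hdom t Ht. rewrite <- H0.
  apply (curve_length_lower (fun t => psi (g t)) (fun t => H (g t)) L HL); [|exact Ht].
  intros s Hs. destruct (Hdom s Hs) as [d [Hd0 Hdd]].
  destruct (path_continuous g s d (Hc s) Hd0) as [d' [Hd' Hg]].
  exists d'; split; auto. intros u Hu Hus. apply Hdd; [|apply Hg; auto].
  apply disk_Cmod, Hd, Hu.
Qed.

(** The strict inequality [w < W] leaves a margin that absorbs the quadratic error of the expansion
    near each point of the annulus; off the annulus the function is locally constant. *)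
Lemma barrier_dominated psi (W : C -> R) w a b l : barrier w a b l ->
  (forall z, Cmod z < 1 -> exists d B, 0 < d /\ 0 <= B /\ forall u, Cmod (u - z) < d ->
    Rabs (dist3 (psi u) (psi z) - W z * Cmod (u - z)) <= B * Cmod (u - z) ^ 2) ->
  (forall z, a <= Cmod z <= b -> w z < W z) ->
  exists f : R -> R, (forall t, t <= a -> f t = 0) /\ (forall t, b <= t -> f t = l) /\
    locally_1_lipschitz psi (fun z => f (Cmod z)).
Proof.
  intros [f [F1 [F2 F3]]] Hexp Hw. exists f. split; [auto|split; [auto|]]. intros z Hz.
  assert (Hab : forall z u, Rabs (Cmod u - Cmod z) <= Cmod (u - z)).
  { intros z' u. pose proof (Cmod_sub_ge u z'). pose proof (Cmod_sub_ge z' u). rewrite Cmod_sub_sym in H0.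
    apply Rabs_le; lra. }
  destruct (Rlt_or_le (Cmod z) a) as [Hlt|Hge]; [|destruct (Rlt_or_le b (Cmod z)) as [Hgt|Hle]].
  - exists (a - Cmod z); split; [lra|]. intros u _ Hu. pose proof (Hab z u) as H. apply Rabs_le_between in H.
    rewrite !F1, Rminus_diag, Rabs_R0 by lra. apply dist3_ge0.
  - exists (Cmod z - b); split; [lra|]. intros u _ Hu. pose proof (Hab z u) as H. apply Rabs_le_between in H.
    rewrite !F2, Rminus_diag, Rabs_R0 by lra. apply dist3_ge0.
  - specialize (Hw z ltac:(lra)). destruct (F3 z ltac:(lra)) as [d1 [Hd1 S1]].
    destruct (Hexp z Hz) as [d2 [B [Hd2 [HB S2]]]].
    set (ep := W z - w z) in *. assert (Hep : 0 < ep / (B + 1)) by (apply Rdiv_lt_0_compat; unfold ep; lra).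
    exists (Rmin (Rmin d1 d2) (ep / (B + 1))). split; [repeat apply Rmin_glb_lt; auto|].
    intros u _ Hu. pose proof (Rmin_l (Rmin d1 d2) (ep / (B + 1))). pose proof (Rmin_r (Rmin d1 d2) (ep / (B + 1))).
    pose proof (Rmin_l d1 d2). pose proof (Rmin_r d1 d2). pose proof (Hab z u) as Hl.
    specialize (S1 (Cmod u) ltac:(lra)). specialize (S2 u ltac:(lra)).
    apply Rabs_le_between in S2. pose proof (Cmod_ge_0 (u - z)) as Hc0.
    assert (Hc1 : Cmod (u - z) * (B + 1) <= ep).
    { assert (Cmod (u - z) <= ep / (B + 1)) by lra. apply Rle_div_r in H3; lra. }
    assert (Hw1 : w z * Rabs (Cmod u - Cmod z) <= w z * Cmod (u - z) \/ w z < 0).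
    { destruct (Rle_or_lt 0 (w z)); [left|right; auto]. apply Rmult_le_compat_l; auto. }
    assert (Hb : B * Cmod (u - z) ^ 2 <= ep * Cmod (u - z)) by (simpl; nra).
    unfold ep in Hb. destruct Hw1 as [Hw1|Hw1]; [lra|].
    pose proof (Rabs_pos (Cmod u - Cmod z)). pose proof (Rabs_pos (f (Cmod u) - f (Cmod z))).
    assert (w z * Rabs (Cmod u - Cmod z) <= 0) by nra.
    pose proof (dist3_ge0 (psi u) (psi z)). lra.
Qed.

(** The same absorption for a multiple of the Euclidean distance to [p]: it compares intrinsic with
    Euclidean distance where the conformal factor is bounded below. *)
Lemma lower_bound_dominated psi (W : C -> R) k p z : 
  (exists d B, 0 < d /\ 0 <= B /\ forall u, Cmod (u - z) < d ->
    Rabs (dist3 (psi u) (psi z) - W z * Cmod (u - z)) <= B * Cmod (u - z) ^ 2) ->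
  0 <= k < W z ->
  exists d, 0 < d /\ forall w, Cmod w < 1 -> Cmod (w - z) < d ->
    Rabs (k * Cmod (w - p) - k * Cmod (z - p)) <= dist3 (psi w) (psi z).
Proof.
  intros [d [B [Hd [HB S2]]]] Hk.
  set (ep := W z - k). assert (Hep : 0 < ep / (B + 1)) by (apply Rdiv_lt_0_compat; unfold ep; lra).
  exists (Rmin d (ep / (B + 1))). split; [apply Rmin_glb_lt; auto|]. intros w _ Hw.
  pose proof (Rmin_l d (ep / (B + 1))). pose proof (Rmin_r d (ep / (B + 1))).
  specialize (S2 w ltac:(lra)). apply Rabs_le_between in S2. pose proof (Cmod_ge_0 (w - z)) as Hc0.
  assert (Hc1 : Cmod (w - z) * (B + 1) <= ep).
  { assert (Hq : Cmod (w - z) <= ep / (B + 1)) by lra. apply Rle_div_r in Hq; lra. }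
  assert (Hb : B * Cmod (w - z) ^ 2 <= ep * Cmod (w - z)) by (simpl; nra). unfold ep in Hb.
  rewrite <- Rmult_minus_distr_l, Rabs_mult, (Rabs_pos_eq k) by lra.
  assert (Ht : Rabs (Cmod (w - p) - Cmod (z - p)) <= Cmod (w - z)).
  { pose proof (Cmod_triangle (w - z) (z - p)) as T1. replace (w - z + (z - p))%C with (w - p)%C in T1 by ring.
    pose proof (Cmod_triangle (z - w) (w - p)) as T2. replace (z - w + (w - p))%C with (z - p)%C in T2 by ring.
    rewrite (Cmod_sub_sym z w) in T2. apply Rabs_le; lra. }
  assert (k * Rabs (Cmod (w - p) - Cmod (z - p)) <= k * Cmod (w - z)) by (apply Rmult_le_compat_l; lra). lra.
Qed.

(** * Completeness and properness *)

(** The straight segment is a competitor; it stays in the disc by convexity, and the Lipschitz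
    constant bounds its length. *)
Lemma segment_induced_dist psi M r p q : 0 < M -> r < 1 ->
  (forall z w, Cmod z <= r -> Cmod w <= r -> dist3 (psi w) (psi z) <= M * Cmod (w - z)) ->
  Cmod p <= r -> Cmod q <= r -> forall e, M * Cmod (p - q) < e -> Rbar_lt (induced_dist psi p q) (Finite e).
Proof.
  intros HM Hr HLip Hp Hq e He.
  set (g := fun t : R => (p + RtoC t * (q - p))%C : R2).
  assert (Hgr : forall t, 0 <= t <= 1 -> Cmod (g t) <= r).
  { intros t Ht. unfold g. replace (p + RtoC t * (q - p))%C with (RtoC (1 - t) * p + RtoC t * q)%C
      by (rewrite RtoC_minus; ring).
    eapply Rle_trans; [apply Cmod_triangle|]. rewrite !Cmod_mult, !Cmod_R, !Rabs_pos_eq by lra.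
    pose proof (Cmod_ge_0 p); pose proof (Cmod_ge_0 q). nra. }
  assert (Hpath : disk_path g p q).
  { split; [|split; [|split]].
    - intros t. unfold g. apply filterlim_locally. intros ep.
      set (c := Cmod (q - p)). pose proof (Cmod_ge_0 (q - p)) as Hc0. fold c in Hc0.
      assert (Hd : 0 < ep / (c + 1)) by (apply Rdiv_lt_0_compat; [apply cond_pos|lra]).
      exists (mkposreal _ Hd). intros s Hs. change (Rabs (s - t) < ep / (c + 1)) in Hs.
      apply (Rlt_div_r (Rabs (s - t))) in Hs; [|lra].
      assert (E : Cmod ((p + RtoC s * (q - p)) - (p + RtoC t * (q - p)))%C < ep).
      { replace (p + RtoC s * (q - p) - (p + RtoC t * (q - p)))%C with (RtoC (s - t) * (q - p))%C
          by (rewrite RtoC_minus; ring).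
        rewrite Cmod_mult, Cmod_R. fold c. pose proof (Rabs_pos (s - t)). lra. }
      split; eapply Rle_lt_trans; [apply (re_le_Cmod ((p + RtoC s * (q - p)) - (p + RtoC t * (q - p)))%C)|exact E|
        apply (im_le_Cmod ((p + RtoC s * (q - p)) - (p + RtoC t * (q - p)))%C)|exact E].
    - intros t Ht. apply disk_Cmod. specialize (Hgr t Ht). lra.
    - unfold g. transitivity (p + RtoC 0 * (q - p))%C; [reflexivity|]. change (@eq C (p + RtoC 0 * (q - p))%C p). ring.
    - unfold g. change (@eq C (p + RtoC 1 * (q - p))%C q). ring. }
  destruct (curve_length_upper (fun t => psi (g t)) (M * Cmod (p - q))) as [L [HL HLe]].
  { apply Rmult_le_pos; [lra|apply Cmod_ge_0]. }
  { intros a b Ha Hb. eapply Rle_trans; [apply HLip; apply Hgr; auto|]. rewrite Rmult_assoc.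
    apply Rmult_le_compat_l; [lra|]. apply Req_le. unfold g.
    replace (p + RtoC a * (q - p) - (p + RtoC b * (q - p)))%C with (RtoC (a - b) * (q - p))%C
      by (rewrite RtoC_minus; ring).
    rewrite Cmod_mult, Cmod_R, (Cmod_sub_sym q). ring. }
  unfold induced_dist. apply Rbar_le_lt_trans with (Finite L); [|simpl; lra].
  apply (Glb_Rbar_correct (fun L => exists g, disk_path g p q /\ curve_length (fun t => psi (g t)) = Finite L)).
  exists g. auto.
Qed.

Lemma Cauchy_C_limit (x : nat -> C) : (forall e, 0 < e -> exists N, forall m n, (N <= m)%nat -> (N <= n)%nat -> Cmod (x n - x m) < e) ->
  exists y : C, forall e, 0 < e -> exists N, forall n, (N <= n)%nat -> Cmod (x n - y) < e.
Proof.
  intros H.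
  destruct (Rcomplete.R_complete (fun n => fst (x n))) as [a Ha].
  { intros e He. destruct (H e He) as [N HN]. exists N. intros n m Hn Hm. unfold Rdist.
    eapply Rle_lt_trans; [apply (re_le_Cmod (x n - x m))|]. apply HN; lia. }
  destruct (Rcomplete.R_complete (fun n => snd (x n))) as [b Hb].
  { intros e He. destruct (H e He) as [N HN]. exists N. intros n m Hn Hm. unfold Rdist.
    eapply Rle_lt_trans; [apply (im_le_Cmod (x n - x m))|]. apply HN; lia. }
  exists (a, b). intros e He.
  destruct (Ha (e / 2)) as [N1 HN1]; [lra|]. destruct (Hb (e / 2)) as [N2 HN2]; [lra|].
  exists (N1 + N2)%nat. intros n Hn. specialize (HN1 n ltac:(lia)). specialize (HN2 n ltac:(lia)).
  unfold Rdist in *. eapply Rle_lt_trans; [apply Cmod_le_parts|].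
  change (Rabs (fst (x n) - a) + Rabs (snd (x n) - b) < e). lra.
Qed.

(** A path shorter than 1 cannot cross a barrier, so the tail of an intrinsic Cauchy sequence and
    the short paths joining its terms remain in a smaller disc. There the metric is bounded below,
    which gives Euclidean convergence, and the map is Lipschitz, which turns this back into
    intrinsic convergence. *)
Lemma complete_of_barriers (psi : C -> R3) (W : C -> R) (rho : nat -> R) :
  (forall z, Cmod z < 1 -> exists d B, 0 < d /\ 0 <= B /\ forall u, Cmod (u - z) < d ->
    Rabs (dist3 (psi u) (psi z) - W z * Cmod (u - z)) <= B * Cmod (u - z) ^ 2) ->
  (forall r, 0 <= r < 1 -> exists M, 0 < M /\ forall z w, Cmod z <= r -> Cmod w <= r ->
    dist3 (psi w) (psi z) <= M * Cmod (w - z)) ->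
  (forall n, 0 < rho n < 1) -> (forall r, r < 1 -> exists N, r <= rho N) ->
  (forall n, exists l f, 1 <= l /\ (forall t, t <= rho n -> f t = 0) /\ (forall t, rho (S n) <= t -> f t = l) /\
     locally_1_lipschitz psi (fun z => f (Cmod z))) ->
  (forall n, exists k, 0 < k /\ forall z, Cmod z <= rho n -> k < W z) ->
  complete_immersion psi.
Proof.
  intros Hexp HLip Hrho Hlim Hbar HW x Hx HC.
  assert (Hstay : forall n p q g L, Cmod p <= rho n -> disk_path g p q ->
     curve_length (fun t => psi (g t)) = Finite L -> L < 1 -> forall t, 0 <= t <= 1 -> Cmod (g t) <= rho (S n)).
  { intros n p q g L Hp Hg HL HL1 t Ht. destruct (Rle_or_lt (Cmod (g t)) (rho (S n))) as [H|H]; auto. exfalso.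
    destruct (Hbar n) as [l [f [Hl [F1 [F2 F3]]]]].
    assert (Hd : f (Cmod (g t)) - f (Cmod p) <= L).
    { apply (dominated_along_path psi (fun z => f (Cmod z)) g p q L Hg HL); [|exact Ht].
      intros s Hs. apply F3. apply disk_Cmod. apply Hg, Hs. }
    rewrite (F1 (Cmod p)), F2 in Hd by lra. lra. }
  destruct (HC 1 ltac:(lra)) as [N0 HN0].
  (* Each use of a barrier costs one index: the tail lies within [rho (k+1)], the paths joining its
     terms within [rho (k+2)]. *)
  destruct (Hlim (Cmod (x N0))) as [k Hk]; [apply disk_Cmod, Hx|].
  assert (Hx1 : forall n, (N0 <= n)%nat -> Cmod (x n) <= rho (S k)).
  { intros n Hn. destruct (induced_dist_path psi _ _ 1 (HN0 N0 n ltac:(lia) Hn)) as [g [L [Hg [HL HL1]]]].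
    destruct Hg as [G1 [G2 [G3 G4]]] eqn:EG. rewrite <- G4.
    apply (Hstay k (x N0) (x n) g L); auto. lra. }
  destruct (HW (S (S k))) as [kap [Hkap HWk]].
  assert (HEu : forall e, 0 < e -> exists N, forall m n, (N <= m)%nat -> (N <= n)%nat -> Cmod ((x n : C) - x m) < e).
  (* The bound 1 keeps the joining path behind a barrier; [kap * e] converts its length into
     Euclidean distance. *)
  { intros e He. assert (Hee : 0 < Rmin 1 (kap * e)) by (apply Rmin_glb_lt; [lra|apply Rmult_lt_0_compat; auto]).
    destruct (HC _ Hee) as [N HN]. exists (N + N0)%nat. intros m n Hm Hn.
    destruct (induced_dist_path psi _ _ _ (HN m n ltac:(lia) ltac:(lia))) as [g [L [Hg [HL HL1]]]].
    pose proof (Rmin_l 1 (kap * e)). pose proof (Rmin_r 1 (kap * e)).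
    assert (Hst : forall t, 0 <= t <= 1 -> Cmod (g t) <= rho (S (S k))).
    { apply (Hstay (S k) (x m) (x n) g L); auto; [apply Hx1; lia|lra]. }
    assert (Hd : kap * Cmod ((g 1 : C) - x m) - kap * Cmod ((x m : C) - x m) <= L).
    { apply (dominated_along_path psi (fun z => kap * Cmod (z - x m)) g (x m) (x n) L Hg HL); [|lra].
      intros t Ht. apply (lower_bound_dominated psi W).
      - apply Hexp. apply disk_Cmod, Hg, Ht.
      - specialize (HWk (g t) (Hst t Ht)). lra. }
    destruct Hg as [_ [_ [_ G4]]]. rewrite G4 in Hd.
    replace ((x m : C) - x m)%C with (RtoC 0) in Hd.
    2:{ generalize (x m). intros [u v]. unfold Cminus, Cplus, Copp, RtoC; simpl. f_equal; ring. }
    rewrite Cmod_0 in Hd. apply Rmult_lt_reg_l with kap; lra. }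
  destruct (Cauchy_C_limit x HEu) as [y Hy].
  assert (Hyr : Cmod y <= rho (S k)).
  { apply Rle_plus_epsilon. intros ep Hep. destruct (Hy ep Hep) as [N HN].
    specialize (HN (N + N0)%nat ltac:(lia)). specialize (Hx1 (N + N0)%nat ltac:(lia)).
    pose proof (Cmod_sub_ge y (x (N + N0)%nat)) as H. rewrite Cmod_sub_sym in H. lra. }
  exists y. split; [apply disk_Cmod; specialize (Hrho (S k)); lra|].
  intros e He. destruct (HLip (rho (S k)) ltac:(specialize (Hrho (S k)); lra)) as [M [HM HML]].
  destruct (Hy (e / M)) as [N HN]; [apply Rdiv_lt_0_compat; auto|].
  exists (N + N0)%nat. intros n Hn.
  apply (segment_induced_dist psi M (rho (S k))); auto.
  - specialize (Hrho (S k)); lra.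
  - apply Hx1; lia.
  - specialize (HN n ltac:(lia)). apply Rlt_div_r in HN; lra.
Qed.

Lemma open_Cmod (U : R2 -> Prop) (z : C) : open U -> U z -> exists e, 0 < e /\ forall w : C, Cmod (w - z) < e -> U w.
Proof.
  intros HU Hz. destruct (HU z Hz) as [e He]. exists e; split; [apply cond_pos|].
  intros w Hw. apply He. split; eapply Rle_lt_trans; [apply (re_le_Cmod (w - z))|exact Hw|apply (im_le_Cmod (w - z))|exact Hw].
Qed.

Lemma compact2_compact_set (S : C -> Prop) : compact2 S -> @compact_set (prod_UniformSpace R_UniformSpace R_UniformSpace) S.
Proof.
  intros HS I U HU Hcov.
  assert (Hd : forall z : C, exists d, 0 < d /\ (S z -> exists i, forall w : C, Cmod (w - z) < d -> U i w)).
  { intros z. destruct (classic (S z)) as [Hz|Hz].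
    - destruct (Hcov z Hz) as [i Hi]. destruct (open_Cmod (U i) z (HU i) Hi) as [e [He Hw]].
      exists e; split; auto. intros _. exists i; auto.
    - exists 1; split; [lra|tauto]. }
  apply choice in Hd. destruct Hd as [d Hd].
  destruct (compact2_cover S d HS) as [l [Hl1 Hl2]]; [intros; apply Hd|].
  assert (Hsel : exists li : list I, forall c, In c l -> exists i, In i li /\ forall w : C, Cmod (w - c) < d c -> U i w).
  { clear Hl2. induction l as [|a l IH].
    - exists nil. intros c [].
    - destruct IH as [li Hli]; [intros; apply Hl1; right; auto|].
      destruct (proj2 (Hd a) (Hl1 a ltac:(left; auto))) as [i Hi].
      exists (i :: li). intros c [<-|Hc]; [exists i; split; [left; auto|auto]|].
      destruct (Hli c Hc) as [j [Hj1 Hj2]]. exists j; split; [right; auto|auto]. }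
  destruct Hsel as [li Hli]. exists li. intros z Hz. destruct (Hl2 z Hz) as [c [Hc1 Hc2]].
  destruct (Hli c Hc1) as [i [Hi1 Hi2]]. exists i; split; [auto|]. apply Hi2; auto.
Qed.

Lemma list_nat_bound (l : list nat) : exists N, forall n, In n l -> (n <= N)%nat.
Proof.
  induction l as [|a l [N HN]]; [exists 0%nat; intros n []|].
  exists (Nat.max a N). intros n [<-|Hn]; [lia|]. specialize (HN n Hn). lia.
Qed.

(** The sets [V (1/(n+1))] increase with [n], so a finite subcover is contained in a single one of
    them. *)
Lemma compact_uniform (Kc : R3 -> Prop) (V : R -> R3 -> Prop) : @compact_set (prod_UniformSpace (prod_UniformSpace R_UniformSpace R_UniformSpace) R_UniformSpace) Kc ->
  (forall e, 0 < e -> open (V e)) -> (forall e e' x, 0 < e' <= e -> V e x -> V e' x) ->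
  (forall x, Kc x -> exists e, 0 < e /\ V e x) -> exists e, 0 < e /\ forall x, Kc x -> V e x.
Proof.
  intros HK Ho Hm Hc.
  assert (Hp : forall n, 0 < / (INR n + 1)) by (intros n; apply Rinv_0_lt_compat; pose proof (pos_INR n); lra).
  destruct (HK nat (fun n => V (/ (INR n + 1)))) as [l Hl].
  - intros n. apply Ho, Hp.
  - intros x Hx. destruct (Hc x Hx) as [e [He Hv]]. destruct (eventually_INR_ge (/ e)) as [n Hn].
    specialize (Hn n (Nat.le_refl n)). exists n. apply (Hm e); auto. split; [apply Hp|].
    rewrite <- (Rinv_inv e). apply Rinv_le_contravar; [apply Rinv_0_lt_compat; auto|lra].
  - destruct (list_nat_bound l) as [N HN]. exists (/ (INR N + 1)). split; [apply Hp|].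
    intros x Hx. destruct (Hl x Hx) as [n [Hn Hv]]. apply (Hm (/ (INR n + 1))); auto. split; [apply Hp|].
    apply Rinv_le_contravar; [pose proof (pos_INR n); lra|]. apply Rplus_le_compat_r, le_INR; auto.
Qed.

(** A compact subset of [O] keeps a positive distance from the complement, while near the unit
    circle the surface is closer to the complement than that; the preimage is thus bounded away from
    the circle, and it is closed by continuity. *)
Lemma proper_of_boundary (psi : C -> R3) (O : R3 -> Prop) : open O ->
  (forall r, 0 <= r < 1 -> exists M, 0 < M /\ forall z w, Cmod z <= r -> Cmod w <= r ->
    dist3 (psi w) (psi z) <= M * Cmod (w - z)) ->
  (forall e, 0 < e -> exists r, r < 1 /\ forall z, r <= Cmod z < 1 -> exists y, ~ O y /\ dist3 (psi z) y < e) ->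
  proper_into psi O.
Proof.
  intros HO HLip Hbd Kc HKO HK. apply compact2_compact_set.
  (* The surplus [d] makes the condition open in [x], as [compact_uniform] requires. *)
  destruct (compact_uniform Kc (fun e x => exists d, 0 < d /\ forall y, dist3 x y < e + d -> O y)) as [e0 [He0 Hin]].
  - exact HK.
  - intros e He. apply open_of_dist3. intros x [d [Hd Hx]]. exists (d / 2); split; [lra|].
    intros y Hy. exists (d / 2); split; [lra|]. intros w Hw. apply Hx.
    pose proof (dist3_triangle x y w). rewrite dist3_sym in Hy. lra.
  - intros e e' x He [d [Hd Hx]]. exists d; split; auto. intros y Hy; apply Hx; lra.
  - intros x Hx. destruct (open_dist3 O x HO (HKO x Hx)) as [e [He Hy]].
    exists (e / 2); split; [lra|]. exists (e / 2); split; [lra|]. intros y Hd. apply Hy. rewrite dist3_sym. lra.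
  - destruct (Hbd e0 He0) as [r [Hr Hrz]].
    assert (Hlt : forall z, disk z -> Kc (psi z) -> Cmod z < r).
    { intros z Hz HKz. destruct (Rlt_or_le (Cmod z) r) as [H|H]; auto. exfalso.
      apply disk_Cmod in Hz. destruct (Hrz z ltac:(lra)) as [y [Hy1 Hy2]].
      destruct (Hin _ HKz) as [d [Hd Hdy]]. apply Hy1, Hdy. lra. }
    split; [|exists r; intros z [Hz HKz]; left; auto].
    intros z Hz. destruct (classic (disk z)) as [Hdz|Hdz].
    + assert (HnK : ~ Kc (psi z)) by tauto.
      destruct (compact_uniform Kc (fun e x => e < dist3 x (psi z))) as [e [He Hfar]].
      * exact HK.
      * intros e He. apply open_of_dist3. intros x Hx. exists (dist3 x (psi z) - e); split; [lra|].
        intros y Hy. pose proof (dist3_triangle x y (psi z)). rewrite dist3_sym in Hy. lra.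
      * intros e e' x He Hx. lra.
      * intros x Hx. exists (dist3 x (psi z) / 2).
        assert (0 < dist3 x (psi z)); [|lra].
        destruct (Rle_lt_or_eq_dec _ _ (dist3_ge0 x (psi z))) as [H|H]; auto. exfalso.
        apply HnK. replace (psi z) with x; auto. apply R3_ext. intros i.
        pose proof (coord_dist3 i x (psi z)) as Hc. rewrite <- H in Hc.
        pose proof (Rabs_pos (coord i x - coord i (psi z))).
        assert (Z0 : Rabs (coord i x - coord i (psi z)) = 0) by lra. apply Rabs_eq_0 in Z0. lra.
      * assert (Hdz' := proj1 (disk_Cmod z) Hdz). pose proof (Cmod_ge_0 z).
        destruct (HLip ((1 + Cmod z) / 2)) as [M [HM HML]]; [lra|].
        exists (Rmin ((1 - Cmod z) / 2) (e / M)). split; [apply Rmin_glb_lt; [lra|apply Rdiv_lt_0_compat; auto]|].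
        intros w Hw [_ HKw]. pose proof (Rmin_l ((1 - Cmod z) / 2) (e / M)). pose proof (Rmin_r ((1 - Cmod z) / 2) (e / M)).
        pose proof (Cmod_sub_ge w z). specialize (Hfar _ HKw). specialize (HML z w ltac:(lra) ltac:(lra)).
        assert (Hq : Cmod (w - z) < e / M) by lra. apply Rlt_div_r in Hq; [lra|auto].
    + assert (Hge : 1 <= Cmod z) by (destruct (Rle_or_lt 1 (Cmod z)); auto; elim Hdz; apply disk_Cmod; auto).
      exists (1 - r). split; [lra|]. intros w Hw [Hdw HKw]. specialize (Hlt w Hdw HKw).
      pose proof (Cmod_sub_ge z w) as H. rewrite Cmod_sub_sym in H. lra.
Qed.

(** * Assembly *)

(** The stages run in a smaller ball than the cap, so that the limit and the outer points used for
    properness stay where [f] is controlled; lowering [c] secures [c <= C]. *)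
Lemma cap_shrink O p f m nu R1 L c C k R' c' : convex_cap O p f m nu R1 L c C k ->
  0 < R' <= R1 -> 0 < c' <= c -> convex_cap O p f m nu R' L c' C k.
Proof.
  intros [HR1 HL Hc HC Hk Hnu Hfp HO Hlip Hcont Hpos Hquad Hexit] HR Hc'.
  split; auto; try lra.
  - intros y Hy. apply HO; lra.
  - intros y y' Hy Hy'. apply Hlip; lra.
  - intros i y Hy. apply Hcont; lra.
  - intros y Hy. apply Hpos; lra.
  - intros y v Hy Hv Ho. pose proof (Hquad y v ltac:(lra) ltac:(lra) Ho).
    pose proof (Rle_0_sqr (norm3 v)) as Hv2. unfold Rsqr in Hv2. nra.
  - intros y t Ht Hy Hyt. apply Hexit; lra.
Qed.

Record stepdata := { sP : list C; sQ : list C; sF : dir3 -> list C; sa : R; srho : R; sd : R }.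

(** [sd] is the budget for all later perturbations: on the current disc they move the map and change
    the speed by at most [2 sd], hence [f] by at most [2 L sd]. The factors 4 preserve the sign of
    [f] and nondegeneracy in the limit. *)
Definition admissible p f K R1 L (s : stepdata) : Prop :=
  good p f K R1 (sP s) (sQ s) (sF s) (sa s) (srho s) /\ 0 < sd s /\ sd s <= R1 / 4 /\
  (forall z, Cmod z <= 1 -> f (Xmap (sF s) z) <= - (4 * L * sd s)) /\
  (forall z, Cmod z <= 1 -> 4 * sd s <= speed (sF s) z).

(** The barrier is recorded for the new speed minus four times the new budget; the limit metric
    differs from that speed by at most twice the budget, so the barrier still holds, strictly, in
    the limit. *)
Definition refines f ga (s s' : stepdata) : Prop :=
  near_on (srho s) (sd s / 2) (sF s) (sF s') /\ sd s' <= sd s / 2 /\ sa s' = ga * sa s /\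
  srho s < srho s' /\ 1 - srho s' <= (1 - srho s) / 2 /\
  (exists l, 1 <= l /\ barrier (fun z => speed (sF s') z - 4 * sd s') (srho s) (srho s') l) /\
  forall z, srho s <= Cmod z <= 1 -> - (3 * sa s) <= f (Xmap (sF s') z).

Lemma exists_tolerance O p f m nu R1 L c C k K P Q F a rho e : convex_cap O p f m nu R1 L c C k ->
  0 <= K -> good p f K R1 P Q F a rho -> 0 < e -> exists d, 0 < d <= e /\
  (forall z, Cmod z <= 1 -> f (Xmap F z) <= - (4 * L * d)) /\ (forall z, Cmod z <= 1 -> 4 * d <= speed F z).
Proof.
  intros Hcap HK [HS Ha Hrho Hball Hneg Hcirc Hann] He.
  assert (HL := cap_L _ _ _ _ _ _ _ _ _ _ Hcap).
  assert (Hin : forall z, Cmod z <= 1 -> dist3 (Xmap F z) p <= R1).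
  { intros z Hz. specialize (Hball z Hz). pose proof (sqrt_pos a). nra. }
  destruct (cap_comp_lipschitz O p f m nu R1 L c C k F Hcap Hin) as [MF [HMF HLF]].
  destruct (cont_on_min (fun z => 0 <= Cmod z <= 1) (fun z => - f (Xmap F z)) (compact2_annulus 0 1)) as [be [Hbe Hbe2]].
  { apply (cont_on_of_lipschitz _ _ MF HMF). intros z w Hz Hw.
    replace (- f (Xmap F w) - - f (Xmap F z)) with (f (Xmap F z) - f (Xmap F w)) by ring.
    rewrite (Cmod_sub_sym w). apply HLF; lra. }
  { intros z Hz. specialize (Hneg z ltac:(lra)). lra. }
  destruct (speed_min P Q F HS) as [s [Hs Hmin]].
  set (d := Rmin e (Rmin (be / (4 * L)) (s / 4))).
  assert (Hd1 : d <= e) by apply Rmin_l.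
  assert (Hd2 : d <= be / (4 * L)) by (unfold d; eapply Rle_trans; [apply Rmin_r|apply Rmin_l]).
  assert (Hd3 : d <= s / 4) by (unfold d; eapply Rle_trans; [apply Rmin_r|apply Rmin_r]).
  exists d. split; [split; auto|split].
  - unfold d; repeat apply Rmin_glb_lt; try lra. apply Rdiv_lt_0_compat; lra.
  - intros z Hz. specialize (Hbe2 z ltac:(split; [apply Cmod_ge_0|auto])). apply Rle_div_r in Hd2; lra.
  - intros z Hz. specialize (Hmin z Hz). lra.
Qed.

Lemma refining_sequence O p f m nu R1 L c C k : convex_cap O p f m nu R1 L c C k -> c <= C ->
  exists K ga (u : nat -> stepdata), 0 <= K /\ 0 < ga < 1 /\
    forall n, admissible p f K R1 L (u n) /\ refines f ga (u n) (u (S n)).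
Proof.
  intros Hcap HcC.
  pose proof (cap_c _ _ _ _ _ _ _ _ _ _ Hcap) as Hc. pose proof (cap_C _ _ _ _ _ _ _ _ _ _ Hcap) as HC.
  pose proof (cap_R _ _ _ _ _ _ _ _ _ _ Hcap) as HR1.
  set (g := 1 - c / (2 * C)).
  assert (Hg : 0 < g < 1).
  { unfold g. assert (0 < c / (2 * C)) by (apply Rdiv_lt_0_compat; lra).
    assert (c / (2 * C) <= 1 / 2) by (apply Rle_div_l; lra). lra. }
  set (ga := (1 + g) / 2). assert (Hga : g < ga < 1) by (unfold ga; lra).
  assert (Hsg : 0 < sqrt ga < 1).
  { split; [apply sqrt_lt_R0; lra|]. rewrite <- sqrt_1 at 1. apply sqrt_lt_1_alt. lra. }
  assert (Hi : 0 < / sqrt C) by (apply Rinv_0_lt_compat, sqrt_lt_R0; auto).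
  (* The sum of the geometric series of displacements: they are bounded by [(1/sqrt C + 1) sqrt a],
     and [sqrt a] has ratio [sqrt ga]. *)
  set (K := (/ sqrt C + 1) / (1 - sqrt ga)).
  assert (HK1 : / sqrt C + 1 <= K * (1 - sqrt ga)) by (unfold K; apply Req_le; field; split; try lra;
     apply Rgt_not_eq, sqrt_lt_R0; auto).
  assert (HK0 : 0 < K) by (apply Rdiv_lt_0_compat; lra).
  assert (HK2 : / sqrt C + 1 <= K) by nra.
  exists K, ga.
  (* Dependent pairs carry admissibility along, so that a choice function can be iterated. *)
  assert (Hstep : forall s : {s | admissible p f K R1 L s}, exists s' : {s | admissible p f K R1 L s},
    refines f ga (proj1_sig s) (proj1_sig s')).
  { intros [s [Hgood [Hd [HdR [Hf Hsp]]]]]. simpl.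
    destruct (main_step O p f m nu R1 L c C k K ga Hcap HcC Hga HK1 HK2 _ _ _ _ _ (sd s / 2) Hgood)
      as [P' [Q' [F' [rho' [tol [Hg' [Hn [Hr [Hr2 [Ht [Hb Hl]]]]]]]]]]]; [lra|].
    destruct (exists_tolerance O p f m nu R1 L c C k K P' Q' F' _ rho' (Rmin (sd s / 2) (tol / 4)) Hcap
      ltac:(lra) Hg') as [d [Hd0 [Hd1 Hd2]]]; [apply Rmin_glb_lt; lra|].
    pose proof (Rmin_l (sd s / 2) (tol / 4)). pose proof (Rmin_r (sd s / 2) (tol / 4)).
    assert (Hadm : admissible p f K R1 L {| sP := P'; sQ := Q'; sF := F'; sa := ga * sa s; srho := rho'; sd := d |}).
    { split; [exact Hg'|]. simpl. split; [lra|]. split; [lra|]. split; auto. }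
    exists (exist _ _ Hadm). simpl. unfold refines; simpl.
    split; [auto|]. split; [lra|]. split; [auto|]. split; [auto|]. split; [auto|]. split; [|auto].
    destruct Hb as [l [Hl1 Hb]]. exists l. split; auto. apply (barrier_mono (fun z => speed F' z - tol)); auto.
    intros z _. lra. }
  apply choice in Hstep. destruct Hstep as [next Hnext].
  destruct (initial_stage O p f m nu R1 L c C k K Hcap HK0) as [P [Q [F [a Hgood]]]].
  destruct (exists_tolerance O p f m nu R1 L c C k K P Q F a (1 / 2) (R1 / 4) Hcap ltac:(lra) Hgood) as [d [Hd0 [Hd1 Hd2]]]; [lra|].
  assert (Hadm : admissible p f K R1 L {| sP := P; sQ := Q; sF := F; sa := a; srho := 1 / 2; sd := d |}).
  { split; [exact Hgood|]. simpl. split; [lra|]. split; [lra|]. split; auto. }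
  set (v := fix v n := match n with O => exist _ _ Hadm | S n' => next (v n') end).
  exists (fun n => proj1_sig (v n)). split; [lra|]. split; [lra|]. intros n. split; [exact (proj2_sig (v n))|].
  apply Hnext.
Qed.

Lemma annulus_index (rho : nat -> R) n0 t : (forall n, rho n <= rho (S n)) -> rho n0 <= t ->
  forall N, t <= rho N -> exists n, (n0 <= n)%nat /\ rho n <= t <= rho (S n).
Proof.
  intros Hm H0.
  assert (Hle : forall n m, (n <= m)%nat -> rho n <= rho m).
  { intros n m Hnm. induction Hnm; [lra|]. specialize (Hm m). lra. }
  induction N as [|N IH]; intros Ht.
  - exists n0. split; [auto|]. specialize (Hle 0%nat n0 ltac:(lia)). specialize (Hm n0). lra.
  - destruct (Rle_or_lt t (rho N)) as [H|H]; [auto|].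
    destruct (Nat.le_gt_cases n0 N) as [Hn|Hn].
    + exists N. split; [auto|lra].
    + exists n0. split; [auto|]. specialize (Hle (S N) n0 ltac:(lia)). specialize (Hm n0). lra.
Qed.

Theorem theoremC (O : R3 -> Prop) :
  bounded_domain O -> smooth_boundary O ->
  exists psi : R2 -> R3,
    (forall p, disk p -> O (psi p)) /\
    minimal_immersion psi /\ complete_immersion psi /\ proper_into psi O.
Proof.
  intros HO Hsm. destruct (exists_convex_cap O HO Hsm) as [p [f [m [nu [R1 [L [c [C [k Hcap]]]]]]]]].
  assert (HR1 := cap_R _ _ _ _ _ _ _ _ _ _ Hcap). assert (HL := cap_L _ _ _ _ _ _ _ _ _ _ Hcap).
  assert (Hk := cap_k _ _ _ _ _ _ _ _ _ _ Hcap). assert (Hc := cap_c _ _ _ _ _ _ _ _ _ _ Hcap).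
  assert (HC := cap_C _ _ _ _ _ _ _ _ _ _ Hcap).
  (* Part of the radius is kept in reserve: the stages stay within [R1/2] of [p] and the limit
     within [3 R1/4]. *)
  assert (Hcap' : convex_cap O p f m nu (R1 / 2) L (Rmin c C) C k).
  { apply (cap_shrink O p f m nu R1 L c C k); [auto|lra|]. split; [apply Rmin_glb_lt; auto|apply Rmin_l]. }
  destruct (refining_sequence O p f m nu (R1 / 2) L _ C k Hcap' (Rmin_r c C)) as [K [ga [u [HK [Hga Hu]]]]].
  set (F := fun n => sF (u n)). set (rho := fun n => srho (u n)). set (d := fun n => sd (u n)).
  set (a := fun n => sa (u n)).
  assert (Hnest : nested F rho d).
  { intros n. destruct (Hu n) as [[Hg [Hd _]] [N1 [N2 [N3 [N4 [N5 _]]]]]]. destruct (Hu (S n)) as [[Hg' _] _].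
    pose proof (good_rho _ _ _ _ _ _ _ _ _ Hg). pose proof (good_rho _ _ _ _ _ _ _ _ _ Hg').
    unfold F, rho, d. repeat split; auto; lra. }
  assert (Hrho : forall n, 0 < rho n < 1).
  { intros n. destruct (Hu n) as [[Hg _] _]. apply (good_rho _ _ _ _ _ _ _ _ _ Hg). }
  assert (Hd : forall n, 0 < d n <= R1 / 8).
  { intros n. destruct (Hu n) as [[_ [H1 [H2 _]]] _]. unfold d. lra. }
  assert (Hst : forall n, stage (sP (u n)) (sQ (u n)) (F n)).
  { intros n. destruct (Hu n) as [[Hg _] _]. apply (good_stage _ _ _ _ _ _ _ _ _ Hg). }
  assert (Hsp : forall n z, Cmod z <= 1 -> 4 * d n <= speed (F n) z) by (intros n; apply (Hu n)).
  assert (Hneg : forall n z, Cmod z <= 1 -> f (Xmap (F n) z) <= - (4 * L * d n)) by (intros n; apply (Hu n)).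
  assert (Hlim : forall r, r < 1 -> exists N, r <= rho N).
  { intros r Hr. destruct (nested_rho_lim F rho d r Hnest Hr) as [N HN]. exists N. apply HN; lia. }
  destruct (limit_map F rho d Hnest) as [T [HT HTl]].
  assert (HlamW : forall n z, Cmod z <= rho n -> Rabs (lam (limW T z) - speed (F n) z) <= 2 * d n).
  { intros n z Hz. apply lam_close. intros i. apply (HTl n z i Hz). }
  assert (Hdist : forall n z, Cmod z <= rho n -> dist3 (limX T z) (Xmap (F n) z) <= 2 * d n).
  { intros n z Hz. unfold dist3, limX, Xmap. rewrite <- revec_sub. apply revec_le.
    intros i. apply (HTl n z i Hz). }
  assert (Hball : forall n z, Cmod z <= 1 -> dist3 (Xmap (F n) z) p <= R1 / 2).
  { intros n z Hz. destruct (Hu n) as [[Hg _] _].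
    pose proof (good_ball _ _ _ _ _ _ _ _ _ Hg z Hz). pose proof (sqrt_pos (sa (u n))). unfold F. nra. }
  assert (Hin : forall z, Cmod z < 1 -> dist3 (limX T z) p <= 3 * R1 / 4).
  { intros z Hz. destruct (Hlim (Cmod z) Hz) as [N HN]. specialize (Hdist N z HN).
    specialize (Hball N z ltac:(lra)). specialize (Hd N).
    pose proof (dist3_triangle (limX T z) (Xmap (F N) z) p). lra. }
  assert (Hfclose : forall n z, Cmod z <= rho n -> Rabs (f (limX T z) - f (Xmap (F n) z)) <= 2 * L * d n).
  { intros n z Hz. assert (Hz1 : Cmod z < 1) by (specialize (Hrho n); lra).
    eapply Rle_trans; [apply (cap_lip _ _ _ _ _ _ _ _ _ _ Hcap)|].
    - specialize (Hball n z ltac:(lra)). lra.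
    - specialize (Hin z Hz1). lra.
    - specialize (Hdist n z Hz). nra. }
  assert (Hnull : forall z, disk z -> null (limW T z)).
  { intros z Hz. apply disk_Cmod in Hz. 
    destruct (nested_rho_lim F rho d (Cmod z) Hnest Hz) as [N1 HN1].
    apply (null_limit (fun n i => peval (pder (F n i)) z)).
    - intros n. destruct (Hst n) as [HF _]. unfold null. rewrite !HF. apply (null_qv (peval (sP (u n)) z) (peval (sQ (u n)) z)).
    - intros e He. destruct (nested_d_lim F rho d e Hnest He) as [N2 HN2].
      exists (N1 + N2)%nat. intros i. specialize (HN1 (N1 + N2)%nat ltac:(lia)). specialize (HN2 (N1 + N2)%nat ltac:(lia)).
      destruct (HTl (N1 + N2)%nat z i HN1) as [_ H]. unfold limW. lra. }
  assert (HWpos : forall n z, Cmod z <= rho n -> d n < lam (limW T z)).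
  { intros n z Hz. specialize (HlamW n z Hz). apply Rabs_le_between in HlamW.
    specialize (Hsp n z ltac:(specialize (Hrho n); lra)). specialize (Hd n). lra. }
  assert (Hlam : forall z, disk z -> 0 < lam (limW T z)).
  { intros z Hz. apply disk_Cmod in Hz. destruct (Hlim (Cmod z) Hz) as [N HN].
    specialize (HWpos N z HN). specialize (Hd N). lra. }
  assert (Hexp : forall z, Cmod z < 1 -> exists dl B, 0 < dl /\ 0 <= B /\ forall w, Cmod (w - z) < dl ->
    Rabs (dist3 (limX T w) (limX T z) - lam (limW T z) * Cmod (w - z)) <= B * Cmod (w - z) ^ 2).
  { intros z Hz. apply limX_expansion; auto. apply Hnull, disk_Cmod, Hz. }
  assert (HLip := fun r (Hr : 0 <= r < 1) => limX_lipschitz T r HT Hr).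
  exists (limX T). split; [|split; [|split]].
  - intros z Hz. apply disk_Cmod in Hz. destruct (Hlim (Cmod z) Hz) as [N HN].
    apply (cap_O _ _ _ _ _ _ _ _ _ _ Hcap); [specialize (Hin z Hz); lra|].
    specialize (Hfclose N z HN). apply Rabs_le_between in Hfclose. specialize (Hneg N z ltac:(lra)).
    assert (0 < L * d N) by (apply Rmult_lt_0_compat; auto; apply Hd). lra.
  - apply limX_minimal; auto.
  - apply (complete_of_barriers (limX T) (fun z => lam (limW T z)) rho); auto.
    + intros n. destruct (Hu n) as [_ [_ [_ [_ [_ [_ [[l [Hl Hb]] _]]]]]]].
      destruct (barrier_dominated (limX T) (fun z => lam (limW T z)) _ _ _ _ Hb Hexp) as [g [G1 [G2 G3]]].
      * intros z Hz. specialize (HlamW (S n) z ltac:(apply Hz)). apply Rabs_le_between in HlamW.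
        specialize (Hd (S n)). unfold F, d in *. lra.
      * exists l, g. auto.
    + intros n. exists (d n). split; [apply Hd|]. intros z Hz. apply HWpos, Hz.
  - apply proper_of_boundary; [apply HO|auto|]. intros e He.
    (* The bound [R1/4] keeps the outward translate in the ball where the sign of [f] decides
       membership in [O]. *)
    set (e' := Rmin e (R1 / 4)). assert (He' : 0 < e') by (apply Rmin_glb_lt; lra).
    assert (Ha : forall n, a n = a 0%nat * ga ^ n).
    { intros n. induction n as [|n IH]; [simpl; ring|]. destruct (Hu n) as [_ [_ [_ [E _]]]].
      unfold a in *. rewrite E, IH. simpl; ring. }
    assert (Ha0 : 0 < a 0%nat) by (destruct (Hu 0%nat) as [[Hg _] _]; apply (good_a _ _ _ _ _ _ _ _ _ Hg)).
    destruct (eventually_pow_le ga (k * e' / 8 / a 0%nat)) as [N1 HN1]; [lra| |].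
    { apply Rdiv_lt_0_compat; auto. assert (0 < k * e') by (apply Rmult_lt_0_compat; auto). lra. }
    destruct (nested_d_lim F rho d (k * e' / (8 * L)) Hnest) as [N2 HN2].
    { apply Rdiv_lt_0_compat; [apply Rmult_lt_0_compat; auto|lra]. }
    set (n0 := (N1 + N2)%nat). exists (rho n0). split; [apply Hrho|]. intros z Hz.
    destruct (Hlim (Cmod z) ltac:(lra)) as [N HN].
    (* On the annulus of index [n >= n0] containing [z], stage [n + 1] satisfies [f >= -3 a n] and
       differs from the limit only within its budget. *)
    destruct (annulus_index rho n0 (Cmod z)) with (N := N) as [n [Hn Hzn]]; auto; [|lra|].
    { intros j. destruct (Hnest j) as [_ [_ [_ [_ [H _]]]]]. lra. }
    destruct (Hu n) as [_ [_ [_ [_ [_ [_ [_ Hlow]]]]]]]. specialize (Hlow z). fold (a n) (rho n) (F (S n)) in Hlow.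
    specialize (Hlow ltac:(lra)). specialize (Hfclose (S n) z ltac:(lra)). apply Rabs_le_between in Hfclose.
    assert (Han : 8 * a n <= k * e').
    { rewrite Ha. specialize (HN1 n ltac:(unfold n0 in Hn; lia)). apply Rle_div_r in HN1; lra. }
    assert (Hdn : 8 * (L * d (S n)) <= k * e').
    { specialize (HN2 (S n) ltac:(unfold n0 in Hn; lia)). apply Rle_div_r in HN2; lra. }
    pose proof (Rmin_l e (R1 / 4)) as M1. pose proof (Rmin_r e (R1 / 4)) as M2. fold e' in M1, M2.
    assert (Hnu : norm3 (scal3 (3 * e' / 4) nu) = 3 * e' / 4).
    { rewrite norm3_scal, (cap_nu _ _ _ _ _ _ _ _ _ _ Hcap), Rabs_pos_eq; lra. }
    (* Moving outwards by [3e'/4] raises [f] by at least [3 k e'/4], from a value of at least [-3 a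
       n - 2 L d (n+1) >= -3 k e'/8 - k e'/4]. The result is positive, so the translate lies outside
       [O]. *)
    exists (add3 (limX T z) (scal3 (3 * e' / 4) nu)).
    assert (Hy : dist3 (add3 (limX T z) (scal3 (3 * e' / 4) nu)) p <= R1).
    { pose proof (dist3_triangle (add3 (limX T z) (scal3 (3 * e' / 4) nu)) (limX T z) p) as H.
      rewrite dist3_add, Hnu in H. specialize (Hin z ltac:(lra)). lra. }
    split.
    + intros Hin2. apply (cap_O _ _ _ _ _ _ _ _ _ _ Hcap) in Hin2; [|exact Hy].
      pose proof (cap_exit _ _ _ _ _ _ _ _ _ _ Hcap (limX T z) (3 * e' / 4) ltac:(lra)
        ltac:(specialize (Hin z ltac:(lra)); lra) Hy). lra.
    + rewrite dist3_sym, dist3_add, Hnu. lra.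
Qed.
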